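(* Let $k\ge2$ and $n\ge1$ be integers and suppose $X\subseteq[0,1]^n$ is $k$-automatic. There exists a set $A\subseteq[0,1]$ definable in the first-order structure $(\mathbb{R},<,+,X)$ such that $d_B(A)\ne d_H(A)$ if and only if either a unary Cantor set (a Cantor set $C\subseteq\mathbb{R}$) is definable in $(\mathbb{R},<,+,X)$, or a set (a subset of $\mathbb{R}$) that is both dense and codense on an interval is definable in $(\mathbb{R},<,+,X)$.
   Context: A Büchi automaton is a 5-tuple $\mathcal{A}=(Q,\Sigma,\delta,S,F)$ with $Q$ a finite set of states, $\Sigma$ a finite alphabet, $\delta:Q\times\Sigma\to\mathcal{P}(Q)$, $S\subseteq Q$ nonempty (start states), $F\subseteq Q$ (accept states). A run of $w=w_1w_2\cdots\in\Sigma^\omega$ is a sequence $q_0,q_1,\dots$ of states with $q_0\in S$ and $q_i\in\delta(q_{i-1},w_i)$ for $i\ge1$; it is accepting if $q_i\in F$ for infinitely many $i$. The $\omega$-language recognized by $\mathcal{A}$ is the set of infinite strings having an accepting run. Write $[k]=\{0,\dots,k-1\}$. For $w=w_0w_1\cdots\in[k]^\omega$, $\nu_k(w)=\sum_{i\ge0}w_ik^{-(i+1)}$; on $([k]^n)^\omega$, $\nu_k$ is applied coordinatewise. A set $X\subseteq[0,1]^n$ is $k$-automatic if there is a Büchi automaton with alphabet $[k]^n$ recognizing the maximal $L\subseteq([k]^n)^\omega$ with $X=\nu_k(L)$, i.e. the set of all base-$k$ representations of elements of $X$. The structure $(\mathbb{R},<,+,X)$ is the ordered additive group of reals expanded by an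 $n$-ary predicate for $X$. Definable means first-order definable, with the conventions of Marker's textbook ''Model Theory: An Introduction'', under which parameters from the structure are allowed. A Cantor set is a nonempty compact set with no isolated points and no interior. A set $D\subseteq\mathbb{R}$ is dense and codense on an interval $J$ (with nonempty interior) if both $D\cap J$ and $J\setminus D$ are dense in $J$. For nonempty bounded $Y\subseteq\mathbb{R}$, let $N(Y,\epsilon)$ be the number of intervals $[z\epsilon,(z+1)\epsilon]$, $z\in\mathbb{Z}$, required to cover $Y$; the box-counting dimension is $d_B(Y)=\lim_{\epsilon\to0}\log N(Y,\epsilon)/\log(1/\epsilon)$ when this limit exists. The $s$-dimensional Hausdorff measure is $\mu_H^s(Y)=\lim_{\epsilon\to0}\inf\{\sum_i(\operatorname{Diam}U_i)^s:\{U_i\}\text{ a countable cover of }Y\text{ by sets of diameter at most }\epsilon\}$, and the Hausdorff dimension $d_H(Y)$ is the unique $s$ such that $\mu_H^{s'}(Y)=\infty$ for $s'<s$ and $\mu_H^{s'}(Y)=0$ for $s'>s$. *)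

(* Defs.v *)
From mathcomp Require Export all_boot all_order all_algebra.
From mathcomp Require Export finmap all_classical all_reals all_analysis.

Set Implicit Arguments.
Unset Strict Implicit.
Unset Printing Implicit Defensive.

Export Order.TTheory GRing.Theory Num.Theory.
Export numFieldNormedType.Exports.
Global Open Scope classical_set_scope.
Global Open Scope ring_scope.

Record buchi (Sigma : finType) := Buchi {
  state : finType;
  delta : state -> Sigma -> {set state};
  start : {set state};
  accept : {set state};
  start_neq0 : start != finset.set0 }.

Definition is_run (Sigma : finType) (A : buchi Sigma)
    (w : nat -> Sigma) (q : nat -> state A) : Prop :=
  q 0%N \in start A /\ forall i, q i.+1 \in delta (q i) (w i).

Definition accepting (Sigma : finType) (A : buchi Sigma)
    (q : nat -> state A) : Prop :=
  forall m, exists2 i, (m <= i)%N & q i \in accept A.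

Definition recognized (Sigma : finType) (A : buchi Sigma) : set (nat -> Sigma) :=
  [set w | exists2 q : nat -> state A, is_run w q & accepting q].

(* The alphabet [k]^n is the type of row vectors over 'I_k. *)
Definition nu (R : realType) (k n : nat) (w : nat -> 'rV['I_k]_n) : 'rV[R]_n :=
  \row_j limn (fun m => \sum_(0 <= i < m) (w i 0 j)%:R / k%:R ^+ i.+1 : R).

Definition unit_cube (R : realType) (n : nat) : set 'rV[R]_n :=
  [set x | forall j, 0 <= x 0 j <= 1].

(* The maximal L is the full preimage of X under nu. *)
Definition automatic (R : realType) (k n : nat) (X : set 'rV[R]_n) : Prop :=
  exists A : buchi 'rV['I_k]_n,
    @nu R k n @` recognized A = X /\
    forall L : set (nat -> 'rV['I_k]_n),
      @nu R k n @` L = X -> L `<=` recognized A.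

(* First-order language with a binary relation <, a binary function + and an
   n-ary relation symbol; variables are indexed by nat. *)
Inductive term : Type :=
| Var of nat
| Add of term & term.

Inductive formula (n : nat) : Type :=
| FEq of term & term
| FLt of term & term
| FPred of n.-tuple term
| FNot of formula n
| FAnd of formula n & formula n
| FOr of formula n & formula n
| FEx of nat & formula n
| FAll of nat & formula n.

Fixpoint eval (R : realType) (e : nat -> R) (t : term) : R :=
  match t with
  | Var i => e i
  | Add t1 t2 => eval e t1 + eval e t2
  end.

Fixpoint sat (R : realType) (n : nat) (X : set 'rV[R]_n) (e : nat -> R)
    (phi : formula n) : Prop :=
  match phi with
  | FEq t1 t2 => eval e t1 = eval e t2
  | FLt t1 t2 => eval e t1 < eval e t2
  | FPred ts => X (\row_j eval e (tnth ts j))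
  | FNot phi1 => ~ sat X e phi1
  | FAnd phi1 phi2 => sat X e phi1 /\ sat X e phi2
  | FOr phi1 phi2 => sat X e phi1 \/ sat X e phi2
  | FEx i phi1 => exists x : R, sat X [eta e with i |-> x] phi1
  | FAll i phi1 => forall x : R, sat X [eta e with i |-> x] phi1
  end.

(* Definability with parameters of a subset of the line in (R, <, +, X): the
   free variable is the one of index 0, and e supplies the parameters, i.e. the
   values of the finitely many other free variables of phi. *)
Definition definable (R : realType) (n : nat) (X : set 'rV[R]_n) (D : set R) :
    Prop :=
  exists (phi : formula n) (e : nat -> R),
    D = [set x | sat X [eta e with 0%N |-> x] phi].

Definition cantor_set (R : realType) (C : set R) : Prop :=
  [/\ C !=set0, compact C, isolated C = set0 & interior C = set0].

Definition dense_codense_on (R : realType) (J D : set R) : Prop :=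
  J `<=` closure (D `&` J) /\ J `<=` closure (J `\` D).

(* The least cardinality of a finite set of grid intervals covering Y. For
   bounded Y and e > 0 such sets exist and the infimum is a minimum. *)
Definition cover_number (R : realType) (Y : set R) (e : R) : R :=
  inf [set (#|` Z|)%:R | Z in [set Z : {fset int} |
    Y `<=` \bigcup_(z in [set` Z]) `[z%:~R * e, (z + 1)%:~R * e]%classic]].

(* box_dim Y d : the box-counting dimension of Y exists and is equal to d. *)
Definition box_dim (R : realType) (Y : set R) (d : R) : Prop :=
  [/\ Y !=set0, bounded_set Y &
      ln (cover_number Y e) / ln e^-1 @[e --> 0^'+] --> d].

Definition diam (R : realType) (U : set R) : \bar R :=
  ereal_sup [set `|x - y|%:E | x in U & y in U].

(* Countable covers are indexed by nat; a finite cover is padded with empty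
   sets, which do not contribute to the sum, even for s = 0. *)
Definition hausdorff_content (R : realType) (s : R) (Y : set R) (e : R) :
    \bar R :=
  ereal_inf [set (\esum_(i in [set i | U i !=set0]) poweR (diam (U i)) s)%E |
    U in [set U : nat -> set R |
      Y `<=` \bigcup_i U i /\ forall i, (diam (U i) <= e%:E)%E]].

Definition hausdorff_measure (R : realType) (s : R) (Y : set R) : \bar R :=
  lim (hausdorff_content s Y e @[e --> 0^'+]).

Definition hausdorff_dim (R : realType) (Y : set R) (d : R) : Prop :=
  0 <= d /\ forall s, 0 <= s ->
    (s < d -> hausdorff_measure s Y = +oo%E) /\
    (d < s -> hausdorff_measure s Y = 0%E).

(* Main.v *)
Require Import Defs.
From mathcomp Require Import zify lra ring.

(** Reals are written in base k, and so are the parameters of a formula. As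
    recognizable languages of infinite words are closed under Boolean operations
    and projections, every definable relation is recognized by a finite monoid
    ([rep_sat]). This has three consequences. A first-order property that holds for
    some parameters holds for ultimately periodic ones ([transfer]). For such
    parameters, past the preperiod, the base-k^t digits of the points of a definable
    set form a recognizable language ([pure_cells]). In particular a definable
    subset of the unit interval looks in only finitely many ways in the cells of all
    scales ([periodic_fintypes]).

    A definable Cantor set gives a set with different dimensions: by transfer it may
    be taken to have periodic parameters. The numbers of cells that it meets are
    then submultiplicative up to a constant, and they grow exponentially since
    the set is perfect, so that any dense subset of it has a positive box-counting
    dimension ([perfect_box_dim]). The left endpoints of its gaps form a definable
    dense subset, which is countable and thus of Hausdorff dimension 0.

    A dense and codense definable set gives such a set too: in some interval, the
    digits of the points of the set, or those of the points of its complement,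
    contain a certain word only finitely often ([rarely_dichotomy]). These points
    form a dense set, of box-counting dimension 1, but their Hausdorff dimension is
    less than 1 ([rare_measure0]).

    Conversely, let A be a definable set with different dimensions, and suppose that
    no definable set is a Cantor set or dense and codense on an interval. A contains
    no interval, as its dimensions would be 1; so A is codense, hence nowhere dense.
    Consider the runs of the monoid on the words of A. If no state carries two
    different loops, the words of A have polynomially many prefixes of each length
    ([few_prefixes]) and both dimensions of A are 0. So some state carries two loops
    of the same length. Repeating them, and with them the digits of the parameters,
    gives parameters q + c / k^(h N) such that the sets defined by these parameters
    approximate the points of a perfect set P as N grows ([pump_branch],
    [branches_perfect]). The multiples k^(-h N) of c must be captured by a definable
    set. For this, let z be an isolated point of the derived set of the closure of A,
    which exists because this derived set is not a Cantor set. The distances from z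
    to the points of the closure form a discrete definable set D that accumulates
    at 0. By transfer and pumping, D may be taken to contain a geometric progression
    of ratio k^(-b) ([discrete_progression]). The union over y in D of the nowhere
    dense sets with parameters q + a y, for a suitable rational vector a, is a
    definable countable union, thus codense, thus nowhere dense; and P lies in its
    closure Y. As Y looks in only finitely many ways in the cells, taking derived
    sets of Y becomes stationary after finitely many steps
    ([fintypes_iterD_stable]). The set so obtained contains P and is a definable
    Cantor set, a contradiction. *)

Set Implicit Arguments.
Unset Strict Implicit.
Unset Printing Implicit Defensive.

Local Open Scope nat_scope.

(** * Infinite words *)

Definition seg (A : Type) (w : nat -> A) (i j : nat) : seq A :=
  [seq w n | n <- iota i (j - i)].

Definition cuts (f : nat -> nat) : Prop := f 0 = 0 /\ forall i, f i < f i.+1.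

Definition wcat (A : Type) (u : seq A) (w : nat -> A) (n : nat) : A :=
  if n < size u then nth (w 0) u n else w (n - size u).

Section Segments.
Variables (A B : Type).
Implicit Types (w : nat -> A) (u v : seq A).

Lemma size_seg w i j : size (seg w i j) = j - i.
Proof. by rewrite size_map size_iota. Qed.

Lemma seg_cat w i j l : i <= j -> j <= l -> seg w i j ++ seg w j l = seg w i l.
Proof.
move=> ij jl; rewrite /seg -map_cat; congr map.
by rewrite -{2}(subnKC ij) -iotaD; congr iota; lia.
Qed.

Lemma eq_seg w w' i j :
  (forall n, i <= n < j -> w n = w' n) -> seg w i j = seg w' i j.
Proof.
move=> ww'; rewrite /seg.
have : forall n, n \in iota i (j - i) -> w n = w' n.
  by move=> n; rewrite mem_iota => H; apply: ww'; lia.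
elim: (iota _ _) => //= a s IH H; rewrite H ?mem_head // IH // => n ns.
by apply: H; rewrite in_cons ns orbT.
Qed.

Lemma nth_seg w d i j n : n < j - i -> nth d (seg w i j) n = w (i + n).
Proof. by move=> H; rewrite (nth_map 0) ?size_iota // nth_iota. Qed.

Lemma eq_seg_shift w w' i j i' :
  (forall n, n < j - i -> w (i + n) = w' (i' + n)) ->
  seg w i j = seg w' i' (i' + (j - i)).
Proof.
move=> ww'; apply: (@eq_from_nth _ (w 0)); rewrite !size_seg ?addKn // => n nl.
by rewrite !nth_seg ?addKn // ww'.
Qed.

Lemma seg_nil w i : seg w i i = [::].
Proof. by rewrite /seg subnn. Qed.

Lemma seg1 w i : seg w i i.+1 = [:: w i].
Proof. by rewrite /seg subSnn. Qed.

Lemma map_seg (h : A -> B) w i j : map h (seg w i j) = seg (h \o w) i j.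
Proof. by rewrite /seg -map_comp. Qed.

Lemma seg_wcat0 u w : seg (wcat u w) 0 (size u) = u.
Proof.
apply: (@eq_from_nth _ (w 0)); rewrite size_seg subn0 // => n nu.
by rewrite nth_seg ?subn0 // add0n /wcat nu.
Qed.

Lemma wcat_addn u w n : wcat u w (size u + n) = w n.
Proof. by rewrite /wcat ifF ?addKn //; apply/negbTE; rewrite -leqNgt leq_addr. Qed.

Lemma wcat_seg w n : wcat (seg w 0 n) (fun i => w (n + i)) = w.
Proof.
apply/funext => i; rewrite /wcat size_seg subn0; case: ltnP => H.
  by rewrite nth_seg ?subn0.
by rewrite subnKC.
Qed.

End Segments.

Section Cuts.
Implicit Types (f g : nat -> nat).

Lemma incr_lt f : (forall i, f i < f i.+1) -> forall i j, i < j -> f i < f j.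
Proof.
move=> fi i j; elim: j => // j IH; rewrite ltnS leq_eqVlt => /orP[/eqP->//|].
by move=> /IH /ltn_trans; apply.
Qed.

Lemma incr_le f : (forall i, f i < f i.+1) -> forall i j, i <= j -> f i <= f j.
Proof.
move=> fi i j; rewrite leq_eqVlt => /orP[/eqP->//|/(incr_lt fi)]; exact: ltnW.
Qed.

Lemma incr_ge f : (forall i, f i < f i.+1) -> forall i, i <= f i.
Proof. by move=> fi; elim=> // i IH; exact: leq_ltn_trans (fi i). Qed.

Lemma incr_block f n : (forall i, f i < f i.+1) -> f 0 <= n ->
  exists i, f i <= n < f i.+1.
Proof.
move=> fi f0n; have ex : exists i, n < f i.+1.
  by exists n; exact: incr_ge.
case: (ex_minnP ex) => -[|i] Hi imin; first by exists 0; rewrite f0n.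
exists i.+1; rewrite Hi andbT leqNgt; apply/negP => /imin; by rewrite ltnn.
Qed.

Lemma glue (A : Type) (g : nat -> nat) (v : nat -> seq A) :
  cuts g -> (forall i, size (v i) = g i.+1 - g i) ->
  exists w, forall i, seg w (g i) (g i.+1) = v i.
Proof.
move=> [g0 gi] vg.
have d : A by case: (v 0) (vg 0) => // H; have := gi 0; rewrite -subn_gt0 -H.
have idx n : {i | g i <= n < g i.+1}.
  by apply/cid/incr_block => //; rewrite g0.
exists (fun n => nth d (v (sval (idx n))) (n - g (sval (idx n)))) => i.
apply: (@eq_from_nth _ d); rewrite size_seg ?vg // => n nl.
rewrite nth_seg //; case: (idx _) => j /= /andP[H1 H2].
have -> : j = i.
  have := gi i; case: (ltngtP i j) => // H3.
    by have := incr_le gi H3; lia.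
  by have := incr_le gi H3; lia.
by rewrite addKn.
Qed.

End Cuts.

(** * Recognition of languages of infinite words by finite monoids *)

(** The elements of M stand for the elements of a finite monoid. The product is
    left implicit: a map is compatible with concatenation exactly when the
    product of the values is well defined. *)
Definition compatible (A M : Type) (mu : seq A -> M) : Prop :=
  forall u u' v v', mu u = mu u' -> mu v = mu v' -> mu (u ++ v) = mu (u' ++ v').

(** The two words play the same role, so this notion is stable under complement. *)
Definition saturates (A M : Type) (mu : seq A -> M) (L : (nat -> A) -> Prop) :=
  forall w w' f g, cuts f -> cuts g ->
    (forall i, mu (seg w (f i) (f i.+1)) = mu (seg w' (g i) (g i.+1))) ->
    L w -> L w'.

Definition recognizes (A M : Type) (mu : seq A -> M) L :=
  compatible mu /\ saturates mu L.

Definition recog (A : Type) (L : (nat -> A) -> Prop) : Prop :=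
  exists (M : finType) (mu : seq A -> M), recognizes mu L.

Section RecogTheory.
Variables (A B : Type).
Implicit Types (L : (nat -> A) -> Prop) (M : finType).

Lemma recog_ext L L' : (forall w, L w <-> L' w) -> recog L -> recog L'.
Proof.
move=> LL' [M [mu [c s]]]; exists M, mu; split=> // w w' f g cf cg fg.
by move=> /LL' Lw; apply/LL'; exact: (s w w' f g).
Qed.

Lemma recog_not L : recog L -> recog (fun w => ~ L w).
Proof.
move=> [M [mu [c s]]]; exists M, mu; split=> // w w' f g cf cg fg nL Lw'.
by apply: nL; apply: (s w' w g f).
Qed.

Lemma recog_and L L' : recog L -> recog L' -> recog (fun w => L w /\ L' w).
Proof.
move=> [M [mu [c s]]] [M' [mu' [c' s']]].
exists (M * M')%type, (fun u => (mu u, mu' u)); split.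
  by move=> u u' v v' [e1 e2] [e3 e4]; congr pair; [exact: c|exact: c'].
move=> w w' f g cf cg fg [Lw L'w]; split.
  by apply: (s _ _ _ _ cf cg) Lw => i; have [] := fg i.
by apply: (s' _ _ _ _ cf cg) L'w => i; have [] := fg i.
Qed.

Lemma recog_true : recog (fun _ : nat -> A => True).
Proof. by exists unit, (fun=> tt). Qed.

Lemma recog_all (I : finType) (L : I -> (nat -> A) -> Prop) :
  (forall i, recog (L i)) -> recog (fun w => forall i, L i w).
Proof.
move=> rL; have : recog (fun w => forall i, i \in enum I -> L i w).
  elim: (enum I) => [|i s IH]; first by apply: recog_ext recog_true.
  apply: recog_ext (recog_and (rL i) IH) => w; split.
    by move=> [Li Ls] j; rewrite in_cons => /orP[/eqP->//|/Ls].
  by move=> H; split=> [|j js]; apply: H; rewrite in_cons ?eqxx ?js ?orbT.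
by apply: recog_ext => w; split=> H i; [apply: H; rewrite mem_enum|].
Qed.

Lemma recog_preim (h : A -> B) (L : (nat -> B) -> Prop) :
  recog L -> recog (fun w => L (h \o w)).
Proof.
move=> [M [mu [c s]]]; exists M, (mu \o map h); split.
  by move=> u u' v v' e e'; rewrite /= !map_cat; exact: c.
move=> w w' f g cf cg fg; apply: (s _ _ _ _ cf cg) => i.
by have := fg i; rewrite /= !map_seg.
Qed.

(** Existential quantification over letters: the powerset of the recognizing
    monoid works because a witness may be replaced block by block. *)
Lemma recog_image (h : B -> A) (L : (nat -> B) -> Prop) :
  recog L -> recog (fun w => exists2 w', L w' & forall i, h (w' i) = w i).
Proof.
move=> [M [mu [c s]]].
pose mu' u := [ffun m : M => `[< exists2 v, map h v = u & mu v = m >]].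
have mu'P u u' v : mu' u = mu' u' -> map h v = u ->
    exists2 v', map h v' = u' & mu v' = mu v.
  move=> /ffunP /(_ (mu v)); rewrite !ffunE => e hv.
  by apply: (asbool_eq_equiv e).1; exists v.
exists {ffun M -> bool}, mu'; split.
  have sub u u' v v' m : mu' u = mu' u' -> mu' v = mu' v' ->
      (exists2 x, map h x = u ++ v & mu x = m) ->
      (exists2 x, map h x = u' ++ v' & mu x = m).
    move=> eu ev [x hx <-].
    have hx1 : map h (take (size u) x) = u.
      by rewrite map_take hx take_size_cat.
    have hx2 : map h (drop (size u) x) = v.
      by rewrite map_drop hx drop_size_cat.
    have [y1 hy1 m1] := mu'P _ _ _ eu hx1.
    have [y2 hy2 m2] := mu'P _ _ _ ev hx2.
    exists (y1 ++ y2); first by rewrite map_cat hy1 hy2.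
    by rewrite -[in RHS](cat_take_drop (size u) x); exact: c.
  move=> u u' v v' eu ev; apply/ffunP => m; rewrite !ffunE.
  by apply: asbool_equiv_eq; split; apply: sub.
move=> w w' f g cf cg fg [x Lx hx].
have vE i : {v | map h v = seg w' (g i) (g i.+1)
                 /\ mu v = mu (seg x (f i) (f i.+1))}.
  apply: cid.
  have [] := mu'P _ _ (seg x (f i) (f i.+1)) (fg i).
    by rewrite map_seg; apply: eq_seg => n _; exact: hx.
  by move=> v hv mv; exists v.
have [|y yE] := @glue B g (fun i => sval (vE i)) cg.
  move=> i; case: (vE i) => v /= [/(congr1 size)]; rewrite size_map => -> _.
  by rewrite size_seg.
exists y.
  apply: (s _ _ _ _ cf cg) Lx => i; rewrite yE; by case: (vE i) => v /= [].
move=> n; have [||i Hi] := @incr_block g n; [by case: cg|by case: cg => ->|].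
have : map h (seg y (g i) (g i.+1)) = seg w' (g i) (g i.+1).
  by rewrite yE; case: (vE i) => v /= [].
rewrite map_seg => /(congr1 (fun s => nth (w' 0) s (n - g i))).
by rewrite !nth_seg ?subnKC //; lia.
Qed.

End RecogTheory.

Section BasicLanguages.
Variables (A : Type).

Lemma mu_prefix (M : Type) (mu : seq A -> M) w w' f g :
  compatible mu -> cuts f -> cuts g ->
  (forall i, mu (seg w (f i) (f i.+1)) = mu (seg w' (g i) (g i.+1))) ->
  forall i, mu (seg w 0 (f i)) = mu (seg w' 0 (g i)).
Proof.
move=> c [f0 fi] [g0 gi] fg; elim=> [|i IH]; first by rewrite f0 g0 !seg_nil.
rewrite -(@seg_cat _ w 0 (f i)) ?(ltnW (fi i)) //.
by rewrite -(@seg_cat _ w' 0 (g i)) ?(ltnW (gi i)) //; exact: c.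
Qed.

Lemma recog_head (p : pred A) : recog (fun w => p (w 0)).
Proof.
exists (option bool), (fun u => omap p (ohead u)); split.
  by move=> [|a u] [|a' u'] [|b v] [|b' v'].
have H (x : nat -> A) n : 0 < n -> ohead (seg x 0 n) = Some (x 0) by case: n.
move=> w w' f g [f0 fi] [g0 gi] /(_ 0); have := fi 0; have := gi 0.
by rewrite f0 g0 => ? ?; rewrite !H //= => -[->].
Qed.

Lemma cuts_inf (f : nat -> nat) (w : nat -> A) (p : pred A) : cuts f ->
  (forall m, exists2 i, m <= i & p (w i)) <->
  (forall m, exists2 i, m <= i & has p (seg w (f i) (f i.+1))).
Proof.
move=> [f0 fi]; split=> H m.
  have [i mi pi] := H (f m).
  have [||j Hj] := @incr_block f i; rewrite ?f0 //.
  exists j.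
    rewrite leqNgt; apply/negP => Hjm; have := incr_le fi Hjm; lia.
  apply/(has_nthP (w 0)); exists (i - f j); rewrite ?size_seg ?nth_seg ?subnKC //; lia.
have [i mi /(has_nthP (w 0))[j]] := H m.
rewrite size_seg => jl; rewrite nth_seg // => pj; exists (f i + j) => //.
have := incr_ge fi i; lia.
Qed.

Lemma recog_inf (p : pred A) :
  recog (fun w => forall m, exists2 i, m <= i & p (w i)).
Proof.
exists bool, (has p); split; first by move=> u u' v v' e e'; rewrite !has_cat e e'.
move=> w w' f g cf cg fg /(cuts_inf _ _ cf) H; apply/(cuts_inf _ _ cg) => m.
by have [i mi Hi] := H m; exists i => //; rewrite -fg.
Qed.

End BasicLanguages.

(** The first and the last letter of a segment are remembered, to test the
    relation where two segments meet. *)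
Lemma recog_local (B : finType) (r : rel B) :
  recog (fun w : nat -> B => forall i, r (w i) (w i.+1)).
Proof.
pose ends (u : seq B) := if u is b :: s then Some (b, last b s) else None.
pose mu u := (ends u, sorted r u).
have c : compatible mu.
  move=> [|a u] [|a' u'] [|b v] [|b' v'] //; rewrite /mu ?cats0 //=.
  case=> <- e1 e2 [<- e3 e4]; rewrite !last_cat /= e3; congr pair.
  by rewrite !cat_path /= e1 e2 e4.
exists (option (B * B) * bool)%type, mu; split=> // w w' f g cf cg fg.
have P (x : nat -> B) (h : nat -> nat) : cuts h -> (forall i, r (x i) (x i.+1)) <->
    forall i, (mu (seg x 0 (h i))).2.
  move=> [h0 hi]; split=> H i.
    apply/(sortedP (x 0)) => j; rewrite size_seg subn0 => jl.
    by rewrite !nth_seg ?add0n ?subn0 ?(ltnW jl).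
  have /(sortedP (x 0)) := H i.+2; rewrite size_seg subn0 => /(_ i).
  have := incr_ge hi i.+2 => /= hh.
  by rewrite !nth_seg ?add0n ?subn0 //; [exact|exact: ltnW].
have E := mu_prefix c cf cg fg.
by move=> /(P _ _ cf) H; apply/(P _ _ cg) => i; rewrite -E.
Qed.

(** Both words are cut letter by letter after their first blocks. *)
Lemma recognizes_prefix (A M : Type) (mu : seq A -> M) L w w' i j :
  recognizes mu L -> mu (seg w 0 i) = mu (seg w' 0 j) ->
  (forall n, w (i + n) = w' (j + n)) -> L w -> L w'.
Proof.
move=> [c s] e ww'.
pose cut i n := if n is n'.+1 then i + n'.+1 else 0.
have cutP k : cuts (cut k) by split=> // -[|n] /=; lia.
apply: (s w w' (cut i) (cut j)) => // -[|n] /=.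
  rewrite -(@seg_cat _ w 0 i) ?leq_addr // -(@seg_cat _ w' 0 j) ?leq_addr //.
  by apply: c => //; rewrite !addn1 !seg1 -(addn0 i) ww' addn0.
congr mu; rewrite (@eq_seg_shift _ w w' _ _ (j + n.+1)); first by congr seg; lia.
by move=> l _; rewrite -!addnA ww'.
Qed.

(** * Ramsey's theorem and ultimately periodic words *)

Lemma ultra_finite_color (T : choiceType) (U : set_system T) (M : finType) (g : T -> M) :
  UltraFilter U -> exists m, U [set j | g j = m]%classic.
Proof.
move=> UU; apply: contrapT => /forallNP H.
have : U [set j | forall m, g j <> m]%classic.
  apply: (filter_forall (F := U)) => m.
  have [Um|] := in_ultra_setVsetC [set j | g j = m]%classic UU; [by case: (H m)|exact].
by move=> /filter_ex [j /(_ (g j))].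
Qed.

(** Fix a nonprincipal ultrafilter. For each i, almost all j give the same
    colour c i j, and this colour is the same for almost all i. The values of f
    are chosen one after the other among these i, large enough for all previous
    ones. *)
Lemma ramsey (M : finType) (c : nat -> nat -> M) n0 :
  exists f, [/\ n0 <= f 0, forall i, f i < f i.+1 &
    exists m, forall i j, i < j -> c (f i) (f j) = m].
Proof.
have [U [UU sU]] := ultraFilterLemma (F := \oo) _.
have mE i : {m | U [set j | c i j = m]%classic}.
  by apply: cid; exact: ultra_finite_color.
have [m Um] := ultra_finite_color (fun i => sval (mE i)) UU.
pose G := [set i | sval (mE i) = m]%classic.
have step (s : seq nat) : exists j, (forall l, l \in s -> G l) ->
    [/\ G j, n0 <= j & forall l, l \in s -> l < j /\ c l j = m].
  have [H|H] := pselect (forall l, l \in s -> G l); last by exists 0.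
  suff : U [set j | [/\ G j, n0 <= j & forall l, l \in s -> l < j /\ c l j = m]]%classic.
    by move=> /filter_ex [j Hj]; exists j.
  have Ugt n : U [set j | n <= j]%classic by apply: sU; exists n.
  have Us : U [set j | forall l, l \in s -> l < j /\ c l j = m]%classic.
    elim: s H => [|a s IH] H; first by apply: filterS (@filterT _ U _) => j _ l.
    have Ha : U [set j | c a j = m]%classic.
      by have := svalP (mE a); rewrite (H a (mem_head _ _)).
    have Hs := IH (fun l ls => H l (mem_behead (s := a :: s) ls)).
    apply: filterS (filterI (filterI Ha (Ugt a.+1)) Hs) => j [[H1 H2] H3] l.
    by rewrite in_cons => /orP[/eqP->|/H3]; [split|].
  by apply: filterS (filterI (filterI Um (Ugt n0)) Us) => j [[? ?] ?].
pose nx s := sval (cid (step s)).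
pose hist := fix hist n := if n is n'.+1 then nx (hist n') :: hist n' else [::].
have histG n l : l \in hist n -> G l.
  elim: n l => // n IH l /=; rewrite in_cons => /orP[/eqP->|/IH//].
  by rewrite /nx; case: (cid _) => j /= /(_ IH) [].
pose f n := nx (hist n).
have fP n : [/\ G (f n), n0 <= f n & forall l, l \in hist n -> l < f n /\ c l (f n) = m].
  by rewrite /f /nx; case: (cid _) => j /=; apply; exact: histG.
have fh i j : i < j -> f i \in hist j.
  elim: j => // j IH; rewrite ltnS leq_eqVlt => /orP[/eqP->|/IH H] /=.
    exact: mem_head.
  by rewrite in_cons H orbT.
exists f; split; first by case: (fP 0).
  by move=> i; case: (fP i.+1) => _ _ /(_ _ (fh i i.+1 (ltnSn i))) [].
by exists m => i j /fh; case: (fP j) => _ _ H /H [].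
Qed.

Definition looped (A : Type) (w : nat -> A) n t (i : nat) : A :=
  if i < n then w i else w (n + (i - n) %% t).
Arguments looped : simpl never.

Lemma looped_prefix (A : Type) (w : nat -> A) n t i : i < n -> looped w n t i = w i.
Proof. by rewrite /looped => ->. Qed.

Lemma looped_periodic (A : Type) (w : nat -> A) n t i :
  n <= i -> looped w n t (i + t) = looped w n t i.
Proof.
move=> ni; rewrite /looped !ifF; try by apply/negbTE; lia.
by rewrite -addnBAC // modnDr.
Qed.

Lemma looped_suffix (A : Type) (w : nat -> A) n t i :
  n <= i -> exists2 j, n <= j & looped w n t i = w j.
Proof.
move=> ni; rewrite /looped ifF; last by apply/negbTE; lia.
by exists (n + (i - n) %% t); rewrite ?leq_addr.
Qed.

(** Ramsey's theorem cuts w into blocks which, except the first one, have the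
    same value; so the second block may be repeated forever. *)
Lemma periodize (A : Type) (M : finType) (mu : seq A -> M) L w n1 :
  recognizes mu L -> L w ->
  exists n t, [/\ n1 <= n, 0 < n, 0 < t & L (looped w n t)].
Proof.
move=> [c s] Lw.
have [f [f0 fi [m fm]]] := ramsey (fun i j => mu (seg w i j)) n1.+1.
exists (f 0), (f 1 - f 0); split; rewrite ?subn_gt0 ?(ltnW f0) ?(leq_trans _ f0) //.
set t := f 1 - f 0.
pose F n := if n is n'.+1 then f n' else 0.
pose G n := if n is n'.+1 then f 0 + n' * t else 0.
have tgt : 0 < t by rewrite subn_gt0.
have f0gt : 0 < f 0 by exact: leq_trans f0.
apply: (s w _ F G) => //.
- by split=> // -[|n] //=; rewrite fi.
- by split=> // -[|n] /=; lia.
move=> [|n] /=.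
  rewrite mul0n addn0; congr mu; apply: eq_seg => i Hi.
  by rewrite looped_prefix.
rewrite fm // -(fm 0 1) //; congr mu.
rewrite (@eq_seg_shift _ w (looped w (f 0) t) _ _ (f 0 + n * t)).
  by congr seg; rewrite -/t; lia.
move=> l ll; rewrite /looped ifF; last by apply/negbTE; lia.
by rewrite -addnA addKn modnMDl modn_small.
Qed.

Local Open Scope classical_set_scope.
Local Open Scope ring_scope.

(** * Radix expansions *)

Section Radix.
Variables (R : realType) (k : nat) (hk : (1 < k)%N).
Implicit Types (d : nat -> int) (m n : nat).

Definition psum d m : R := \sum_(0 <= i < m) (d i)%:~R / k%:R ^+ i.+1.
Definition frac d : R := limn (psum d).

Lemma k_gt0 : 0 < k%:R :> R.
Proof. by rewrite ltr0n ltnW. Qed.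

Lemma kX_gt0 m : 0 < k%:R ^+ m :> R.
Proof. by rewrite exprn_gt0 // k_gt0. Qed.

Lemma kX_neq0 m : k%:R ^+ m != 0 :> R.
Proof. by rewrite gt_eqF ?kX_gt0. Qed.

Lemma norm_divkX (x : R) m : `|x / k%:R ^+ m| = `|x| / k%:R ^+ m.
Proof. by rewrite normrM (ger0_norm (x := _^-1)) // invr_ge0 ltW ?kX_gt0. Qed.

Lemma ler_divkX (x y : R) m : (x / k%:R ^+ m <= y / k%:R ^+ m) = (x <= y).
Proof. by rewrite ler_pM2r ?invr_gt0 ?kX_gt0. Qed.

Lemma k_ge2 : 2 <= k%:R :> R.
Proof. by rewrite ler_nat. Qed.

Lemma psum0 d : psum d 0 = 0.
Proof. by rewrite /psum big_geq. Qed.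

Lemma psumS d m : psum d m.+1 = psum d m + (d m)%:~R / k%:R ^+ m.+1.
Proof. by rewrite /psum big_nat_recr. Qed.

Lemma psum_cat d m n :
  psum d (m + n) = psum d m + psum (fun i => d (m + i)%N) n / k%:R ^+ m.
Proof.
elim: n => [|n IH]; first by rewrite addn0 psum0 mul0r addr0.
rewrite addnS !psumS IH mulrDl addrA; congr (_ + _).
by rewrite -mulrA -invfM -exprD addSn addnC.
Qed.

Lemma psum_bound d (b : nat) m : (forall i, `|d i| <= b%:Z) ->
  `|psum d m| * (k%:R - 1) <= b%:R * (1 - (k%:R ^+ m)^-1).
Proof.
move=> db; elim: m => [|m IH]; first by rewrite psum0 normr0 mul0r expr0 invr1 subrr mulr0.
rewrite psumS; have := k_ge2 => k2.
have h : `|(d m)%:~R / k%:R ^+ m.+1| <= b%:R / k%:R ^+ m.+1 :> R.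
  rewrite norm_divkX ler_divkX -intr_norm.
  by have := db m; rewrite -(ler_int R).
have h2 : `|psum d m + (d m)%:~R / k%:R ^+ m.+1| * (k%:R - 1) <=
  `|psum d m| * (k%:R - 1) + (b%:R / k%:R ^+ m.+1) * (k%:R - 1).
  rewrite -mulrDl ler_wpM2r //; first by lra.
  by apply: le_trans (ler_normD _ _) _; rewrite lerD2l.
apply: le_trans h2 _; apply: le_trans (lerD IH (lexx _)) _.
rewrite le_eqVlt; apply/orP; left; apply/eqP; rewrite exprS; field.
by rewrite kX_neq0 gt_eqF ?k_gt0.
Qed.

Lemma psum_cvg d (b : nat) : (forall i, `|d i| <= b%:Z) -> cvgn (psum d).
Proof.
move=> db; apply: normed_cvg => /=.
pose v := geometric (b%:R : R) 2^-1.
apply: (@series_le_cvg _ _ v) => [n|n|n|].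
- exact: normr_ge0.
- by rewrite /v /geometric /= mulr_ge0 // exprn_ge0 // invr_ge0.
- rewrite /v /geometric /= norm_divkX ler_pM //.
  + by have := db n; rewrite -(ler_int R) intr_norm.
  rewrite exprVn lef_pV2 ?posrE ?exprn_gt0 ?k_gt0 //.
  apply: (@le_trans _ _ (k%:R ^+ n)); first by rewrite lerXn2r ?nnegrE // k_ge2.
  by rewrite ler_eXn2l ?leqnSn // (lt_le_trans _ k_ge2) // ltr1n.
by apply: is_cvg_geometric_series; rewrite ger0_norm ?invr_ge0 // invf_lt1 // ltr1n.
Qed.

Lemma frac_bound d (b : nat) : (forall i, `|d i| <= b%:Z) ->
  `|frac d| * (k%:R - 1) <= b%:R.
Proof.
move=> db; have c := psum_cvg db.
have k2 := k_ge2.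
have cn : (fun m => `|psum d m| * (k%:R - 1)) @ \oo --> `|frac d| * (k%:R - 1).
  by apply: cvgMr_tmp; apply: cvg_norm.
rewrite -(cvg_lim _ cn) //; apply: limr_le; first by apply/cvg_ex; eexists; exact: cn.
near=> m.
apply: le_trans (psum_bound m db) _.
rewrite -[X in _ <= X]mulr1 ler_wpM2l // gerBl invr_ge0 ltW //; exact: kX_gt0.
Unshelve. all: by end_near. Qed.

Lemma frac_split d (b : nat) m : (forall i, `|d i| <= b%:Z) ->
  frac d = psum d m + frac (fun i => d (m + i)%N) / k%:R ^+ m.
Proof.
move=> db; have c := psum_cvg db.
have c' : cvgn (psum (fun i => d (m + i)%N)) by apply: psum_cvg.
have h1 : (fun n => psum d (n + m)%N) @ \oo --> frac d by rewrite cvg_shiftn.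
apply: (cvg_unique _ h1) => //.
rewrite (_ : (fun n => _) = fun n => psum d m + psum (fun i => d (m + i)%N) n / k%:R ^+ m).
  by apply: cvgD; [exact: cvg_cst|apply: cvgMr_tmp].
by apply/funext => n; rewrite addnC psum_cat.
Qed.

Lemma frac_close d (b : nat) m : (forall i, `|d i| <= b%:Z) ->
  `|frac d - psum d m| <= b%:R / k%:R ^+ m.
Proof.
move=> db; rewrite (frac_split m db) addrAC subrr add0r norm_divkX ler_divkX.
have := frac_bound (d := fun i => d (m + i)%N) (b := b) (fun i => db _).
have := k_ge2; have := normr_ge0 (frac (fun i => d (m + i)%N)); nra.
Qed.

Lemma kX_inv_small (e C : R) : 0 < e ->
  exists m0, forall m, (m0 <= m)%N -> C / k%:R ^+ m < e.
Proof.
move=> e0; exists (Num.truncn (`|C| / e)).+1 => m mm.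
rewrite ltr_pdivrMr ?kX_gt0 //; apply: le_lt_trans (ler_norm C) _.
rewrite -ltr_pdivrMl // mulrC.
apply: lt_le_trans (Num.Theory.truncnS_gt _) _.
apply: (@le_trans _ _ m%:R); first by rewrite ler_nat.
by rewrite -natrX ler_nat ltnW // ltn_expl.
Qed.

Lemma frac_unique d (b : nat) (x C : R) : (forall i, `|d i| <= b%:Z) ->
  (forall m, exists2 n, (m <= n)%N & `|x - psum d n| <= C / k%:R ^+ n) -> x = frac d.
Proof.
move=> db H; apply/eqP; rewrite -subr_eq0 -normr_eq0 eq_le normr_ge0 andbT.
apply/ler_addgt0Pr => z z0; rewrite add0r.
have [m0 Hm] := kX_inv_small (C + b%:R) z0.
have [n mn Hn] := H m0.
have -> : x - frac d = (x - psum d n) - (frac d - psum d n) by ring.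
apply: le_trans (ler_normB _ _) _; apply: le_trans (lerD Hn (frac_close n db)) _.
by rewrite -mulrDl ltW // Hm.
Qed.

Lemma eq_frac d d' : (forall i, d i = d' i) -> frac d = frac d'.
Proof. by move=> /funext ->. Qed.

Lemma fracD d d' (b b' : nat) : (forall i, `|d i| <= b%:Z) ->
  (forall i, `|d' i| <= b'%:Z) ->
  frac (fun i => d i + d' i) = frac d + frac d'.
Proof.
move=> db d'b; apply: cvg_lim => //.
rewrite (_ : psum _ = fun m => psum d m + psum d' m).
  by apply: cvgD; apply: psum_cvg; eauto.
apply/funext => m; rewrite /psum -big_split; apply: eq_bigr => i _ /=.
by rewrite intrD mulrDl.
Qed.

Lemma fracN d (b : nat) : (forall i, `|d i| <= b%:Z) ->
  frac (fun i => - d i) = - frac d.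
Proof.
move=> db; apply: cvg_lim => //.
rewrite (_ : psum _ = fun m => - psum d m).
  by apply: cvgN; apply: psum_cvg; eauto.
apply/funext => m; rewrite /psum -sumrN; apply: eq_bigr => i _ /=.
by rewrite intrN mulNr.
Qed.

Definition fr (w : nat -> 'I_k) : R := frac (fun i => Posz (w i)).

Lemma ord_bound (w : nat -> 'I_k) i : `|Posz (w i)| <= (k.-1)%:Z.
Proof. by rewrite lez_nat; have := ltn_ord (w i); lia. Qed.

Lemma predk_cast : (k.-1)%:R = k%:R - 1 :> R.
Proof. by rewrite -subn1 natrB // ltnW. Qed.

Lemma fr_ge0 w : 0 <= fr w.
Proof.
apply: limr_ge; first exact: psum_cvg (ord_bound w).
near=> m; apply: sumr_ge0 => i _; apply: divr_ge0; first by rewrite ler0z.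
by rewrite ltW ?kX_gt0.
Unshelve. all: by end_near. Qed.

Lemma fr_le1 w : fr w <= 1.
Proof.
have := frac_bound (ord_bound w); rewrite predk_cast -/(fr w).
have := k_ge2; have := ler_norm (fr w) => ? ? ?; nra.
Qed.

Lemma fr_split w m :
  fr w = psum (fun i => Posz (w i)) m + fr (fun i => w (m + i)%N) / k%:R ^+ m.
Proof. exact: frac_split (ord_bound w). Qed.

Lemma fr_surj (x : R) : 0 <= x <= 1 -> exists w, fr w = x.
Proof.
move=> x01; have k2 := k_ge2.
have step (y : R) : exists c : 'I_k, 0 <= y <= 1 -> 0 <= k%:R * y - (nat_of_ord c)%:R <= 1.
  have [y01|_] := boolP (0 <= y <= 1); last by exists (Ordinal (ltnW hk)).
  (* At y = 1 the truncation of k y would be k, which is not a digit. *)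
  have [H|H] := leP 1 y.
    have pk : (k.-1 < k)%N by rewrite prednK // ltnW.
    by exists (Ordinal pk) => _ /=; rewrite predk_cast; nra.
  have fl : (Num.truncn (k%:R * y) < k)%N.
    rewrite -(ltr_nat R); apply: le_lt_trans (_ : k%:R * y < _).
      by have /truncn_itv/andP[] : 0 <= k%:R * y by nra.
    by rewrite -[ltRHS]mulr1 ltr_pM2l // k_gt0.
  exists (Ordinal fl) => _ /=; have /truncn_itv : 0 <= k%:R * y by nra.
  by rewrite -natr1 => /andP[? ?]; apply/andP; split; lra.
pose dig y := sval (cid (step y)).
have digP y : 0 <= y <= 1 -> 0 <= k%:R * y - (nat_of_ord (dig y))%:R <= 1.
  by rewrite /dig; case: (cid _).
pose orb := fix orb i := if i is i'.+1 then k%:R * orb i' - (nat_of_ord (dig (orb i')))%:R else x.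
have orb01 i : 0 <= orb i <= 1 by elim: i => //= i IH; exact: digP.
exists (fun i => dig (orb i)); symmetry.
apply: (frac_unique (C := 1) (ord_bound _)) => m; exists m => //.
have -> : x - psum (fun i => Posz (dig (orb i))) m = orb m / k%:R ^+ m.
  elim: m => [|m IH]; first by rewrite psum0 subr0 expr0 divr1.
  rewrite psumS opprD addrA IH /= exprS; field.
  by rewrite kX_neq0 gt_eqF ?k_gt0.
rewrite norm_divkX ler_divkX; have /andP[? ?] := orb01 m; by rewrite ger0_norm.
Qed.

Lemma fr_wcat (u : seq 'I_k) w :
  fr (wcat u w) = psum (fun i => Posz (wcat u w i)) (size u) + fr w / k%:R ^+ size u.
Proof.
rewrite (fr_split _ (size u)); congr (_ + fr _ / _).
by apply/funext => i; rewrite wcat_addn.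
Qed.

End Radix.

(** * Linear equations between expansions *)

Section LinearEquations.
Variables (R : realType) (k : nat) (hk : (1 < k)%N).
Implicit Types (d : nat -> int).

Definition ipart d n : int := \sum_(0 <= i < n) d i * (k ^ i)%N%:Z.

Lemma ipart0 d : ipart d 0 = 0.
Proof. by rewrite /ipart big_geq. Qed.

Lemma ipartS d n : ipart d n.+1 = ipart d n + d n * (k ^ n)%N%:Z.
Proof. by rewrite /ipart big_nat_recr. Qed.

Lemma ipartSl d n : ipart d n.+1 = d 0%N + k%:Z * ipart (fun i => d i.+1) n.
Proof.
rewrite /ipart big_nat_recl // expn0 mulr1; congr (_ + _).
rewrite big_distrr; apply: eq_bigr => i _ /=.
by rewrite expnS PoszM mulrCA.
Qed.

Lemma ipart_cat d m n :
  ipart d (m + n) = ipart d m + (k ^ m)%N%:Z * ipart (fun i => d (m + i)%N) n.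
Proof.
elim: n => [|n IH]; first by rewrite addn0 ipart0 mulr0 addr0.
rewrite addnS !ipartS IH mulrDr addrA; congr (_ + _).
by rewrite expnD PoszM mulrCA.
Qed.

Lemma ipart_stable d m n : (m <= n)%N -> (forall i, (m <= i)%N -> d i = 0) ->
  ipart d n = ipart d m.
Proof.
move=> mn d0; rewrite -(subnKC mn) ipart_cat /ipart [X in _ * X]big1 ?mulr0 ?addr0 //.
by move=> i _; rewrite d0 ?mul0r // leq_addr.
Qed.

Lemma ipart_bound d (b n : nat) : (forall i, `|d i| <= b%:Z) ->
  `|ipart d n| <= b%:Z * (k ^ n)%N%:Z.
Proof.
move=> db; elim: n => [|n IH]; first by rewrite ipart0 normr0 mulr_ge0.
rewrite ipartS; apply: le_trans (ler_normD _ _) _.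
rewrite normrM (ger0_norm (x := (k ^ n)%N%:Z)) //.
have h : `|d n| * (k ^ n)%N%:Z <= b%:Z * (k ^ n)%N%:Z by rewrite ler_wpM2r.
apply: le_trans (lerD IH h) _; rewrite -mulrDr ler_wpM2l // lez_nat expnS.
by rewrite addnn -mul2n leq_mul2r hk orbT.
Qed.

(** dI and dF read, off a letter, a digit of the integer part and a digit of the
    fractional part of a number. These digits are bounded but may be negative or
    larger than k, so testing whether the number is 0 needs carries; bounded
    carries are states of a finite automaton. *)
Variables (A : Type) (dI dF : A -> int) (b : nat).
Hypotheses (bI : forall a, `|dI a| <= b%:Z) (bF : forall a, `|dF a| <= b%:Z).

Let C := 'I_(b.*2.+1).
Let dec (x : C) : int := x%:Z - b%:Z.
Let enc (x : int) : C := inord (absz (x + b%:Z)).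

Lemma encK x : `|x| <= b%:Z -> dec (enc x) = x.
Proof. by move=> xb; rewrite /dec /enc inordK; lia. Qed.

Let S := 'I_(b.*2.*2.+1).
Let decS (x : S) : int := x%:Z - b.*2%:Z.
Let encS (x : int) : S := inord (absz (x + b.*2%:Z)).

Lemma encSK x : `|x| <= b.*2%:Z -> decS (encS x) = x.
Proof. by move=> xb; rewrite /decS /encS inordK; lia. Qed.

Let step (x y : C * C * (S * S)) :=
  (decS y.2.1 == k%:Z * decS x.2.1 + dec x.1.2) &&
  (decS x.2.2 + dec x.1.1 == k%:Z * decS y.2.2).

Let h (x : A * (S * S)) := (enc (dI x.1), enc (dF x.1), x.2).

Lemma recog_carries :
  recog (fun w : nat -> A => exists s : nat -> S * S,
    decS (s 0%N).1 + decS (s 0%N).2 = 0 /\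
    forall i, decS (s i.+1).1 = k%:Z * decS (s i).1 + dF (w i) /\
              decS (s i).2 + dI (w i) = k%:Z * decS (s i.+1).2).
Proof.
pose p (x : A * (S * S)) := decS x.2.1 + decS x.2.2 == 0.
have := recog_image fst (recog_and (recog_head p) (recog_preim h (recog_local step))).
apply: recog_ext => w; split.
  move=> [w' [p0 st] ww']; exists (fun i => (w' i).2); split; first exact/eqP.
  move=> i; have /andP[/eqP/= e1 /eqP/= e2] := st i; move: e1 e2.
  by rewrite !encK // ww'.
move=> [s [s0 st]]; exists (fun i => (w i, s i)) => //; split; first exact/eqP.
move=> i; have [e1 e2] := st i; rewrite /step /= !encK //.
by rewrite e1 e2 !eqxx.
Qed.

(** The partial sums of the fractional part are c m / k ^ m - c 0 for the first
    sequence c of carries, so that the fractional part is - c 0 when c is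
    bounded. For the second sequence e, e m * k ^ m is e 0 plus the integer part
    for large m, so that the integer part is - e 0 when e is bounded. The two
    sequences meet in the first letter, where their sum has to vanish. *)
Lemma carries_eq0 (w : nat -> A) n0 : (forall i, (n0 <= i)%N -> dI (w i) = 0) ->
  (exists s : nat -> S * S,
    decS (s 0%N).1 + decS (s 0%N).2 = 0 /\
    forall i, decS (s i.+1).1 = k%:Z * decS (s i).1 + dF (w i) /\
              decS (s i).2 + dI (w i) = k%:Z * decS (s i.+1).2) <->
  (ipart (dI \o w) n0)%:~R + frac R k (dF \o w) = 0.
Proof.
move=> w0; set T := ipart _ _.
have kX m : (k ^ m)%N%:Z%:~R = k%:R ^+ m :> R by rewrite -pmulrn natrX.
have bF' i : `|(dF \o w) i| <= b%:Z by exact: bF.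
split.
  move=> [s [s0 st]]; pose c i := decS (s i).1; pose e i := decS (s i).2.
  have cb i : `|c i| <= b.*2%:Z by rewrite /c /decS; have := ltn_ord (s i).1; lia.
  have eb i : `|e i| <= b.*2%:Z by rewrite /e /decS; have := ltn_ord (s i).2; lia.
  have cS m : c m.+1 = k%:Z * c m + dF (w m) := (st m).1.
  have eS m : e m + dI (w m) = k%:Z * e m.+1 := (st m).2.
  have ce0 : c 0%N + e 0%N = 0 := s0.
  clearbody c e => {s s0 st}.
  have cE m : psum R k (dF \o w) m = (c m)%:~R / k%:R ^+ m - (c 0%N)%:~R.
    elim: m => [|m IH]; first by rewrite psum0 expr0 divr1 subrr.
    rewrite psumS IH cS intrD intrM exprS /= -pmulrn; field.
    by rewrite kX_neq0 // gt_eqF ?k_gt0.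
  have eE m : e m * (k ^ m)%N%:Z = e 0%N + ipart (dI \o w) m.
    elim: m => [|m IH]; first by rewrite ipart0 expn0 addr0 mulr1.
    by rewrite ipartS addrA -IH /= -mulrDl eS expnS PoszM mulrA [e _ * _]mulrC.
  have fE : frac R k (dF \o w) = - (c 0%N)%:~R.
    symmetry; apply: (frac_unique hk (C := b.*2%:R) bF') => m; exists m => //.
    rewrite cE (_ : _ - (_ - _) = - ((c m)%:~R / k%:R ^+ m)); last by ring.
    rewrite normrN norm_divkX // ler_divkX //.
    by have := cb m; rewrite -(ler_int R) intr_norm.
  have TE : T = c 0%N.
    have s0' : e 0%N = - c 0%N by lia.
    pose m := (n0 + absz (T - c 0%N))%N.
    have := eE m; rewrite (ipart_stable (leq_addr _ _)) // -/T s0'.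
    move=> /(congr1 absz); rewrite abszM absz_nat => E.
    have := ltn_expl m hk; rewrite {1}/m.
    case: (absz (e m)) E => [|y]; rewrite ?mulSn; lia.
  by rewrite fE TE subrr.
move=> H.
have fE : frac R k (dF \o w) = - T%:~R by apply/eqP; rewrite -addr_eq0 addrC H.
have Tb : `|T| <= b%:Z.
  rewrite -(ler_int R) intr_norm -normrN -fE.
  have := frac_bound R hk bF'; have := k_ge2 R hk; have := normr_ge0 (frac R k (dF \o w)).
  by rewrite -pmulrn; nra.
pose c := fix c i : int := if i is i'.+1 then k%:Z * c i' + dF (w i') else T.
have c0 : c 0%N = T by [].
have cS i : c i.+1 = k%:Z * c i + dF (w i) by [].
clearbody c.
pose e i : int := - ipart (fun j => dI (w (i + j)%N)) (n0 - i).
have cE m : psum R k (dF \o w) m = (c m)%:~R / k%:R ^+ m - T%:~R.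
  elim: m => [|m IH]; first by rewrite psum0 expr0 divr1 c0 subrr.
  rewrite psumS IH cS rmorphD rmorphM exprS /= -pmulrn; field.
  by rewrite kX_neq0 // gt_eqF ?k_gt0.
have cb m : `|c m| <= b%:Z.
  rewrite -(ler_int R) intr_norm -(ler_divkX hk _ _ m) -norm_divkX //.
  have := frac_close R hk m bF'; rewrite fE cE.
  by rewrite [_ - (_ - _)](_ : _ = - ((c m)%:~R / k%:R ^+ m)) ?normrN //; ring.
have e0 : e 0%N = - T by rewrite /e subn0.
have eS i : e i + dI (w i) = k%:Z * e i.+1.
  rewrite /e; have [n0i|n0i] := leqP n0 i.
    have z1 : (n0 - i)%N = 0%N by apply/eqP; rewrite subn_eq0.
    have z2 : (n0 - i.+1)%N = 0%N by apply/eqP; rewrite subn_eq0 leqW.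
    by rewrite w0 // addr0 z1 z2 !ipart0 oppr0 mulr0.
  rewrite -(subnSK n0i) ipartSl addn0 opprD addrAC addNr add0r mulrN; congr (- (_ * ipart _ _)).
  by apply/funext => j; rewrite addSnnS.
have eb i : `|e i| <= b.*2%:Z.
  have E : e i * (k ^ i)%N%:Z = ipart (dI \o w) i - T.
    have [n0i|n0i] := leqP n0 i.
      rewrite (ipart_stable n0i) // subrr /e.
      have -> : (n0 - i)%N = 0%N by apply/eqP; rewrite subn_eq0.
      by rewrite ipart0 oppr0 mul0r.
    by rewrite /T -[in X in _ - X](subnKC (ltnW n0i)) ipart_cat /e mulrC; ring.
  have Ib := @ipart_bound (dI \o w) b i (fun i => bI _).
  have ki : (0 < k ^ i)%N by rewrite expn_gt0 ltnW.
  have : `|e i| * (k ^ i)%N%:Z <= b%:Z * (k ^ i)%N%:Z + b%:Z.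
    rewrite -[X in _ * X <= _]ger0_norm // -normrM E; lia.
  nia.
have cb2 i : `|c i| <= b.*2%:Z by apply: le_trans (cb i) _; rewrite lez_nat; lia.
exists (fun i => (encS (c i), encS (e i))) => /=; split.
  by rewrite !encSK // e0 c0 subrr.
by move=> i; rewrite !encSK // cS eS.
Qed.

Lemma recog_lineq : exists L : (nat -> A) -> Prop, recog L /\
  forall w n0, (forall i, (n0 <= i)%N -> dI (w i) = 0) ->
  (L w <-> (ipart (dI \o w) n0)%:~R + frac R k (dF \o w) = 0).
Proof.
eexists; split; first exact: recog_carries.
by move=> w n0 w0; exact: carries_eq0.
Qed.

End LinearEquations.

(** * Definable relations are recognizable *)

(** A run is guessed along with the word, one state per letter. *)
Lemma recog_buchi (Sigma : finType) (A : buchi Sigma) :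
  recog (fun w => recognized A w).
Proof.
pose B := (Sigma * state A)%type.
pose step (x y : B) := y.2 \in delta x.2 x.1.
have := recog_image (B := B) fst (recog_and (recog_head (fun x : B => x.2 \in start A))
  (recog_and (recog_local step) (recog_inf (fun x : B => x.2 \in accept A)))).
apply: recog_ext => w; split.
  move=> [x [x0 [xs xa]] xw]; exists (fun i => (x i).2) => //.
  by split=> // i; rewrite -xw; exact: xs.
move=> [q [q0 qs] qa]; exists (fun i => (w i, q i)) => //.
Qed.

Section Encoding.
Variables (R : realType) (k : nat) (hk : (1 < k)%N).

(** A real is written as an integer plus a fraction in [0, 1]. A letter carries
    at once a signed digit of the integer, least significant digit first, and a
    digit of the fraction, so that no position of a word is the radix point. *)
Definition letter := (bool * 'I_k * 'I_k)%type.
Definition idig (a : letter) : int := if a.1.1 then - a.1.2%:Z else a.1.2%:Z.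
Definition fdig (a : letter) : int := a.2%:Z.
Definition fin_int (w : nat -> letter) n := forall i, (n <= i)%N -> (w i).1.2 = 0%N :> nat.
Definition wval (w : nat -> letter) : R :=
  limn (fun n => (ipart k (idig \o w) n)%:~R : R) + frac R k (fdig \o w).

Definition good (W : nat -> nat -> letter) :=
  exists n, forall v, fin_int (fun i => W i v) n.
Definition env (W : nat -> nat -> letter) (v : nat) : R := wval (fun i => W i v).

Lemma idig0 w n : fin_int w n -> forall i, (n <= i)%N -> (idig \o w) i = 0.
Proof. by move=> wn i /wn; rewrite /idig /= => ->; rewrite oppr0 if_same. Qed.

Lemma idig_bound a : `|idig a| <= k%:Z.
Proof. by rewrite /idig; have := ltn_ord a.1.2; case: a.1.1; lia. Qed.

Lemma fdig_bound a : `|fdig a| <= k%:Z.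
Proof. by rewrite /fdig; have := ltn_ord a.2; lia. Qed.

Lemma wvalE w n : fin_int w n ->
  wval w = (ipart k (idig \o w) n)%:~R + frac R k (fdig \o w).
Proof.
move=> wn; congr (_ + _); apply: cvg_lim => //.
apply: cvg_near_cst; near=> m.
rewrite (@ipart_stable _ _ n m) //; last exact: idig0.
by near: m; exists n.
Unshelve. all: by end_near. Qed.

Lemma nat_digits (N : nat) : exists (d : nat -> 'I_k) n,
  (forall i, (n <= i)%N -> d i = 0%N :> nat) /\
  forall m, (n <= m)%N -> ipart k (fun i => (d i)%:Z) m = N%:Z.
Proof.
have k0 : (0 < k)%N by rewrite ltnW.
have dk i : ((N %/ k ^ i) %% k < k)%N by rewrite ltn_mod.
exists (fun i => Ordinal (dk i)), N.
have big i : (N <= i)%N -> (N < k ^ i)%N.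
  by move=> Ni; apply: leq_ltn_trans Ni _; exact: ltn_expl.
split=> [i /big Ni /=|m Nm]; first by rewrite divn_small // mod0n.
have -> : ipart k (fun i => (Ordinal (dk i))%:Z) m = (N %% k ^ m)%N%:Z.
  elim: m {Nm} => [|m IH]; first by rewrite ipart0 expn0 modn1.
  rewrite ipartS IH /= -PoszM -PoszD; congr Posz.
  rewrite expnSr; set K := (k ^ m)%N.
  have rK : (N %% K < K)%N by rewrite ltn_mod expn_gt0 k0.
  have cK : (((N %/ K) %% k).+1 * K <= k * K)%N by rewrite leq_mul2r dk orbT.
  have E := divn_eq N K; have E2 := divn_eq (N %/ K) k.
  set r := (N %% K)%N in E rK *; set c := ((N %/ K) %% k)%N in E2 cK *.
  rewrite [in RHS]E E2 mulnDl -mulnA -addnA [in RHS](mulnC K k) modnMDl modn_small 1?addnC //.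
  by apply: leq_trans cK; rewrite mulSn ltn_add2r.
by rewrite modn_small // big.
Qed.

Lemma wval_surj (x : R) : exists w n, fin_int w n /\ wval w = x.
Proof.
have [d [n [dn dE]]] := nat_digits (absz (Num.floor x)).
have [w wE] : exists w : nat -> 'I_k, fr R w = x - (Num.floor x)%:~R.
  apply: (fr_surj hk); have := floor_itv x.
  by rewrite intrD => /andP[? ?]; apply/andP; split; lra.
exists (fun i => (Num.floor x < 0, d i, w i)), n; split=> //.
rewrite (@wvalE _ n) //.
have -> : frac R k (fdig \o (fun i => (Num.floor x < 0, d i, w i))) = fr R w by [].
have -> : ipart k (idig \o (fun i => (Num.floor x < 0, d i, w i))) n = Num.floor x.
  have -> : (idig \o (fun i => (Num.floor x < 0, d i, w i))) =
    fun i => (if Num.floor x < 0 then -1 else 1) * (d i)%:Z.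
    by apply/funext => i; rewrite /idig /=; case: ifP; rewrite ?mulN1r ?mul1r.
  have := dE n (leqnn n); rewrite /ipart.
  under [X in _ -> X = _]eq_bigr do rewrite -mulrA.
  rewrite -big_distrr /= => ->; case: ltP; lia.
by rewrite wE; ring.
Qed.

Lemma env_surj (e : nat -> R) b : (forall v, (b <= v)%N -> e v = 0) ->
  exists W, good W /\ env W = e.
Proof.
move=> e0.
pose w v := sval (cid (wval_surj (e v))).
have wP v : exists n, fin_int (w v) n /\ wval (w v) = e v by rewrite /w; case: (cid _).
pose nn v := sval (cid (wP v)).
have nP v : fin_int (w v) (nn v) /\ wval (w v) = e v by rewrite /nn; case: (cid _).
pose z : letter := (false, Ordinal (ltnW hk), Ordinal (ltnW hk)).
exists (fun i v => if (v < b)%N then w v i else z); split.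
  exists (\max_(v < b) nn v)%N => v i Hi; case: ifP => // vb.
  apply: (nP v).1; apply: leq_trans Hi.
  exact: (@leq_bigmax _ (fun v : 'I_b => nn v) (Ordinal vb)).
apply/funext => v; rewrite /env; case: (ltnP v b) => vb; first exact: (nP v).2.
rewrite e0 // (@wvalE _ 0) // ipart0 add0r.
symmetry; apply: (frac_unique hk (b := 0%N) (C := 0)) => // m; exists m => //.
rewrite sub0r normrN /psum big1 ?normr0 ?mul0r // => i _.
by rewrite /fdig /= mul0r.
Qed.

Fixpoint tI (t : term) (a : nat -> letter) : int :=
  match t with Var v => idig (a v) | Add t1 t2 => tI t1 a + tI t2 a end.
Fixpoint tF (t : term) (a : nat -> letter) : int :=
  match t with Var v => fdig (a v) | Add t1 t2 => tF t1 a + tF t2 a end.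
Fixpoint tB (t : term) : nat :=
  match t with Var v => k | Add t1 t2 => (tB t1 + tB t2)%N end.

Lemma tI_bound t a : `|tI t a| <= (tB t)%:Z.
Proof.
elim: t => [v|t1 IH1 t2 IH2] /=; first exact: idig_bound.
by apply: le_trans (ler_normD _ _) _; rewrite PoszD lerD.
Qed.

Lemma tF_bound t a : `|tF t a| <= (tB t)%:Z.
Proof.
elim: t => [v|t1 IH1 t2 IH2] /=; first exact: fdig_bound.
by apply: le_trans (ler_normD _ _) _; rewrite PoszD lerD.
Qed.

Lemma tI0 t (W : nat -> nat -> letter) n : (forall v, fin_int (fun i => W i v) n) ->
  forall i, (n <= i)%N -> tI t (W i) = 0.
Proof.
move=> Wn i ni; elim: t => [v|t1 IH1 t2 IH2] /=; last by rewrite IH1 IH2.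
exact: (idig0 (Wn v)).
Qed.

Lemma ipartD d d' n : ipart k (fun i => d i + d' i) n = ipart k d n + ipart k d' n.
Proof. by rewrite /ipart -big_split; apply: eq_bigr => i _; rewrite mulrDl. Qed.

Lemma ipartN d n : ipart k (fun i => - d i) n = - ipart k d n.
Proof. by rewrite /ipart -sumrN; apply: eq_bigr => i _; rewrite mulNr. Qed.

Lemma evalE t W n : (forall v, fin_int (fun i => W i v) n) ->
  eval (env W) t = (ipart k (tI t \o W) n)%:~R + frac R k (tF t \o W).
Proof.
move=> Wn; elim: t => [v|t1 IH1 t2 IH2] /=; first by rewrite /env (wvalE (Wn v)).
rewrite IH1 IH2.
have -> : (tI (Add t1 t2) \o W) = fun i => (tI t1 \o W) i + (tI t2 \o W) i by [].
have -> : (tF (Add t1 t2) \o W) = fun i => (tF t1 \o W) i + (tF t2 \o W) i by [].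
rewrite ipartD (@fracD R k hk _ _ (tB t1) (tB t2)); last 2 first.
- by move=> i; exact: tF_bound.
- by move=> i; exact: tF_bound.
by rewrite intrD; ring.
Qed.

(** Only words whose integer digits are eventually zero denote reals, hence the
    restriction to good words. *)
Definition rep (P : (nat -> R) -> Prop) :=
  exists L, recog L /\ forall W, good W -> (L W <-> P (env W)).

Definition updw (W : nat -> nat -> letter) j (w : nat -> letter) :=
  fun i v => if v == j then w i else W i v.

Lemma env_updw W j w : env (updw W j w) = [eta env W with j |-> wval w].
Proof.
apply/funext => v; rewrite /env /updw /=; case: ifP => vj //.
Qed.

Lemma good_updw W j w n : good W -> fin_int w n -> good (updw W j w).
Proof.
move=> [m Wm] wn; exists (maxn m n) => v i; rewrite geq_max => /andP[mi ni].
by rewrite /updw; case: ifP => _; [exact: wn|exact: Wm].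
Qed.

Lemma recog_fin_int (A : Type) (f : A -> nat) :
  recog (fun w => exists n, forall i, (n <= i)%N -> f (w i) = 0%N).
Proof.
apply: recog_ext (recog_not (recog_inf (fun a => f a != 0%N))) => w; split.
  move=> H; apply: contrapT => /forallNP H2; apply: H => m.
  have /existsNP[i /not_implyP[mi /eqP fi]] := H2 m; by exists i.
by move=> [n Hn] /(_ n)[i /Hn ->].
Qed.

(** The witness is guessed along with the other numbers; only words with
    finitely many nonzero integer digits are allowed, as the others denote no
    real. *)
Lemma rep_ex j P : rep P -> rep (fun e => exists x, P [eta e with j |-> x]).
Proof.
move=> [L [rL LP]].
pose g (x : (nat -> letter) * letter) v := if v == j then x.2 else x.1 v.
exists (fun W => exists2 W' : nat -> (nat -> letter) * letter,
  L (g \o W') /\ (exists n, forall i, (n <= i)%N -> nat_of_ord (W' i).2.1.2 = 0%N)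
  & forall i, (W' i).1 = W i); split.
  apply: recog_image; apply: recog_and; first exact: recog_preim.
  exact: (recog_fin_int (fun x : (nat -> letter) * letter => nat_of_ord x.2.1.2)).
move=> W gW; split.
  move=> [W' [LW' [n W'n]] WW']; exists (wval (fun i => (W' i).2)).
  rewrite -env_updw; apply/LP; first exact: good_updw W'n.
  by congr L: LW'; apply/funext => i; apply/funext => v; rewrite /g /updw /= WW'.
move=> [x Px]; have [w [n [wn wx]]] := wval_surj x.
exists (fun i => (W i, w i)) => //; split; last by exists n.
have /LP H : good (updw W j w) by exact: good_updw wn.
by apply/H; rewrite env_updw wx.
Qed.

Lemma rep_not P : rep P -> rep (fun e => ~ P e).
Proof.
move=> [L [rL LP]]; exists (fun W => ~ L W); split; first exact: recog_not.
by move=> W gW; rewrite LP.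
Qed.

Lemma rep_and P Q : rep P -> rep Q -> rep (fun e => P e /\ Q e).
Proof.
move=> [L [rL LP]] [L' [rL' LP']]; exists (fun W => L W /\ L' W).
by split; [exact: recog_and|move=> W gW; rewrite LP ?LP'].
Qed.

Lemma rep_ext P Q : (forall e, P e <-> Q e) -> rep P -> rep Q.
Proof.
move=> PQ [L [rL LP]]; exists L; split=> // W gW; rewrite LP //; exact: PQ.
Qed.

Lemma rep_eq t1 t2 : rep (fun e => eval e t1 = eval e t2).
Proof.
have bI a : `|tI t1 a - tI t2 a| <= (tB t1 + tB t2)%N%:Z.
  by apply: le_trans (ler_normB _ _) _; rewrite PoszD lerD ?tI_bound.
have bF a : `|tF t1 a - tF t2 a| <= (tB t1 + tB t2)%N%:Z.
  by apply: le_trans (ler_normB _ _) _; rewrite PoszD lerD ?tF_bound.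
have [L [rL LE]] := recog_lineq R hk bI bF.
exists L; split=> // W [n Wn]; rewrite (LE W n); last first.
  by move=> i ni; rewrite !(tI0 _ Wn) // subrr.
rewrite !(evalE _ Wn).
have -> : ((fun a => tI t1 a - tI t2 a) \o W) =
  fun i => (tI t1 \o W) i + - (tI t2 \o W) i by [].
have -> : ((fun a => tF t1 a - tF t2 a) \o W) =
  fun i => (tF t1 \o W) i + - (tF t2 \o W) i by [].
rewrite ipartD ipartN (@fracD R k hk _ _ (tB t1) (tB t2)); last 2 first.
- by move=> i; exact: tF_bound.
- by move=> i; rewrite normrN; exact: tF_bound.
rewrite (@fracN R k hk _ (tB t2)); last by move=> i; exact: tF_bound.
by rewrite intrD intrN; split=> [H|H]; lra.
Qed.

(** t1 <= t2 holds when a nonnegative real z satisfies t1 + z = t2. *)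
Lemma rep_le t1 t2 : rep (fun e => eval e t1 <= eval e t2).
Proof.
pose B := ((nat -> letter) * ('I_k * 'I_k))%type.
pose dI (x : B) : int := tI t1 x.1 + (Posz x.2.1 + - tI t2 x.1).
pose dF (x : B) : int := tF t1 x.1 + (Posz x.2.2 + - tF t2 x.1).
pose b := (tB t1 + (k + tB t2))%N.
have ob (c : 'I_k) : `|Posz c| <= k%:Z by have := ltn_ord c; lia.
have bI x : `|dI x| <= b%:Z.
  apply: le_trans (ler_normD _ _) _; rewrite /b PoszD lerD ?tI_bound //.
  by apply: le_trans (ler_normB _ _) _; rewrite PoszD lerD ?tI_bound.
have bF x : `|dF x| <= b%:Z.
  apply: le_trans (ler_normD _ _) _; rewrite /b PoszD lerD ?tF_bound //.
  by apply: le_trans (ler_normB _ _) _; rewrite PoszD lerD ?tF_bound.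
have [L [rL LE]] := recog_lineq R hk bI bF.
have LE' W (z : nat -> 'I_k * 'I_k) n : (forall v, fin_int (fun i => W i v) n) ->
    (forall i, (n <= i)%N -> (z i).1 = 0%N :> nat) ->
    L (fun i => (W i, z i)) <->
    eval (env W) t1 + ((ipart k (fun i => Posz (z i).1) n)%:~R + fr R (fun i => (z i).2))
      = eval (env W) t2.
  move=> Wn zn; rewrite (LE _ n); last first.
    by move=> i ni; rewrite /dI /= zn // !(tI0 _ Wn) // !addr0 oppr0.
  rewrite !(evalE _ Wn).
  have -> : (dI \o (fun i => (W i, z i))) =
    fun i => (tI t1 \o W) i + (Posz (z i).1 + - (tI t2 \o W) i) by [].
  have -> : (dF \o (fun i => (W i, z i))) =
    fun i => (tF t1 \o W) i + (Posz (z i).2 + - (tF t2 \o W) i) by [].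
  rewrite !ipartD ipartN (@fracD R k hk _ _ (tB t1) (k + tB t2)%N); last 2 first.
  - by move=> i; exact: tF_bound.
  - move=> i; apply: le_trans (ler_normB _ _) _; rewrite PoszD lerD //; exact: tF_bound.
  rewrite (@fracD R k hk _ _ k (tB t2)); last 2 first.
  - by move=> i.
  - by move=> i; rewrite normrN; exact: tF_bound.
  rewrite (@fracN R k hk _ (tB t2)); last by move=> i; exact: tF_bound.
  by rewrite !intrD intrN /fr; split=> [H|H]; lra.
exists (fun W => exists2 W' : nat -> B,
  L W' /\ (exists n, forall i, (n <= i)%N -> nat_of_ord (W' i).2.1 = 0%N)
  & forall i, (W' i).1 = W i); split.
  apply: recog_image; apply: recog_and => //.
  exact: (recog_fin_int (fun x : B => nat_of_ord x.2.1)).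
move=> W [n Wn]; split.
  move=> [W' [LW' [m W'm]] WW'].
  have W'E : W' = fun i => (W i, (W' i).2).
    by apply/funext => i; rewrite -WW'; case: (W' i).
  move: LW'; rewrite W'E (LE' _ _ (maxn n m)); last 2 first.
  - by move=> v i; rewrite geq_max => /andP[+ _]; exact: Wn.
  - by move=> i; rewrite geq_max => /andP[_]; exact: W'm.
  move=> <-; rewrite lerDl addr_ge0 ?fr_ge0 // ler0z /ipart sumr_ge0 //.
move=> le12; pose y := eval (env W) t2 - eval (env W) t1.
have y0 : 0 <= y by rewrite subr_ge0.
have [d [m [dm dE]]] := nat_digits (absz (Num.floor y)).
have [w wE] : exists w : nat -> 'I_k, fr R w = y - (Num.floor y)%:~R.
  apply: (fr_surj hk); have := floor_itv y.
  by rewrite intrD => /andP[? ?]; apply/andP; split; lra.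
exists (fun i => (W i, (d i, w i))) => //; split; last by exists m.
apply/(LE' _ _ (maxn n m)).
- by move=> v i; rewrite geq_max => /andP[+ _]; exact: Wn.
- by move=> i; rewrite geq_max => /andP[_]; exact: dm.
rewrite /= dE ?leq_maxr // wE gez0_abs; last by rewrite floor_ge0.
by rewrite /y; ring.
Qed.

(** A word of the automaton is guessed, and the numbers that it denotes are
    compared with the values of the terms. Any expansion of a point of X will
    do, because X is the image of the recognized language. *)
Lemma rep_pred n (X : set 'rV[R]_n) (ts : n.-tuple term) : automatic k X ->
  rep (fun e => X (\row_j eval e (tnth ts j))).
Proof.
move=> [A [AX _]].
pose B := ((nat -> letter) * 'rV['I_k]_n)%type.
pose dI j (x : B) : int := tI (tnth ts j) x.1.
pose dF j (x : B) : int := tF (tnth ts j) x.1 + - Posz (x.2 0 j).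
have ob (c : 'I_k) : `|Posz c| <= k%:Z by have := ltn_ord c; lia.
have bI j x : `|dI j x| <= (tB (tnth ts j) + k)%N%:Z.
  by apply: le_trans (tI_bound _ _) _; rewrite lez_nat leq_addr.
have bF j x : `|dF j x| <= (tB (tnth ts j) + k)%N%:Z.
  by apply: le_trans (ler_normB _ _) _; rewrite PoszD lerD ?tF_bound.
have [L LP] := choice (fun j => recog_lineq R hk (bI j) (bF j)).
exists (fun W => exists2 W' : nat -> B,
  recognized A (snd \o W') /\ (forall j, L j W') & forall i, (W' i).1 = W i); split.
  apply: recog_image; apply: recog_and.
    exact: (recog_preim (snd : B -> _) (recog_buchi A)).
  by apply: recog_all => j; case: (LP j).
move=> W [m Wm].
have E (y : nat -> 'rV['I_k]_n) : (forall j, L j (fun i => (W i, y i))) <->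
    \row_j eval (env W) (tnth ts j) = nu R y.
  have H j : L j (fun i => (W i, y i)) <-> eval (env W) (tnth ts j) = (nu R y) 0 j.
    rewrite ((LP j).2 _ m); last by move=> i mi; exact: tI0 mi.
    rewrite (evalE _ Wm) mxE.
    have -> : (dF j \o (fun i => (W i, y i))) =
      fun i => (tF (tnth ts j) \o W) i + - (Posz (y i 0 j)) by [].
    rewrite (@fracD R k hk _ _ (tB (tnth ts j)) k); last 2 first.
    - by move=> i; exact: tF_bound.
    - by move=> i; rewrite normrN.
    rewrite (@fracN R k hk _ k) //.
    rewrite -[limn _]/(frac R k (fun i => Posz (y i 0 j))).
    have -> : dI j \o (fun i => (W i, y i)) = tI (tnth ts j) \o W by [].
    by split=> H; lra.
  split=> [Hj|/rowP Hj j]; first by apply/rowP => j; rewrite mxE; exact/H.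
  by apply/H; rewrite -Hj mxE.
split.
  move=> [W' [W'A W'L] WW'].
  have W'E : W' = fun i => (W i, (W' i).2).
    by apply/funext => i; rewrite -WW'; case: (W' i).
  move: W'L; rewrite {1}W'E E => ->; rewrite -AX; exists (snd \o W') => //.
rewrite -{1}AX => -[y yA yE]; exists (fun i => (W i, y i)) => //; split=> //.
by apply/E; rewrite yE.
Qed.

Lemma rep_sat n (X : set 'rV[R]_n) phi : automatic k X ->
  rep (fun e => sat X e phi).
Proof.
move=> aX; elim: phi => [t1 t2|t1 t2|ts|p1 I1|p1 I1 p2 I2|p1 I1 p2 I2|j p I|j p I] /=.
- exact: rep_eq.
- apply: rep_ext (rep_not (rep_le t2 t1)) => e; rewrite ltNge; by split=> /negP.
- exact: rep_pred.
- exact: rep_not.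
- exact: rep_and.
- apply: rep_ext (rep_not (rep_and (rep_not I1) (rep_not I2))) => e.
  by split; [move=> /not_andP[/contrapT|/contrapT]; tauto|tauto].
- exact: (rep_ex j I).
- apply: rep_ext (rep_not (rep_ex j (rep_not I))) => e.
  by split; [move=> /forallNP H x; exact: contrapT|move=> H [x]; apply].
Qed.

End Encoding.

(** * First-order definability *)

Definition upd (T : Type) (e : nat -> T) i (x : T) : nat -> T := [eta e with i |-> x].

Lemma updE (T : Type) (e : nat -> T) i x j : upd e i x j = if j == i then x else e j.
Proof. by []. Qed.

Fixpoint tbnd (t : term) : nat :=
  match t with Var v => v.+1 | Add t1 t2 => maxn (tbnd t1) (tbnd t2) end.

Fixpoint fbnd n (phi : formula n) : nat :=
  match phi with
  | FEq t1 t2 => maxn (tbnd t1) (tbnd t2)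
  | FLt t1 t2 => maxn (tbnd t1) (tbnd t2)
  | FPred ts => \max_j tbnd (tnth ts j)
  | FNot p => fbnd p
  | FAnd p q => maxn (fbnd p) (fbnd q)
  | FOr p q => maxn (fbnd p) (fbnd q)
  | FEx i p => maxn i.+1 (fbnd p)
  | FAll i p => maxn i.+1 (fbnd p)
  end.

Fixpoint tren (r : nat -> nat) (t : term) : term :=
  match t with Var v => Var (r v) | Add t1 t2 => Add (tren r t1) (tren r t2) end.

Fixpoint fren n (r : nat -> nat) (phi : formula n) : formula n :=
  match phi with
  | FEq t1 t2 => FEq n (tren r t1) (tren r t2)
  | FLt t1 t2 => FLt n (tren r t1) (tren r t2)
  | FPred ts => FPred (map_tuple (tren r) ts)
  | FNot p => FNot (fren r p)
  | FAnd p q => FAnd (fren r p) (fren r q)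
  | FOr p q => FOr (fren r p) (fren r q)
  | FEx i p => FEx (r i) (fren r p)
  | FAll i p => FAll (r i) (fren r p)
  end.

Section FirstOrder.
Variables (R : realType) (n : nat) (X : set 'rV[R]_n).
Implicit Types (e w : nat -> R) (phi : formula n).

Lemma eval_agree t e e' : (forall v, (v < tbnd t)%N -> e v = e' v) ->
  eval e t = eval e' t.
Proof.
elim: t => [v|t1 I1 t2 I2] /= H; first exact: H.
by rewrite I1 ?I2 // => v vt; apply: H; rewrite leq_max vt ?orbT.
Qed.

Lemma sat_agree phi e e' : (forall v, (v < fbnd phi)%N -> e v = e' v) ->
  sat X e phi <-> sat X e' phi.
Proof.
elim: phi e e' => [t1 t2|t1 t2|ts|p I|p I q J|p I q J|i p I|i p I] e e' /= H.
- by rewrite (@eval_agree t1 e e') ?(@eval_agree t2 e e') // => v vt;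
    apply: H; rewrite leq_max vt ?orbT.
- by rewrite (@eval_agree t1 e e') ?(@eval_agree t2 e e') // => v vt;
    apply: H; rewrite leq_max vt ?orbT.
- suff -> : \row_j eval e (tnth ts j) = \row_j eval e' (tnth ts j) by [].
  apply/rowP => j; rewrite !mxE; apply: eval_agree => v vt; apply: H.
  exact: leq_trans vt (leq_bigmax j).
- by rewrite (I e e').
- by rewrite (I e e') ?(J e e') // => v vt; apply: H; rewrite leq_max vt ?orbT.
- by rewrite (I e e') ?(J e e') // => v vt; apply: H; rewrite leq_max vt ?orbT.
- have E x : sat X [eta e with i |-> x] p <-> sat X [eta e' with i |-> x] p.
    by apply: I => v vt /=; case: ifP => // _; apply: H; rewrite leq_max vt orbT.
  by split=> -[x Hx]; exists x; apply/E.
- have E x : sat X [eta e with i |-> x] p <-> sat X [eta e' with i |-> x] p.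
    by apply: I => v vt /=; case: ifP => // _; apply: H; rewrite leq_max vt orbT.
  by split=> H1 x; apply/E.
Qed.

Lemma eval_ren r t e : eval e (tren r t) = eval (e \o r) t.
Proof. by elim: t => //= t1 -> t2 ->. Qed.

Lemma upd_ren (r : nat -> nat) e (i : nat) (x : R) : injective r ->
  [eta e with r i |-> x] \o r = [eta (e \o r) with i |-> x].
Proof. by move=> ri; apply/funext => v /=; rewrite (inj_eq ri). Qed.

Lemma sat_ren r phi e : injective r -> sat X e (fren r phi) <-> sat X (e \o r) phi.
Proof.
move=> ri; elim: phi e => [t1 t2|t1 t2|ts|p I|p I q J|p I q J|i p I|i p I] e /=.
- by rewrite !eval_ren.
- by rewrite !eval_ren.
- suff -> : \row_j eval e (tnth (map_tuple (tren r) ts) j) =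
            \row_j eval (e \o r) (tnth ts j) by [].
  by apply/rowP => j; rewrite !mxE tnth_map eval_ren.
- by rewrite I.
- by rewrite I J.
- by rewrite I J.
- by split=> -[x Hx]; exists x; move: Hx; rewrite I upd_ren.
- by split=> H x; move: (H x); rewrite I upd_ren.
Qed.

(** An environment whose first B entries are the parameters and whose other
    entries are auxiliary variables: quantifying over auxiliary variables never
    captures a parameter. *)
Definition mix B e w (v : nat) : R := if (v < B)%N then e v else w (v - B)%N.

(** The relation Q has a formula for every large number B of parameters, and not
    just for one, because the connectives bring together relations with
    different sets of parameters. *)
Definition fo (Q : (nat -> R) -> (nat -> R) -> Prop) :=
  exists B0, forall B, (B0 <= B)%N -> exists phi, forall e w, sat X (mix B e w) phi <-> Q e w.

Definition foterm (f : (nat -> R) -> (nat -> R) -> R) :=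
  exists B0, forall B, (B0 <= B)%N -> exists t, forall e w, eval (mix B e w) t = f e w.

(** A definable set and its parameters: as in [definable], the variable of index
    0 is the element of the set, so F e does not depend on the entry e 0. *)
Definition fam (F : (nat -> R) -> set R) :=
  exists phi, forall e x, F e x <-> sat X (upd e 0%N x) phi.

Definition sentence (Q : (nat -> R) -> Prop) :=
  exists phi, forall e, sat X e phi <-> Q e.

Lemma mix_upd B e w i x : mix B e (upd w i x) = [eta mix B e w with (B + i)%N |-> x].
Proof.
apply/funext => v; rewrite /mix /upd /=; case: ltnP => vB.
  by rewrite ifF //; apply/negbTE; lia.
have -> : ((v - B)%N == i) = (v == (B + i)%N) by lia.
by [].
Qed.

Lemma fo_ext Q Q' : (forall e w, Q e w <-> Q' e w) -> fo Q -> fo Q'.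
Proof.
by move=> QQ' [B0 H]; exists B0 => B /H [phi Hp]; exists phi => e w; rewrite Hp.
Qed.

Lemma fo_not Q : fo Q -> fo (fun e w => ~ Q e w).
Proof.
move=> [B0 H]; exists B0 => B /H [phi Hp]; exists (FNot phi) => e w /=.
by rewrite Hp.
Qed.

Lemma fo_and Q Q' : fo Q -> fo Q' -> fo (fun e w => Q e w /\ Q' e w).
Proof.
move=> [B0 H] [B1 H1]; exists (maxn B0 B1) => B; rewrite geq_max => /andP[].
move=> /H [p Hp] /H1 [q Hq]; exists (FAnd p q) => e w /=.
by rewrite Hp Hq.
Qed.

Lemma fo_or Q Q' : fo Q -> fo Q' -> fo (fun e w => Q e w \/ Q' e w).
Proof.
move=> [B0 H] [B1 H1]; exists (maxn B0 B1) => B; rewrite geq_max => /andP[].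
move=> /H [p Hp] /H1 [q Hq]; exists (FOr p q) => e w /=.
by rewrite Hp Hq.
Qed.

Lemma fo_imp Q Q' : fo Q -> fo Q' -> fo (fun e w => Q e w -> Q' e w).
Proof.
move=> fQ fQ'; apply: fo_ext (fo_or (fo_not fQ) fQ') => e w.
split=> [|H]; first by tauto.
by have [q|nq] := pselect (Q e w); [right; exact: H|left].
Qed.

Lemma fo_ex i Q : fo Q -> fo (fun e w => exists x, Q e (upd w i x)).
Proof.
move=> [B0 H]; exists B0 => B /H [p Hp]; exists (FEx (B + i) p) => e w /=.
by split=> -[x Hx]; exists x; move: Hx; rewrite -mix_upd Hp.
Qed.

Lemma fo_all i Q : fo Q -> fo (fun e w => forall x, Q e (upd w i x)).
Proof.
move=> [B0 H]; exists B0 => B /H [p Hp]; exists (FAll (B + i) p) => e w /=.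
by split=> Hx x; move: (Hx x); rewrite -mix_upd Hp.
Qed.

Lemma foterm_aux i : foterm (fun e w => w i).
Proof.
exists 0%N => B _; exists (Var (B + i)) => e w /=.
by rewrite /mix ifF ?addKn //; apply/negbTE; lia.
Qed.

Lemma foterm_par v : foterm (fun e w => e v).
Proof. by exists v.+1 => B vB; exists (Var v) => e w /=; rewrite /mix vB. Qed.

Lemma foterm_add f g : foterm f -> foterm g -> foterm (fun e w => f e w + g e w).
Proof.
move=> [B0 H] [B1 H1]; exists (maxn B0 B1) => B; rewrite geq_max => /andP[].
by move=> /H [p Hp] /H1 [q Hq]; exists (Add p q) => e w /=; rewrite Hp Hq.
Qed.

Lemma foterm_muln f m : foterm f -> foterm (fun e w => f e w *+ m.+1).
Proof.
move=> ff; elim: m => [|m IH].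
  by case: ff => B H; exists B => B' /H [t Ht]; exists t => e w; rewrite Ht.
case: (foterm_add ff IH) => B H; exists B => B' /H [t Ht]; exists t => e w.
by rewrite Ht [RHS]mulrS.
Qed.

Lemma fo_lt f g : foterm f -> foterm g -> fo (fun e w => f e w < g e w).
Proof.
move=> [B0 H] [B1 H1]; exists (maxn B0 B1) => B; rewrite geq_max => /andP[].
by move=> /H [p Hp] /H1 [q Hq]; exists (FLt n p q) => e w /=; rewrite Hp Hq.
Qed.

Lemma fo_eq f g : foterm f -> foterm g -> fo (fun e w => f e w = g e w).
Proof.
move=> [B0 H] [B1 H1]; exists (maxn B0 B1) => B; rewrite geq_max => /andP[].
by move=> /H [p Hp] /H1 [q Hq]; exists (FEq n p q) => e w /=; rewrite Hp Hq.
Qed.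

Lemma fo_le f g : foterm f -> foterm g -> fo (fun e w => f e w <= g e w).
Proof.
move=> ff fg; apply: fo_ext (fo_not (fo_lt fg ff)) => e w.
by rewrite leNgt; split=> /negP.
Qed.

Lemma fo_lt_aux i j : fo (fun e w => w i < w j).
Proof. exact: fo_lt (foterm_aux i) (foterm_aux j). Qed.

Lemma fo_gt0 f : foterm f -> fo (fun e w => 0 < f e w).
Proof. by move=> ff; apply: fo_ext (fo_lt ff (foterm_add ff ff)) => e w; rewrite ltrDl. Qed.

Lemma fo_ge0 f : foterm f -> fo (fun e w => 0 <= f e w).
Proof. by move=> ff; apply: fo_ext (fo_le ff (foterm_add ff ff)) => e w; rewrite lerDl. Qed.

Lemma fo_true : fo (fun _ _ => True).
Proof.
exists 0%N => B _; exists (FEq n (Var 0) (Var 0)) => e w /=; by split.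
Qed.

Lemma fo_all_lt b (Q : nat -> _) : (forall v, fo (Q v)) ->
  fo (fun e w => forall v, (v < b)%N -> Q v e w).
Proof.
move=> fQ; elim: b => [|b IH]; first by apply: fo_ext fo_true => e w; split.
apply: fo_ext (fo_and IH (fQ b)) => e w; split.
  by move=> [H Hb] v; rewrite ltnS leq_eqVlt => /orP[/eqP->|/H].
by move=> H; split=> [v vb|]; apply: H; rewrite // ltnW.
Qed.

(** The variable 0 of the formula for F is not an auxiliary variable, hence the
    detour through an equation. *)
Lemma fo_fam F i : fam F -> fo (fun e w => F e (w i)).
Proof.
move=> [phi Hp]; exists (fbnd phi).+1 => B Bb.
exists (FEx 0 (FAnd (FEq n (Var 0) (Var (B + i))) phi)) => e w /=.
have -> : (B + i == 0)%N = false by lia.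
have E x : sat X [eta mix B e w with 0%N |-> x] phi <-> F e x.
  rewrite Hp; apply: sat_agree => v vb; rewrite /upd /=; case: ifP => // _.
  by rewrite /mix ifT // (ltn_trans vb).
have -> : mix B e w (B + i)%N = w i.
  by rewrite /mix ifF ?addKn //; apply/negbTE; lia.
by split=> [[x [-> /E]]//|H]; exists (w i); split=> //; exact/E.
Qed.

Lemma fo_fam_shift F j : fam F -> fo (fun e w => F (fun v => w (j + v)%N) (w j)).
Proof.
move=> [phi Hp]; exists 0%N => B _; exists (fren (fun v => B + (j + v))%N phi) => e w.
rewrite sat_ren; last by move=> x y /addnI /addnI.
rewrite Hp.
have -> : mix B e w \o (fun v => (B + (j + v))%N) = fun v => w (j + v)%N.
  apply/funext => v; rewrite /= /mix ifF ?addKn //; apply/negbTE; lia.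
suff -> : upd (fun v => w (j + v)%N) 0%N (w j) = fun v => w (j + v)%N by [].
by apply/funext => v; rewrite /upd /=; case: eqP => // ->; rewrite addn0.
Qed.

Lemma sentence_fo (Q : (nat -> R) -> Prop) : fo (fun e w => Q e) -> sentence Q.
Proof.
move=> [B H]; have [phi Hp] := H B (leqnn B); exists phi => e.
rewrite -(Hp e (fun i => e (B + i)%N)).
suff -> : mix B e (fun i => e (B + i)%N) = e by [].
by apply/funext => v; rewrite /mix; case: ltnP => // vB; rewrite subnKC.
Qed.

Lemma fam_indep F e x : fam F -> F (upd e 0%N x) = F e.
Proof.
move=> [phi Hp]; apply/seteqP; split=> y /Hp H; apply/Hp.
  by apply: (sat_agree _).1 H => v _; rewrite /upd /=; case: eqP.
by apply: (sat_agree _).1 H => v _; rewrite /upd /=; case: eqP.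
Qed.

Lemma fam_agree F : fam F ->
  exists b, forall e e', (forall v, (0 < v < b)%N -> e v = e' v) -> F e = F e'.
Proof.
move=> [phi Hp]; exists (fbnd phi) => e e' H; apply/seteqP; split=> x /Hp Hx; apply/Hp.
  by apply: (sat_agree _).1 Hx => -[|v] vb; rewrite /upd //=; exact: H.
by apply: (sat_agree _).1 Hx => -[|v] vb; rewrite /upd //= H.
Qed.

Lemma fam_fo F : fo (fun e w => F e (w 0%N)) ->
  (forall e x, F (upd e 0%N x) x <-> F e x) -> fam F.
Proof.
move=> [B0 H] Find; pose B := B0.+1; have [phi Hp] := H B (leqnSn _).
exists (FEx B (FAnd (FEq n (Var B) (Var 0)) phi)) => e x /=.
rewrite eqxx /= -Find {1}/upd /=.
have E : upd (upd e 0%N x) B x =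
  mix B (upd e 0%N x) (fun i => if i == 0%N then x else e (B + i)%N).
  apply/funext => v; rewrite /mix {1}/upd /=; case: ltnP => vB; first by rewrite ltn_eqF.
  have -> : (v - B == 0)%N = (v == B) by lia.
  case: eqP => // _; rewrite /upd /= ifF ?subnKC //; apply/negbTE; lia.
have P := Hp (upd e 0%N x) (fun i => if i == 0%N then x else e (B + i)%N).
rewrite -E /= in P; split=> [/P Hx|[y [-> Hy]]]; first by exists x.
exact/P.
Qed.

Lemma definable_fam (D : set R) :
  definable X D <-> exists F e, fam F /\ D = F e.
Proof.
split=> [[phi [e ->]]|[F [e [[phi Hp] ->]]]].
  by exists (fun e => [set x | sat X (upd e 0%N x) phi]), e; split=> //; exists phi.
by exists phi, e; apply/seteqP; split=> x /Hp.
Qed.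

End FirstOrder.

(** * Periodic parameters *)

Section Transfer.
Variables (R : realType) (k : nat) (hk : (1 < k)%N) (n : nat) (X : set 'rV[R]_n).
Hypothesis aX : automatic k X.

Definition periodic (W : nat -> nat -> letter k) m t :=
  [/\ (0 < m)%N, (0 < t)%N, forall i, (m <= i)%N -> W (i + t)%N = W i &
      forall i v, (m <= i)%N -> (W i v).1.2 = 0%N :> nat].

(** This expansion of 1 is constant after its first letter, and so it survives
    any change that repeats or removes later letters. *)
Definition oneword (i : nat) : letter k :=
  (false, if i == 0%N then Ordinal hk else Ordinal (ltnW hk), Ordinal (ltnW hk)).

Lemma fin_oneword : fin_int oneword 1.
Proof. by case. Qed.

Lemma frac0 : frac R k (fun=> 0) = 0.
Proof.
symmetry; apply: (frac_unique hk (b := 0%N) (C := 0)) => // m; exists m => //.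
by rewrite sub0r normrN /psum big1 ?normr0 ?mul0r // => i _; rewrite mul0r.
Qed.

Lemma val_oneword : wval R oneword = 1.
Proof.
rewrite (wvalE R fin_oneword) ipartS ipart0 /= /idig /= expn0 mulr1 add0r.
by rewrite -[X in _ + X]/(frac R k (fun=> 0)) frac0 addr0.
Qed.

(** The parameters with the property form a recognizable language, and a
    nonempty recognizable language contains an ultimately periodic word. The
    constant 1 is not definable in the ordered additive group of reals, but it
    may be kept among the parameters. *)
Lemma transfer (Q : (nat -> R) -> Prop) e c : sentence X Q -> Q e -> e c = 1 ->
  exists W m t, [/\ periodic W m t, Q (env R W) & env R W c = 1].
Proof.
move=> [phi Hp] Qe ec; pose b := maxn (fbnd phi) c.+1.
have [W [gW WE]] : exists W : nat -> nat -> letter k, good W /\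
    env R W = fun v => if (v < b)%N then e v else 0.
  by apply: (env_surj hk (b := b)) => v vb; rewrite ltnNge vb.
pose W1 := updw W c oneword.
have [m W1m] : good W1 by exact: good_updw fin_oneword.
have W1E : env R W1 = env R W.
  rewrite /W1 env_updw val_oneword WE; apply/funext => v /=.
  by case: eqP => // ->; rewrite leq_maxr ec.
have [L [[M [mu rmu]] LP]] := rep_sat hk phi aX.
have LW1 : L W1.
  apply/LP; first by exists m.
  rewrite W1E WE; apply: (sat_agree X _).1 ((Hp e).2 Qe) => v vb.
  by rewrite ifT // leq_max vb.
have [m2 [t [mm2 m20 t0 LU]]] := periodize m.+1 rmu LW1.
have m2m : (m <= m2)%N by exact: ltnW.
have per : periodic (looped W1 m2 t) m2 t.
  split=> // [i mi|i v mi]; first exact: looped_periodic.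
  have [j m2j ->] := looped_suffix W1 t mi; apply: W1m; exact: leq_trans m2j.
exists (looped W1 m2 t), m2, t; split=> //.
  apply/Hp/LP => //; exists m2 => v i mi; by case: per => _ _ _; exact.
rewrite -val_oneword /env; congr wval; apply/funext => i.
have [im|mi] := ltnP i m2; first by rewrite looped_prefix // /W1 /updw eqxx.
have [j m2j ->] := looped_suffix W1 t mi; rewrite /W1 /updw eqxx /oneword.
by rewrite !gtn_eqF // (leq_trans m20).
Qed.

End Transfer.

(** * Sets with finitely many local types *)

Section Sections.
Variables (R : realType) (k : nat) (hk : (1 < k)%N).

Lemma psum_digits t N : (N < k ^ t)%N ->
  exists d : nat -> 'I_k, psum R k (fun j => Posz (d j)) t = N%:R / k%:R ^+ t.
Proof.
elim: t N => [|t IH] N Nt.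
  exists (fun=> Ordinal (ltnW hk)); rewrite psum0.
  by move: Nt; rewrite expn0 ltnS leqn0 => /eqP ->; rewrite mul0r.
have [d dE] : exists d : nat -> 'I_k,
    psum R k (fun j => Posz (d j)) t = (N %/ k)%:R / k%:R ^+ t.
  by apply: IH; rewrite ltn_divLR ?(ltnW hk) // -expnSr.
have ck : (N %% k < k)%N by rewrite ltn_mod ltnW.
exists (fun j => if j == t then Ordinal ck else d j).
rewrite psumS eqxx (_ : psum _ _ _ t = psum R k (fun j => Posz (d j)) t); last first.
  by apply: eq_big_nat => j jt; rewrite ltn_eqF //; case/andP: jt.
have E : N%:R = (N %/ k)%:R * k%:R + (N %% k)%:R :> R.
  by rewrite {1}(divn_eq N k) natrD natrM.
rewrite dE E exprS /= -pmulrn; field.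
by rewrite (kX_neq0 R hk) gt_eqF // (k_gt0 R hk).
Qed.

Lemma psum_ext d d' m : (forall i, (i < m)%N -> d i = d' i) -> psum R k d m = psum R k d' m.
Proof. by move=> H; apply: eq_big_nat => i /H ->. Qed.

Lemma fr_prefix (w : nat -> 'I_k) m N :
  psum R k (fun j => Posz (w j)) m = N%:R / k%:R ^+ m ->
  fr R w = (N%:R + fr R (fun i => w (m + i)%N)) / k%:R ^+ m.
Proof. by move=> E; rewrite (fr_split R hk w m) E mulrDl. Qed.

Section Blocks.
Variables (t : nat) (t0 : (0 < t)%N).
Let K := (k ^ t)%N.

Lemma K_gt1 : (1 < K)%N.
Proof. by rewrite /K -(exp1n t) ltn_exp2r. Qed.

Lemma digs_exist : exists digs : 'I_K -> nat -> 'I_k,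
  forall d, psum R k (fun j => Posz (digs d j)) t = d%:R / k%:R ^+ t.
Proof.
have H (d : 'I_K) : exists e : nat -> 'I_k,
    psum R k (fun j => Posz (e j)) t = d%:R / k%:R ^+ t.
  by apply: psum_digits; exact: ltn_ord.
by have [f fP] := choice H; exists f.
Qed.

Variables (digs : 'I_K -> nat -> 'I_k)
  (digsP : forall d, psum R k (fun j => Posz (digs d j)) t = d%:R / k%:R ^+ t).

Definition flat (w : nat -> 'I_K) n := digs (w (n %/ t)%N) (n %% t)%N.

Lemma flatE w l i : (i < t)%N -> flat w (t * l + i) = digs (w l) i.
Proof.
move=> it; rewrite /flat mulnC divnMDl // modnMDl.
by rewrite divn_small // addn0 modn_small.
Qed.

Lemma fr_flat w : fr R (flat w) = fr R w.
Proof.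
have KX l : K%:R ^+ l = k%:R ^+ (t * l) :> R by rewrite exprM natrX.
have pE l : psum R k (fun j => Posz (flat w j)) (t * l) = psum R K (fun j => Posz (w j)) l.
  elim: l => [|l IH]; first by rewrite muln0 !psum0.
  rewrite mulnS addnC psum_cat // IH psumS; congr (_ + _).
  rewrite (psum_ext (d' := fun j => Posz (digs (w l) j))); last by move=> i /flatE ->.
  by rewrite digsP exprS KX /K natrX -pmulrn invfM mulrA.
symmetry; apply: (frac_unique hk (C := (K.-1)%:R) (ord_bound hk (flat w))) => m.
exists (t * m)%N; first by rewrite leq_pmull.
by rewrite pE -KX; apply: (frac_close R K_gt1 _ (ord_bound K_gt1 w)).
Qed.

End Blocks.

Variables (n : nat) (X : set 'rV[R]_n) (aX : automatic k X).

Let z0 : 'I_k := Ordinal (ltnW hk).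
Definition fword (d : nat -> 'I_k) (i : nat) : letter k := (false, z0, d i).

Lemma val_fword d : wval R (fword d) = fr R d.
Proof.
rewrite (@wvalE R k (fword d) 0) // ipart0 add0r.
by rewrite /fr; apply: eq_frac.
Qed.

Lemma periodic_mul (W : nat -> nat -> letter k) m t : periodic W m t ->
  forall l i, W (m + i + t * l)%N = W (m + i)%N.
Proof.
move=> [_ _ Wt _]; elim=> [|l IH] i; first by rewrite muln0 addn0.
by rewrite mulnS addnCA addnC Wt ?IH // -addnA leq_addr.
Qed.

Lemma good_periodic (W : nat -> nat -> letter k) m t : periodic W m t -> @good k W.
Proof. by move=> [_ _ _ H]; exists m => v i mi; exact: H. Qed.

(** After the preperiod of the parameters, the base-k^t digits of the points of a
    definable set are recognized by a finite monoid without parameters. *)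
Lemma pure_cells F (W : nat -> nat -> letter k) m t : fam X F -> periodic W m t ->
  exists (M : finType) (nu : seq 'I_(k ^ t) -> M), forall a, (a < k ^ m)%N ->
    recognizes nu (fun w => F (env R W) ((a%:R + fr R w) / k%:R ^+ m)).
Proof.
move=> [phi Hphi] per; have [m0 t0 Wt Wz] := per.
have [L [[M [mu [mc ms]]] LP]] := rep_sat hk phi aX.
have [digs digsP] := digs_exist t.
pose updl (a : nat -> letter k) (c : 'I_k) v := if v == 0%N then (false, z0, c) else a v.
pose blk (d : 'I_(k ^ t)) := [seq updl (W (m + j)%N) (digs d j) | j <- iota 0 t].
pose nu u := mu (flatten (map blk u)).
exists M, nu => a am.
have [da daE] := psum_digits am.
pose xd (w : nat -> 'I_(k ^ t)) i := if (i < m)%N then da i else flat digs w (i - m).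
pose W' w := updw W 0 (fword (xd w)).
have frxd w : fr R (xd w) = (a%:R + fr R w) / k%:R ^+ m.
  rewrite (@fr_prefix _ m a).
    rewrite -(fr_flat t0 digsP); congr (_ / _); congr (_ + fr R _).
    by apply/funext => i; rewrite /xd ifF ?addKn //; apply/negbTE; lia.
  by rewrite -daE; apply: psum_ext => i im; rewrite /xd im.
have FL w : F (env R W) ((a%:R + fr R w) / k%:R ^+ m) <-> L (W' w).
  rewrite LP; last by apply: good_updw (_ : fin_int _ 0) => //; exact: good_periodic per.
  by rewrite Hphi /W' env_updw val_fword frxd.
have segW' w i j : (i <= j)%N ->
    seg (W' w) (m + t * i) (m + t * j) = flatten (map blk (seg w i j)).
  move=> ij; rewrite -(subnKC ij); elim: (j - i)%N => [|l IH].
    by rewrite addn0 !seg_nil.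
  rewrite addnS -(@seg_cat _ (W' w) _ (m + t * (i + l))); last 2 first.
  - by rewrite leq_add2l leq_mul2l leq_addr orbT.
  - by rewrite leq_add2l leq_mul2l leqnSn orbT.
  rewrite -(@seg_cat _ w i (i + l)) ?leq_addr // map_cat flatten_cat IH seg1 /= cats0.
  congr (_ ++ _); apply: (@eq_from_nth _ (W 0%N)); rewrite size_seg ?/blk ?size_map ?size_iota.
    by rewrite mulnS; lia.
  move=> b bt; have {}bt : (b < t)%N by move: bt; rewrite mulnS; lia.
  rewrite nth_seg; last by rewrite mulnS; lia.
  rewrite (nth_map 0%N) ?size_iota // nth_iota // add0n.
  apply/funext => v; rewrite /W' /updw /updl /fword /xd.
  rewrite -addnA ltnNge leq_addr /= addKn.
  rewrite flatE //; case: ifP => // _.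
  by rewrite [(_ + b)%N]addnC addnA (periodic_mul per).
split.
  by move=> u u' v v' eu ev; rewrite /nu !map_cat !flatten_cat; exact: mc.
move=> w w' f g [f0 fi] [g0 gi] fg; rewrite !FL.
pose ex h i := if i is i'.+1 then (m + t * h i')%N else 0%N.
have exP h : h 0%N = 0%N -> (forall i, (h i < h i.+1)%N) -> cuts (ex h).
  move=> h0 hi; split=> // -[|i] /=; first by rewrite addn_gt0 m0.
  by rewrite ltn_add2l ltn_mul2l t0 hi.
apply: (ms _ _ (ex f) (ex g)); [exact: exP|exact: exP|].
move=> [|i] /=.
  rewrite f0 g0 !muln0 !addn0; congr mu; apply: eq_seg => i /andP[_ im].
  by apply/funext => v; rewrite /W' /updw /fword /xd im.
by rewrite !segW' ?(ltnW (fi i)) ?(ltnW (gi i)) //; exact: fg.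
Qed.

End Sections.

(** An analogue of finite kernels of automatic sequences: the set shows finitely
    many patterns in the cells [z, z + 1] / (r * K ^ i) of all scales i. *)
Definition fintypes (R : realType) (r K : nat) (Y : set R) : Prop :=
  exists (T : finType) (tp : nat -> int -> T), forall i z j z', tp i z = tp j z' ->
    forall x, 0 <= x <= 1 ->
    (Y ((z%:~R + x) / (r * K ^ i)%N%:R) <-> Y ((z'%:~R + x) / (r * K ^ j)%N%:R)).

(** The type of a cell of the unit interval consists of the cell of scale 0 that
    contains it and of the value of its digits. A cell that does not lie in the
    unit interval meets the set at most in its endpoints. *)
Lemma periodic_fintypes (R : realType) (k : nat) (hk : (1 < k)%N) n (X : set 'rV[R]_n)
    (aX : automatic k X) F (W : nat -> nat -> letter k) m t : fam X F -> periodic W m t ->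
  F (env R W) `<=` `[0, 1] -> fintypes (k ^ m) (k ^ t) (F (env R W)).
Proof.
move=> fF per; set Y := F _ => Y01.
have [M [nu nuP]] := pure_cells hk aX fF per.
have t0 : (0 < t)%N by case: per.
set r := (k ^ m)%N; set K := (k ^ t)%N; have K1 : (1 < K)%N := K_gt1 hk t0.
have r0 : (0 < r)%N by rewrite expn_gt0 ltnW.
have K0 i : (0 < K ^ i)%N by rewrite expn_gt0 ltnW.
have [dg dgP] : exists dg : nat -> nat -> nat -> 'I_K, forall i N, (N < K ^ i)%N ->
    psum R K (fun j => Posz (dg i N j)) i = N%:R / K%:R ^+ i.
  have H (iN : nat * nat) : exists d : nat -> 'I_K, (iN.2 < K ^ iN.1)%N ->
      psum R K (fun j => Posz (d j)) iN.1 = iN.2%:R / K%:R ^+ iN.1.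
    have [lt|ge] := boolP (iN.2 < K ^ iN.1)%N; last by exists (fun=> Ordinal (ltnW K1)).
    by have [d dE] := psum_digits R K1 lt; exists d.
  have [d dP] := choice H; exists (fun i N => d (i, N)) => i N; exact: (dP (i, N)).
pose wd i N := seg (dg i N) 0 i.
pose T := ((bool * bool) + ('I_r * M))%type.
have ar i z : (0 <= z < (r * K ^ i)%N%:Z) -> (absz z %/ K ^ i < r)%N.
  by move=> H; rewrite ltn_divLR //; lia.
pose tp i z : T :=
  if 0 <= z < (r * K ^ i)%N%:Z then
    inr (Ordinal (ltn_pmod (absz z %/ K ^ i) r0), nu (wd i (absz z %% K ^ i)%N))
  else inl (`[< Y (z%:~R / (r * K ^ i)%N%:R) >], `[< Y ((z%:~R + 1) / (r * K ^ i)%N%:R) >]).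
have out i z x : ~~ (0 <= z < (r * K ^ i)%N%:Z) -> 0 < x -> x < 1 ->
    ~ Y ((z%:~R + x) / (r * K ^ i)%N%:R).
  have D0 : 0 < (r * K ^ i)%N%:R :> R by rewrite ltr0n muln_gt0 r0 K0.
  move=> zr x0 x1 /Y01; rewrite /= in_itv /= ler_pdivlMr ?D0 // ler_pdivrMr ?D0 //.
  rewrite mul0r mul1r => /andP[h1 h2]; move: zr; rewrite negb_and -!ltNge -leNgt.
  case/orP => h.
    have : z%:~R <= -1 :> R by rewrite -[-1]/((-1)%:~R) ler_int; lia.
    lra.
  have : (r * K ^ i)%N%:Z%:~R <= z%:~R :> R by rewrite ler_int.
  by rewrite -pmulrn; lra.
have inr_case i z (h : 0 <= z < (r * K ^ i)%N%:Z) (w : nat -> 'I_K) :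
    Y ((z%:~R + fr R w) / (r * K ^ i)%N%:R) <->
    F (env R W) (((absz z %/ K ^ i)%N%:R
      + fr R (wcat (wd i (absz z %% K ^ i)%N) w)) / k%:R ^+ m).
  rewrite -/Y; have zi : (absz z %% K ^ i < K ^ i)%N by rewrite ltn_mod.
  have sw : size (wd i (absz z %% K ^ i)%N) = i by rewrite size_seg subn0.
  rewrite (@fr_prefix R K K1 (wcat (wd i (absz z %% K ^ i)%N) w) i (absz z %% K ^ i)%N); last first.
    rewrite -dgP //; apply: psum_ext => j ji.
    by rewrite /= /wcat sw ji /wd nth_seg ?subn0.
  have -> : (fun l => wcat (wd i (absz z %% K ^ i)%N) w (i + l)%N) = w.
    by apply/funext => l; have := wcat_addn (wd i (absz z %% K ^ i)%N) w l; rewrite sw.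
  suff -> : (z%:~R + fr R w) / (r * K ^ i)%N%:R =
    ((absz z %/ K ^ i)%N%:R + ((absz z %% K ^ i)%N%:R + fr R w) / K%:R ^+ i) / k%:R ^+ m by [].
  have -> : z%:~R = (absz z %/ K ^ i)%N%:R * K%:R ^+ i + (absz z %% K ^ i)%N%:R :> R.
    rewrite -natrX -natrM -natrD -divn_eq pmulrn gez0_abs //; lia.
  rewrite natrM !natrX -[(k%:R ^+ m)]natrX -/r; field.
  by rewrite pnatr_eq0 gt_eqF //= expf_neq0 // (kX_neq0 R hk).
exists T, tp => i z j z'; rewrite /tp.
case: ifPn => h; case: ifPn => h' // [].
- rewrite (modn_small (ar i z h)) (modn_small (ar j z' h')) => e1 e2 x x01; have [w <-] := fr_surj K1 x01.
  rewrite !inr_case // e1.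
  have rn := nuP _ (ar j z' h').
  have P (u u' : seq 'I_K) : nu u = nu u' ->
     F (env R W) (((absz z' %/ K ^ j)%N%:R + fr R (wcat u w)) / k%:R ^+ m) ->
     F (env R W) (((absz z' %/ K ^ j)%N%:R + fr R (wcat u' w)) / k%:R ^+ m).
    move=> uu'; apply: (recognizes_prefix (i := size u) (j := size u') rn).
      by rewrite !seg_wcat0.
    by move=> l; rewrite !wcat_addn.
  by split; apply: P.
- move=> e1 e2 x /andP[x0 x1].
  have [->|x0'] := eqVneq x 0; first by rewrite !addr0; exact: asbool_eq_equiv e1.
  have [->|x1'] := eqVneq x 1; first exact: asbool_eq_equiv e2.
  by split=> H; exfalso; [apply: (out i z x h)|apply: (out j z' x h')] => //;
    rewrite lt_neqAle ?x0 ?x1 ?andbT // eq_sym.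
Qed.

(** * Topology of the line in terms of its order *)

Section OrderTopology.
Variable R : realType.
Implicit Types (S C Y : set R) (x y a b : R).

(** Closure, derived set and nowhere density in terms of the order, so that they
    can be expressed by formulas. *)
Definition oclosure S : set R :=
  [set x | forall a b, a < x -> x < b -> exists y, [/\ S y, a < y & y < b]].

Definition derived S : set R :=
  [set x | forall a b, a < x -> x < b -> exists y, [/\ S y, y <> x, a < y & y < b]].

Definition codense S := forall a b, a < b -> exists y, [/\ a < y, y < b & ~ S y].

Definition nwd S := forall a b, a < b ->
  exists c d, [/\ a < c, c < d, d < b & forall x, c < x -> x < d -> ~ S x].

Lemma nbhs_oitv x (A : set R) :
  nbhs x A <-> exists a b, [/\ a < x, x < b & forall y, a < y -> y < b -> A y].
Proof.
split.
  move=> /nbhs_ballP[e /= e0 He]; exists (x - e), (x + e); split.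
  - by rewrite ltrBlDr ltrDl.
  - by rewrite ltrDl.
  by move=> y ay yb; apply: He; rewrite /ball /= ltr_distlC; apply/andP; split; lra.
move=> [a [b [ax xb H]]]; apply/nbhs_ballP; exists (Num.min (x - a) (b - x)) => /=.
  by rewrite lt_min !subr_gt0 ax.
move=> y; rewrite /ball /= lt_min !ltr_norml => /andP[/andP[h1 h2] /andP[h3 h4]].
by apply: H; lra.
Qed.

Lemma closureE S : closure S = oclosure S.
Proof.
apply/seteqP; split=> x Hx.
  move=> a b ax xb; have [|y [Sy /andP[ay yb]]] := Hx [set y | a < y < b].
    by apply/nbhs_oitv; exists a, b; split=> // y ay yb /=; rewrite ay.
  by exists y.
move=> A /nbhs_oitv[a [b [ax xb HA]]]; have [y [Sy ay yb]] := Hx a b ax xb.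
by exists y; split=> //; exact: HA.
Qed.

Lemma sub_oclosure S : S `<=` oclosure S.
Proof. by move=> x Sx a b ax xb; exists x. Qed.

Lemma oclosure_idem S : oclosure (oclosure S) `<=` oclosure S.
Proof.
move=> x Hx a b ax xb; have [y [Sy ay yb]] := Hx a b ax xb; exact: Sy.
Qed.

Lemma cantorP C : cantor_set C <->
  [/\ C !=set0, exists M, forall x, C x -> `|x| <= M, oclosure C `<=` C,
      C `<=` derived C & codense C].
Proof.
split.
  move=> [C0 Cc Ci Co]; split=> //.
  - have [M [Mr HM]] := compact_bounded Cc.
    by exists (`|M| + 1) => x Cx; apply: (HM (`|M| + 1)) => //; have := ler_norm M; lra.
  - by rewrite -closureE; exact: compact_closed.
  - move=> x Cx a b ax xb; apply: contrapT => H.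
    suff : isolated C x by rewrite Ci.
    split; first exact: mem_set.
    exists [set y | a < y < b].
      by apply/nbhs_oitv; exists a, b; split=> // y ay yb /=; rewrite ay.
    apply/seteqP; split=> [y [/= /andP[ay yb] Cy]|y ->].
      by apply: contrapT => yx; apply: H; exists y.
    by split=> //=; rewrite ax xb.
  - move=> a b ab; apply: contrapT => H.
    suff : interior C ((a + b) / 2) by rewrite Co.
    apply/nbhs_oitv; exists a, b; split; [lra|lra|] => y ay yb.
    by apply: contrapT => Cy; apply: H; exists y.
move=> [C0 [M CM] Cc Cd Co]; split=> //.
- apply: (@subclosed_compact _ _ `[- M, M]); last first.
  + by move=> x /CM; rewrite ler_norml /= in_itv.
  + exact: segment_compact.
  + by rewrite /closed closureE.
- apply/seteqP; split=> // x [/set_mem Cx [V /nbhs_oitv[a [b [ax xb abV]]] VC]].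
  have [y [Cy yx ay yb]] := Cd x Cx a b ax xb.
  have : (V `&` C) y by split=> //; exact: abV.
  by rewrite VC.
- apply/seteqP; split=> // x /nbhs_oitv[a [b [ax xb abC]]].
  have [y [ay yb nCy]] := Co a b (lt_trans ax xb).
  by apply: nCy; exact: abC.
Qed.

Lemma nwd_codense S : nwd S -> codense S.
Proof.
move=> nS a b /nS[c [d [ac cd db H]]]; exists ((c + d) / 2).
by split; [lra|lra|apply: H; lra].
Qed.

Lemma nwd_sub S S' : S `<=` S' -> nwd S' -> nwd S.
Proof.
move=> SS' nS' a b /nS'[c [d [ac cd db H]]]; exists c, d; split=> // x cx xd /SS'.
exact: H.
Qed.

Lemma nwd_oclosure S : nwd S -> nwd (oclosure S).
Proof.
move=> nS a b /nS[c [d [ac cd db H]]]; exists c, d; split=> // x cx xd Sx.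
by have [y [Sy cy yd]] := Sx c d cx xd; apply: (H y).
Qed.

(** This is the Baire category theorem. *)
Lemma meager_codense (S : (set R)^nat) : (forall i, nwd (S i)) ->
  codense (\bigcup_i S i).
Proof.
move=> nS a b ab.
have /Baire : forall i, open (~` closure (S i)) /\ dense (~` closure (S i)).
  move=> i; split; first by rewrite openC; exact: closed_closure.
  move=> O [x Ox] oO.
  have /nbhs_oitv[c [d [cx xd cdO]]] : nbhs x O by exact: open_nbhs_nbhs.
  have [y [cy yd nSy]] := nwd_codense (nwd_oclosure (nS i)) (lt_trans cx xd).
  by exists y; split; [exact: cdO|rewrite /= closureE].
move=> /(_ [set x | a < x < b]) [||y [/andP[ay yb] Hy]].
- by exists ((a + b) / 2); rewrite /= ; apply/andP; split; lra.
- rewrite openE => x /andP[ax xb]; apply/nbhs_oitv; exists a, b.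
  by split=> // y ay yb /=; rewrite ay.
- exists y; split=> // -[i _ Siy]; apply: (Hy i I).
  exact: subset_closure.
Qed.

(** A codense set that is not nowhere dense is dense in some interval. *)
Lemma nwd_of_codense n (X : set 'rV[R]_n) (D : set R) :
  (~ exists D, definable X D /\ exists J : set R,
     [/\ is_interval J, interior J !=set0 & dense_codense_on J D]) ->
  definable X D -> codense D -> nwd D.
Proof.
move=> H dD coD a b ab; apply: contrapT => nD; apply: H; exists D; split=> //.
exists `]a, b[%classic; split; first exact: interval_is_interval.
  exists ((a + b) / 2); apply/nbhs_oitv; exists a, b; split; [lra|lra|].
  by move=> y ay yb; rewrite /= in_itv /= ay.
have sub x c d : a < x -> x < b -> c < x -> x < d ->
    exists c' d', [/\ Num.max a c < c', c' < d' & d' < Num.min b d].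
  move=> ax xb cx xd.
  have : Num.max a c < Num.min b d.
    by rewrite lt_min !gt_max (lt_trans ax xb) (lt_trans cx xb) (lt_trans ax xd) (lt_trans cx xd).
  move: (Num.max a c) (Num.min b d) => u v uv.
  by exists (u + (v - u) / 3), (u + (v - u) / 3 *+ 2); split; rewrite ?mulr2n; lra.
split=> x; rewrite /= in_itv /= closureE => /andP[ax xb] c d cx xd.
  have [c' [d' [h1 cd' h2]]] := sub x c d ax xb cx xd.
  move: h1 h2; rewrite lt_min gt_max => /andP[ac' cc'] /andP[d'b d'd].
  apply: contrapT => Hy; apply: nD; exists c', d'; split=> // y cy yd Dy.
  apply: Hy; exists y; split; [split=> //|lra|lra].
  by rewrite /= in_itv /=; apply/andP; split; lra.
have [c' [d' [h1 cd' h2]]] := sub x c d ax xb cx xd.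
move: h1 h2; rewrite lt_min gt_max => /andP[ac' cc'] /andP[d'b d'd].
have [y [cy yd nDy]] := coD _ _ cd'.
exists y; split; [split=> //|lra|lra].
by rewrite /= in_itv /=; apply/andP; split; lra.
Qed.

(** * Derived sets *)

Lemma derived_sub S S' : S `<=` S' -> derived S `<=` derived S'.
Proof. by move=> SS' x Sx a b ax xb; have [y [/SS' ? ? ? ?]] := Sx a b ax xb; exists y. Qed.

Lemma derived_oclosure S : derived S `<=` oclosure S.
Proof. by move=> x Sx a b ax xb; have [y [? ? ? ?]] := Sx a b ax xb; exists y. Qed.

Lemma derived_closed S : oclosure (derived S) `<=` derived S.
Proof.
move=> x Hx a b ax xb; have [y [Sy ay yb]] := Hx a b ax xb.
have [yx|/eqP yx] := eqVneq y x; first by rewrite yx in Sy; exact: Sy.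
have [z [Sz zy az zb]] := Sy a b ay yb.
have [zx|/eqP zx] := eqVneq z x; last by exists z.
case: (ltgtP y x) => // xy.
  have [u [Su uy au ux]] := Sy a x ay xy; exists u; split=> //; last by lra.
  by move=> E; rewrite E ltxx in ux.
have [u [Su uy xu ub]] := Sy x b xy yb; exists u; split=> //; last by lra.
by move=> E; rewrite E ltxx in xu.
Qed.

Definition iterD c Y := iter c derived Y.

Lemma iterDS c Y : iterD c.+1 Y = derived (iterD c Y).
Proof. by []. Qed.

Lemma iterD_closed c Y : oclosure Y `<=` Y -> oclosure (iterD c Y) `<=` iterD c Y.
Proof. by case: c => // c _; exact: derived_closed. Qed.

Lemma iterDS_sub c Y : oclosure Y `<=` Y -> iterD c.+1 Y `<=` iterD c Y.
Proof.
move=> cY; apply: subset_trans (iterD_closed (c := c) cY); exact: derived_oclosure.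
Qed.

Lemma iterD_le c c' Y : oclosure Y `<=` Y -> (c <= c')%N -> iterD c' Y `<=` iterD c Y.
Proof.
move=> cY; elim: c' => [|c' IH]; first by rewrite leqn0 => /eqP ->.
rewrite leq_eqVlt => /orP[/eqP->//|cc']; apply: subset_trans (IH cc').
exact: iterDS_sub.
Qed.

Lemma perfect_iterD C Y c : C `<=` derived C -> C `<=` Y -> C `<=` iterD c Y.
Proof.
move=> Cd CY; elim: c => // c IH; rewrite iterDS.
exact: subset_trans Cd (derived_sub IH).
Qed.

(** Accumulation points are defined locally, so a similarity between two sets in
    a window carries over to their derived sets. *)
Lemma derived_window S S' z D z' D' :
  0 < D -> 0 < D' ->
  (forall x : R, -1 < x -> x < 2 -> S ((z + x) / D) -> S' ((z' + x) / D')) ->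
  forall x : R, -1 < x -> x < 2 -> derived S ((z + x) / D) -> derived S' ((z' + x) / D').
Proof.
move=> D0 D'0 H x x1 x2 Sx a b.
rewrite ltr_pdivlMr // ltr_pdivrMr // => ax xb.
pose a1 := Num.max (-1) (a * D' - z'); pose b1 := Num.min 2 (b * D' - z').
have [|| y [Sy yx]] := Sx ((z + a1) / D) ((z + b1) / D).
- rewrite ltr_pM2r ?invr_gt0 // ltrD2l gt_max x1 /=; lra.
- rewrite ltr_pM2r ?invr_gt0 // ltrD2l lt_min x2 /=; lra.
rewrite ltr_pdivrMr // ltr_pdivlMr // => ya yb.
have : a1 < y * D - z < b1 by apply/andP; split; lra.
rewrite gt_max lt_min => /andP[/andP[y1 y2] /andP[y3 y4]].
have yE : y = (z + (y * D - z)) / D by field; rewrite gt_eqF.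
exists ((z' + (y * D - z)) / D'); split.
- by apply: H => //; rewrite -yE.
- move=> /(congr1 ( *%R^~ D')); rewrite !divfK ?gt_eqF // => /addrI E.
  by apply: yx; rewrite yE E.
- by rewrite ltr_pdivlMr //; lra.
- by rewrite ltr_pdivrMr //; lra.
Qed.

End OrderTopology.

(** A point of Cantor-Bendixson rank c has a window whose type determines c, so
    the ranks of isolated points are bounded by the number of types. *)
Lemma fintypes_iterD_stable (R : realType) (r K : nat) (Y : set R) :
  (0 < r)%N -> (1 < K)%N -> oclosure Y `<=` Y -> fintypes r K Y ->
  exists c, iterD c Y = iterD c.+1 Y.
Proof.
move=> r0 K1 cY [T [tp tpP]].
have D0 i : 0 < (r * K ^ i)%N%:R :> R by rewrite ltr0n muln_gt0 r0 expn_gt0 ltnW.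
pose tw i z := (tp i (z - 1), tp i z, tp i (z + 1)).
have twP c : forall i z j z', tw i z = tw j z' -> forall x, -1 < x -> x < 2 ->
    iterD c Y ((z%:~R + x) / (r * K ^ i)%N%:R) ->
    iterD c Y ((z'%:~R + x) / (r * K ^ j)%N%:R).
  elim: c => [|c IH] i z j z' e x x1 x2; last first.
    by apply: derived_window => // y y1 y2; exact: IH.
  rewrite /iterD /=; case: e => e1 e2 e3.
  have shift (u v : int) : (u + v)%:~R + (x - v%:~R) = u%:~R + x :> R.
    by rewrite intrD; ring.
  have [x0|x0] := leP x 0.
    by have := tpP _ _ _ _ e1 (x - (-1)%:~R); rewrite !shift => H; apply: (H _).1; rewrite intrN; apply/andP; split; lra.
  have [x3|x3] := leP x 1; first by apply: (tpP _ _ _ _ e2 x _).1; rewrite ltW.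
  by have := tpP _ _ _ _ e3 (x - 1%:~R); rewrite !shift => H; apply: (H _).1; apply/andP; split; lra.
apply: contrapT => /forallNP nst.
have rk c : exists w : nat * int,
    (exists x, [/\ -1 < x, x < 2 & iterD c Y ((w.2%:~R + x) / (r * K ^ w.1)%N%:R)]) /\
    forall x, -1 < x -> x < 2 -> ~ iterD c.+1 Y ((w.2%:~R + x) / (r * K ^ w.1)%N%:R).
  have [y [Dy nDy]] : exists y, iterD c Y y /\ ~ iterD c.+1 Y y.
    apply: contrapT => /forallNP H; apply: (nst c); apply/seteqP; split.
      by move=> y Dy; apply: contrapT => nDy; apply: (H y).
    exact: iterDS_sub.
  have /existsNP[a /existsNP[b /not_implyP[ay /not_implyP[yb nex]]]] := nDy.
  pose d := Num.min (y - a) (b - y).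
  have d0 : 0 < d by rewrite lt_min !subr_gt0 ay.
  have [i Hi] := kX_inv_small K1 (3 / r%:R) d0.
  have {}Hi : 3 / (r * K ^ i)%N%:R < d.
    by rewrite natrM natrX invfM mulrA; exact: Hi.
  pose z := Num.floor (y * (r * K ^ i)%N%:R).
  have /andP[z1 z2] := floor_itv (y * (r * K ^ i)%N%:R); rewrite -/z intrD in z1 z2.
  have win x : -1 < x -> x < 2 -> a < (z%:~R + x) / (r * K ^ i)%N%:R < b.
    move=> x1 x2; rewrite ltr_pdivlMr // ltr_pdivrMr //.
    move: Hi; rewrite lt_min !ltr_pdivrMr // => /andP[h1 h2].
    by rewrite !mulrBl in h1 h2; apply/andP; split; lra.
  exists (i, z); split.
    exists (y * (r * K ^ i)%N%:R - z%:~R); split; [lra|lra|].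
    by rewrite /= addrC subrK mulfK // gt_eqF.
  move=> x x1 x2 Dx; have /andP[wa wb] := win x x1 x2.
  have [u [Du ux au ub]] := Dx a b wa wb.
  have uy : u = y.
    by apply: contrapT => uy; apply: nex; exists u.
  apply: nex; exists ((z%:~R + x) / (r * K ^ i)%N%:R); split=> //.
    exact: iterDS_sub Dx.
  by move=> E; apply: ux; rewrite E uy.
have [w wP] := choice rk.
have inj c c' : (c < c')%N -> tw (w c).1 (w c).2 <> tw (w c').1 (w c').2.
  move=> cc' E; have [[x [x1 x2 Dx]] _] := wP c'; have [_ nD] := wP c.
  apply: (nD x) => //; apply: (twP _ _ _ _ _ (esym E)) => //.
  exact: iterD_le cc' _ Dx.
pose N := #|{: T * T * T}|.
have : injective (fun c : 'I_N.+1 => tw (w c).1 (w c).2).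
  move=> c c' E; apply/val_inj; case: (ltngtP c c') => // /inj; first by case.
  by move=> H; case: H.
by move=> /leq_card; rewrite card_ord ltnn.
Qed.

(** * Box-counting dimension *)

Section Covers.
Variable R : realType.
Implicit Types (Y : set R) (e : R) (Z : {fset int}).

Definition covers Y e Z :=
  Y `<=` \bigcup_(z in [set` Z]) `[z%:~R * e, (z + 1)%:~R * e]%classic.

Lemma coversP Y e Z : covers Y e Z <->
  forall x, Y x -> exists z, [/\ z \in Z, z%:~R * e <= x & x <= (z + 1)%:~R * e].
Proof.
split=> H x Yx.
  by have [z /= zZ] := H x Yx; rewrite /= in_itv /= => /andP[? ?]; exists z.
by have [z [zZ h1 h2]] := H x Yx; exists z => //=; rewrite in_itv /= h1.
Qed.

Lemma cover_number_le Y e Z : covers Y e Z -> cover_number Y e <= #|` Z|%:R.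
Proof.
move=> cZ; apply: ge_inf; last by exists Z.
by exists 0 => _ [Z' _ <-]; rewrite ler0n.
Qed.

Lemma cover_number_seq Y e (s : seq int) :
  (forall x, Y x -> exists z, [/\ z \in s, z%:~R * e <= x & x <= (z + 1)%:~R * e]) ->
  cover_number Y e <= (size s)%:R.
Proof.
move=> H; apply: (@le_trans _ _ #|` [fset z in s]%fset|%:R).
  apply: cover_number_le; apply/coversP => x /H [z [zs h1 h2]].
  by exists z; split=> //; rewrite in_fset.
by rewrite ler_nat card_fseq size_undup.
Qed.

Lemma cell_of e x : 0 < e -> exists z : int, z%:~R * e <= x /\ x <= (z + 1)%:~R * e.
Proof.
move=> e0; exists (Num.floor (x / e)); have /andP[h1 h2] := floor_itv (x / e).
by rewrite -ler_pdivlMr // h1 -ler_pdivrMr // ltW.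
Qed.

Definition bnd Y := exists M, forall x, Y x -> `|x| <= M.

Lemma bnd_unit Y : Y `<=` `[0, 1] -> bnd Y.
Proof.
move=> Y01; exists 1 => x /Y01; rewrite /= in_itv /= ler_norml => /andP[x0 ->].
by rewrite (le_trans _ x0) // lerN10.
Qed.

Lemma bndP Y : bnd Y <-> bounded_set Y.
Proof.
split=> [[M YM]|[M [Mr HM]]].
  exists M; split; first exact: num_real.
  by move=> x Mx y /YM yM; apply: le_trans yM (ltW Mx).
by exists (`|M| + 1) => x Yx; apply: (HM (`|M| + 1)) => //; have := ler_norm M; lra.
Qed.

Lemma covers_ex Y e : bnd Y -> 0 < e -> exists Z, covers Y e Z.
Proof.
move=> [M YM] e0; pose N := (Num.truncn (`|M| / e)).+1.
exists [fset z in [seq i%:Z - N%:Z | i <- iota 0 (2 * N)]]%fset.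
apply/coversP => x Yx; have [z [h1 h2]] := cell_of x e0; exists z; split=> //.
have := YM x Yx; rewrite ler_norml => /andP[x1 x2].
have HN : `|M| < N%:R * e by rewrite -ltr_pdivrMr //; exact: truncnS_gt.
have MM := ler_norm M.
have hz1 : - N%:Z <= z.
  rewrite leNgt; apply/negP => zN.
  have : (z + 1)%:~R <= (- N%:Z)%:~R :> R by rewrite ler_int; lia.
  by rewrite intrN -pmulrn => h; nra.
have hz2 : z < N%:Z.
  rewrite ltNge; apply/negP => zN.
  have : (N%:Z)%:~R <= z%:~R :> R by rewrite ler_int.
  by rewrite -pmulrn => h; nra.
rewrite in_fset; apply/mapP; exists (absz (z + N%:Z)); last by lia.
by rewrite mem_iota; lia.
Qed.

Lemma cover_number_ex Y e : bnd Y -> 0 < e ->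
  exists2 Z, covers Y e Z & cover_number Y e = #|` Z|%:R.
Proof.
move=> bY e0.
pose P N := `[< exists2 Z, covers Y e Z & #|` Z| = N >].
have exP : exists N, P N.
  by have [Z cZ] := covers_ex bY e0; exists #|` Z|; apply/asboolP; exists Z.
have [N /asboolP[Z cZ ZN] Nmin] := ex_minnP exP.
exists Z => //; apply/eqP; rewrite eq_le cover_number_le //=.
apply: lb_le_inf; first by exists #|` Z|%:R, Z.
move=> _ [Z' cZ' <-]; rewrite ler_nat ZN; apply: Nmin.
by apply/asboolP; exists Z'.
Qed.

Lemma cover_number_ge0 Y e : 0 <= cover_number Y e.
Proof.
rewrite /cover_number; set S := [set _ | _ in _].
have [S0|/set0P/negP/negPn/eqP ->] := pselect (S !=set0); last by rewrite inf0.
by apply: lb_le_inf => // _ [Z' _ <-]; rewrite ler0n.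
Qed.

Lemma cover_number_ge1 Y e : bnd Y -> 0 < e -> Y !=set0 -> 1 <= cover_number Y e.
Proof.
move=> bY e0 [x Yx]; have [Z /coversP cZ ->] := cover_number_ex bY e0.
have [z [zZ _ _]] := cZ x Yx.
by rewrite (ler_nat _ 1) cardfs_gt0; apply/fset0Pn; exists z.
Qed.

(** A finite union of closed intervals is closed. *)
Lemma covers_oclosure Y e Z : 0 < e -> covers Y e Z -> covers (oclosure Y) e Z.
Proof.
move=> e0 /coversP cZ; apply/coversP => x Yx; apply: contrapT => /forallNP nx.
pose far z := (x < z%:~R * e) || ((z + 1)%:~R * e < x).
have Zfar z : z \in Z -> far z.
  move=> zZ; rewrite /far !ltNge -negb_and; apply/negP => /andP[h1 h2].
  exact: (nx z).
have [a [b [ax xb H]]] : exists a b, [/\ a < x, x < b & forall y z, z \in Z ->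
    a < y -> y < b -> ~~ (z%:~R * e <= y <= (z + 1)%:~R * e)].
  have {}Zfar : forall z, z \in enum_fset Z -> far z by [].
  suff [a [b [ax xb H]]] : exists a b, [/\ a < x, x < b & forall y z, z \in enum_fset Z ->
      a < y -> y < b -> ~~ (z%:~R * e <= y <= (z + 1)%:~R * e)] by exists a, b.
  elim: (enum_fset Z) Zfar => [|z s IH] Hs.
    by exists (x - 1), (x + 1); split=> //; lra.
  have [|a [b [ax xb H]]] := IH.
    by move=> z' z's; apply: Hs; rewrite in_cons z's orbT.
  have /orP[h|h] := Hs z (mem_head _ _).
    exists a, (Num.min b (z%:~R * e)); split=> //; first by rewrite lt_min xb.
    move=> y z'; rewrite in_cons lt_min => /orP[/eqP->|z's] ay /andP[yb yz].
      by rewrite negb_and -ltNge yz.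
    exact: H.
  exists (Num.max a ((z + 1)%:~R * e)), b; split=> //; first by rewrite gt_max ax.
  move=> y z'; rewrite in_cons gt_max => /orP[/eqP->|z's] /andP[ay yz] yb.
    by rewrite negb_and -!ltNge yz orbT.
  exact: H.
have [y [Yy ay yb]] := Yx a b ax xb; have [z [zZ h1 h2]] := cZ y Yy.
by have := H y z zZ ay yb; rewrite h1 h2.
Qed.

Lemma bnd_oclosure Y : bnd Y -> bnd (oclosure Y).
Proof.
move=> [M YM]; exists M => x Yx; rewrite leNgt; apply/negP => Mx.
have [x0|x0] := leP 0 x.
  rewrite ger0_norm // in Mx.
  have [|y [/YM Yy My _]] := Yx M (x + 1) Mx; first by rewrite ltrDl.
  by have := ler_norm y; lra.
rewrite ltr0_norm // in Mx.
have [||y [/YM Yy _ My]] := Yx (x - 1) (- M); [lra|lra|].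
by have := ler_norm (- y); rewrite normrN; lra.
Qed.

Lemma bnd_sub Y Y' : Y `<=` Y' -> bnd Y' -> bnd Y.
Proof. by move=> YY' [M H]; exists M => x /YY' /H. Qed.

Lemma cover_number_sub Y Y' e : bnd Y' -> 0 < e -> Y `<=` oclosure Y' ->
  cover_number Y e <= cover_number Y' e.
Proof.
move=> bY' e0 YY'; have [Z cZ ->] := cover_number_ex bY' e0.
apply: cover_number_le; exact: subset_trans YY' (covers_oclosure e0 cZ).
Qed.

(** A grid interval of length e meets at most two grid intervals that are at
    least as long. *)
Lemma cover_number_scale Y e e' : bnd Y -> 0 < e -> e <= e' ->
  cover_number Y e' <= 2 * cover_number Y e.
Proof.
move=> bY e0 ee'; have e'0 : 0 < e' by exact: lt_le_trans ee'.
have [Z /coversP cZ ->] := cover_number_ex bY e0.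
pose fl (z : int) := Num.floor (z%:~R * e / e').
have H : cover_number Y e' <= (size ([seq fl z | z <- enum_fset Z] ++
    [seq fl z + 1 | z <- enum_fset Z]))%:R.
  apply: cover_number_seq => x /cZ [z [zZ h1 h2]].
  have /andP[f1 f2] := floor_itv (z%:~R * e / e'); rewrite -/(fl z) in f1 f2.
  rewrite ler_pdivlMr // in f1; rewrite ltr_pdivrMr // in f2.
  rewrite !intrD in f1 f2 h2 *.
  have [xf|xf] := leP x ((fl z + 1)%:~R * e').
    exists (fl z); split; [|lra|by []].
    by rewrite mem_cat map_f.
  exists (fl z + 1); split; [by rewrite mem_cat (map_f (fun z => fl z + 1)) ?orbT|exact: ltW|].
  rewrite !intrD in xf *; lra.
by rewrite (le_trans H) // size_cat !size_map -natrM ler_nat mul2n addnn.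
Qed.

Lemma cover_number_unit Y e : Y `<=` `[0, 1] -> 0 < e -> cover_number Y e <= e^-1 + 1.
Proof.
move=> Y01 e0; pose N := (Num.truncn e^-1).+1.
have H : cover_number Y e <= (size [seq Posz i | i <- iota 0 N])%:R.
  apply: cover_number_seq => x Yx; have := Y01 x Yx.
  rewrite [X in X -> _]/= in_itv => /andP[x0 x1].
  pose i := Num.truncn (x / e).
  have /truncn_itv/andP[t1 t2] : 0 <= x / e by rewrite divr_ge0 // ltW.
  exists (Posz i); split.
  - apply/mapP; exists i => //; rewrite mem_iota /= add0n ltnS; apply: le_truncn.
    by rewrite ler_pdivrMr // mulVf // gt_eqF.
  - by rewrite -ler_pdivlMr.
  - by rewrite -ler_pdivrMr // -natr1 intrD -!pmulrn in t2 *; exact: ltW.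
apply: le_trans H _; rewrite size_map size_iota /N -natr1 lerD2r.
by have /truncn_itv/andP[] : 0 <= e^-1 by rewrite invr_ge0 ltW.
Qed.

Lemma cover_number_interval Y e a b : bnd Y -> 0 < e -> a < b ->
  (forall x, a < x -> x < b -> oclosure Y x) -> (b - a) / e - 3 <= cover_number Y e.
Proof.
move=> bY e0 ab H; have [Z cZ ->] := cover_number_ex bY e0.
have /coversP cZ' := covers_oclosure e0 cZ.
pose z0 := Num.floor (a / e) + 1.
have /andP[] := floor_itv (a / e).
rewrite -/z0 ler_pdivlMr // ltr_pdivrMr // => f1 f2.
pose N := (Num.truncn ((b - a) / e) - 2)%N.
have /truncn_itv/andP[t1 t2] : 0 <= (b - a) / e.
  by apply: divr_ge0; rewrite ?subr_ge0; exact: ltW.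
have N1 : (b - a) / e - 3 <= N%:R.
  apply: le_trans (_ : (Num.truncn ((b - a) / e))%:R - 2%:R <= _).
    by rewrite -natr1 in t2; lra.
  by rewrite lerBlDr -natrD ler_nat /N; lia.
apply: le_trans N1 _; rewrite ler_nat.
have sub : {subset [seq z0 + Posz i | i <- iota 0 N] <= enum_fset Z}.
  move=> _ /mapP[i + ->]; rewrite mem_iota /= add0n => iN.
  have iN2 : (i + 2)%:R * e < b - a.
    rewrite -ltr_pdivlMr //; apply: lt_le_trans t1.
    by rewrite ltr_nat; move: iN; rewrite /N; lia.
  rewrite natrD mulrDl in iN2.
  have zi : (z0 + Posz i)%:~R = z0%:~R + i%:R :> R by rewrite intrD -pmulrn.
  have f1' : z0%:~R * e <= a + e by rewrite /z0 intrD mulrDl mul1r; lra.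
  clearbody z0.
  have ie : 0 <= i%:R * e by rewrite mulr_ge0 ?ler0n // ltW.
  have [|z [zZ h1 h2]] := cZ' ((z0%:~R + i%:R + 1 / 2) * e).
    by apply: H; rewrite !mulrDl; lra.
  rewrite ler_pM2r // in h1; rewrite ler_pM2r // intrD in h2.
  suff -> : z0 + Posz i = z by [].
  apply/eqP; rewrite eq_le; apply/andP; split; rewrite -ltzD1 -(ltr_int R) !intrD -?pmulrn; lra.
have := uniq_leq_size _ sub; rewrite size_map size_iota; apply.
by rewrite map_inj_uniq ?iota_uniq // => i j /addrI [].
Qed.

Lemma cvg_at_right0 (f : R -> R) (l : R) :
  (forall c, 0 < c -> exists2 e0, 0 < e0 & forall e, 0 < e -> e < e0 -> `|l - f e| <= c) <->
  f e @[e --> 0^'+] --> l.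
Proof.
split=> [H|].
  apply/cvgrPdist_le => c c0; have [e0 e00 He] := H c c0.
  near=> e; apply: He; [near: e; exact: nbhs_right_gt|near: e; exact: nbhs_right_lt].
move=> /cvgrPdist_le H c c0; have := H c c0.
move=> /nbhs_ballP[e0 /= e00 He]; exists e0 => // e ep ee0.
by apply: He => //; rewrite /ball /= sub0r normrN gtr0_norm.
Unshelve. all: by end_near. Qed.

End Covers.

(** * Hausdorff dimension *)

Section Hausdorff.
Variable R : realType.
Implicit Types (Y : set R) (e c s t : R) (U : nat -> set R) (d : nat -> R).

Definition cost s U d n : R := if `[< U n !=set0 >] then d n `^ s else 0.

(** Covers in the sense of Hausdorff measures, with real numbers only: d bounds
    the diameters. Empty sets are free, even for s = 0. *)
Definition small_cover s e c Y := exists U d,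
  [/\ Y `<=` \bigcup_i U i, forall n, 0 <= d n <= e,
      forall n x y, U n x -> U n y -> `|x - y| <= d n &
      forall N, \sum_(0 <= n < N) cost s U d n <= c].

Lemma cost_ge0 s U d n : 0 <= cost s U d n.
Proof. by rewrite /cost; case: ifP => _ //; exact: powR_ge0. Qed.

Lemma diam_le (V : set R) (r : R) : (forall x y, V x -> V y -> `|x - y| <= r) ->
  (diam V <= r%:E)%E.
Proof.
move=> H; apply: ge_ereal_sup => _ [x Vx [y Vy <-]]; rewrite lee_fin; exact: H.
Qed.

Lemma diam_ge (V : set R) x y : V x -> V y -> (`|x - y|%:E <= diam V)%E.
Proof. by move=> Vx Vy; apply: ereal_sup_ubound; exists x => //; exists y. Qed.

Lemma hcost_series s U :
  (\esum_(i in [set i | U i !=set0]) poweR (diam (U i)) s =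
   \sum_(0 <= i <oo) (if `[< U i !=set0 >] then poweR (diam (U i)) s else 0))%E.
Proof.
rewrite nneseries_esumT; last first.
  by move=> n; case: ifP => // _; exact: poweR_ge0.
rewrite esum_mkcond; apply: eq_esum => i _.
suff -> : (i \in [set i | U i !=set0]) = `[< U i !=set0 >] by [].
by apply/idP/asboolP; rewrite inE.
Qed.

Lemma content_le s e c Y : small_cover s e c Y -> 0 <= s ->
  (hausdorff_content s Y e <= c%:E)%E.
Proof.
move=> [U [d [YU de Ud Uc]]] s0.
have dU n : (diam (U n) <= (d n)%:E)%E by apply: diam_le; exact: Ud.
apply: (@le_trans _ _ (\esum_(i in [set i | U i !=set0]) poweR (diam (U i)) s)%E).
  apply: ereal_inf_lbound; exists U => //; split=> // n.
  by apply: le_trans (dU n) _; rewrite lee_fin; case/andP: (de n).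
rewrite hcost_series; apply: (@le_trans _ _ (\sum_(0 <= i <oo) (cost s U d i)%:E)%E).
  apply: lee_nneseries => n _ *; first by case: ifP => // _; exact: poweR_ge0.
  rewrite /cost; case: ifP => // /asboolP[x Ux].
  have dge : (0 <= diam (U n))%E by apply: le_trans (diam_ge Ux Ux); rewrite subrr normr0.
  rewrite -poweR_EFin; apply: gt0_ler_poweR => //.
    by rewrite in_itv /= dge leey.
  by rewrite in_itv /= leey lee_fin andbT; case/andP: (de n).
apply: lime_le; first by apply: is_cvg_nneseries => n _ _; rewrite lee_fin cost_ge0.
by near=> N; rewrite sumEFin lee_fin.
Unshelve. all: by end_near. Qed.

Lemma content_lt s e c Y : 0 < e -> (hausdorff_content s Y e < c%:E)%E ->
  small_cover s e c Y.
Proof.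
move=> e0 /ereal_inf_lt[_ [U [YU Ue] <-]]; rewrite hcost_series => lt.
pose d n := if `[< U n !=set0 >] then fine (diam (U n)) else 0.
have dE n : U n !=set0 -> (d n)%:E = diam (U n) /\ 0 <= d n <= e.
  move=> Un; have [x Ux] := Un.
  have h0 : (0 <= diam (U n))%E by apply: le_trans (diam_ge Ux Ux); rewrite subrr normr0.
  have E : (d n)%:E = diam (U n).
    rewrite /d ifT; last exact/asboolP.
    rewrite fineK // fin_numElt (lt_le_trans _ h0) ?ltNyr // (le_lt_trans (Ue n)) //.
    exact: ltry.
  by split=> //; rewrite -!lee_fin E h0 Ue.
exists U, d; split=> //.
- move=> n; have [Un|Un] := pselect (U n !=set0); first by case: (dE n Un).
  by rewrite /d ifF ?lexx ?ltW //; apply/asboolPn.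
- move=> n x y Ux Uy; rewrite -lee_fin; have [|-> _] := dE n; first by exists x.
  exact: diam_ge.
move=> N; rewrite -lee_fin; apply: le_trans (ltW lt); rewrite -sumEFin.
apply: le_trans (nneseries_lim_ge N _) => /=; first last.
  by move=> *; case: ifP => // _; exact: poweR_ge0.
apply: lee_sum => n _; rewrite /cost; case: ifP => // /asboolP Un.
by rewrite -(dE n Un).1 poweR_EFin.
Qed.

Lemma small_cover_exp s t e c Y : 0 < e -> 0 <= s -> s < t -> small_cover s e c Y ->
  small_cover t e (e `^ (t - s) * c) Y.
Proof.
move=> e0 s0 st [U [d [YU de Ud Uc]]]; exists U, d; split=> // N.
apply: le_trans (_ : e `^ (t - s) * \sum_(0 <= n < N) cost s U d n <= _); last first.
  by apply: ler_wpM2l; [exact: powR_ge0|exact: Uc].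
rewrite big_distrr /=; apply: ler_sum => n _; rewrite /cost; case: ifP => _; last by rewrite mulr0.
have /andP[d0 dle] := de n; move: d0; rewrite le_eqVlt => /orP[/eqP<-|d0].
  by rewrite powR0 ?mulr_ge0 ?powR_ge0 // gt_eqF // (le_lt_trans s0).
rewrite -[in leLHS](subrK s t) [leLHS]powRD; last by rewrite (gt_eqF d0) implybT.
apply: ler_wpM2r; first exact: powR_ge0.
apply: ge0_ler_powR => //; rewrite ?nnegrE ?subr_ge0 ?ltW //.
Qed.

Lemma small_cover_le s e e' c Y : e <= e' -> small_cover s e c Y -> small_cover s e' c Y.
Proof.
move=> ee' [U [d [YU de Ud Uc]]]; exists U, d; split=> // n.
by have /andP[-> /= h] := de n; exact: le_trans ee'.
Qed.

Lemma small_cover_sub s e c Y Y' : Y `<=` Y' -> small_cover s e c Y' -> small_cover s e c Y.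
Proof.
by move=> YY' [U [d [YU de Ud Uc]]]; exists U, d; split=> //; exact: subset_trans YU.
Qed.

Lemma content_ge0 s Y e : (0 <= hausdorff_content s Y e)%E.
Proof.
by apply: le_ereal_inf_tmp => _ [U _ <-]; apply: esum_ge0 => i _; exact: poweR_ge0.
Qed.

Lemma content_mono s Y e e' : e <= e' ->
  (hausdorff_content s Y e' <= hausdorff_content s Y e)%E.
Proof.
move=> ee'; apply: ereal_inf_le_tmp => _ [U [YU Ue] <-]; exists U => //; split=> // i.
by apply: le_trans (Ue i) _; rewrite lee_fin.
Qed.

(** The content is monotone in e, so the limit is a supremum. *)
Lemma hausdorff_measureE s Y :
  hausdorff_measure s Y = ereal_sup [set hausdorff_content s Y e | e in `]0, 1[].
Proof.
apply: cvg_lim => //; apply: (@nonincreasing_at_right_cvge _ _ _ (BLeft 1)).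
  by rewrite bnd_simp.
by move=> x y _ _ xy; exact: content_mono.
Qed.

Lemma hausdorff_measure_eq0 s Y : 0 <= s ->
  (forall e c, 0 < e -> 0 < c -> small_cover s e c Y) -> hausdorff_measure s Y = 0%E.
Proof.
move=> s0 H; rewrite hausdorff_measureE; apply/eqP; rewrite eq_le; apply/andP; split.
  apply: ge_ereal_sup => x [e /=]; rewrite in_itv /= => /andP[e0 _] <-.
  apply/lee_addgt0Pr => c c0; rewrite add0e; exact: content_le (H e c e0 c0) s0.
apply: le_trans (content_ge0 s Y 2^-1) _; apply: ereal_sup_ubound.
by exists 2^-1 => //; rewrite /= in_itv /=; apply/andP; split; lra.
Qed.

Lemma small_cover_of_measure s Y h e : 0 < e < 1 -> (hausdorff_measure s Y < h%:E)%E ->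
  small_cover s e h Y.
Proof.
move=> /andP[e0 e1]; rewrite hausdorff_measureE => lt; apply: content_lt => //.
apply: le_lt_trans lt; apply: ereal_sup_ubound; exists e => //=.
by rewrite in_itv /= e0.
Qed.

(** A finite measure in dimension s leaves nothing in dimension t > s. *)
Lemma hausdorff_measure_lt s t Y : 0 <= s -> s < t ->
  (hausdorff_measure s Y < +oo)%E -> hausdorff_measure t Y = 0%E.
Proof.
move=> s0 st fin; have [h hlt] : exists h : R, (hausdorff_measure s Y < h%:E)%E.
  case: (hausdorff_measure s Y) fin => [r| |] // lt.
    by exists (r + 1); rewrite lte_fin ltrDl.
  by exists 0; exact: ltNyr.
apply: hausdorff_measure_eq0 => [|e c e0 c0]; first by rewrite ltW // (le_lt_trans s0).
have ts : 0 < t - s by rewrite subr_gt0.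
pose h1 := `|h| + 1; have h10 : 0 < h1 by rewrite ltr_wpDl.
pose e1 := Num.min (Num.min e 2^-1) ((c / h1) `^ (t - s)^-1).
have e10 : 0 < e1 by rewrite !lt_min e0 powR_gt0 ?divr_gt0 // invr_gt0 ltr0n.
have e11 : 0 < e1 < 1.
  rewrite e10 /=; apply: le_lt_trans (_ : 2^-1 < 1); first by rewrite !ge_min lexx orbT.
  by rewrite invf_lt1 // ltr1n.
have := small_cover_exp e10 s0 st (small_cover_of_measure e11 hlt).
move=> [U [d [YU de Ud Uc]]]; exists U, d; split=> //.
  move=> n; have /andP[-> /= h2] := de n; apply: le_trans h2 _.
  by rewrite !ge_min lexx.
move=> N; apply: le_trans (Uc N) _.
apply: le_trans (_ : e1 `^ (t - s) * h1 <= _).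
  by rewrite ler_wpM2l ?powR_ge0 // /h1; have := ler_norm h; lra.
rewrite -ler_pdivlMr //.
have E : c / h1 = ((c / h1) `^ (t - s)^-1) `^ (t - s).
  by rewrite -powRrM mulVf ?gt_eqF // powRr1 // divr_ge0 // ltW.
rewrite [leRHS]E; apply: ge0_ler_powR; rewrite ?nnegrE ?powR_ge0 // ?(ltW e10) ?(ltW ts) //.
by rewrite ge_min lexx orbT.
Qed.

Lemma hausdorff_dim_exists s1 Y : 0 <= s1 -> hausdorff_measure s1 Y = 0%E ->
  exists2 d, hausdorff_dim Y d & d <= s1.
Proof.
move=> s10 H1; pose S := [set s | 0 <= s /\ hausdorff_measure s Y = 0%E].
have S1 : S s1 by [].
have hS : has_inf S by split; [exists s1|exists 0 => s []].
exists (inf S); last by apply: ge_inf => //; case: hS.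
split; first by apply: lb_le_inf; [exists s1|move=> s []].
move=> s s0; split=> [lt|gt].
  case E : (hausdorff_measure s Y) => [r| |] //.
    have [m1 m2] := midf_lt lt.
    have : S ((s + inf S) / 2).
      split; first by rewrite ltW // (le_lt_trans s0).
      by apply: hausdorff_measure_lt m1 _ => //; rewrite E ltry.
    by move=> /(ge_inf hS.2) h; move: (le_lt_trans h m2); rewrite ltxx.
  have [m1 m2] := midf_lt lt.
  have : S ((s + inf S) / 2).
    split; first by rewrite ltW // (le_lt_trans s0).
    by apply: hausdorff_measure_lt m1 _ => //; rewrite E.
  by move=> /(ge_inf hS.2) h; move: (le_lt_trans h m2); rewrite ltxx.
have [u [u0 Hu] us] := inf_lt hS.1 gt.
by apply: hausdorff_measure_lt us _ => //; rewrite Hu ltry.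
Qed.

Lemma hausdorff_dim_countable Y : countable Y -> hausdorff_dim Y 0.
Proof.
move=> cY; split=> // s s0; split=> [|sp]; first by rewrite ltNge s0.
apply: hausdorff_measure_eq0 => // e c e0 c0.
have [->|/set0P Y0] := eqVneq Y set0.
  exists (fun=> set0), (fun=> 0); split=> //.
  - by move=> n; rewrite lexx ltW.
  - by move=> N; rewrite big1 ?ltW // => n _; rewrite /cost ifF //; apply/asboolPn => -[].
have [/eqP|[f]] := pfcard_geP cY; first by move/set0P: Y0 => /negPf ->.
exists (fun n => [set f n]), (fun=> 0); split.
- by move=> x /(@surj _ _ _ _ f) [n _ fn]; exists n.
- by move=> n; rewrite lexx ltW.
- by move=> n x y -> ->; rewrite subrr normr0.
move=> N; rewrite big1 ?ltW // => n _; rewrite /cost.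
by case: ifP => // _; rewrite powR0 // gt_eqF.
Qed.

(** Lebesgue measure bounds the cost of a cover from below. *)
Lemma small_cover_itv e c a b Y : a < b -> (forall x, a < x -> x < b -> Y x) ->
  small_cover 1 e c Y -> b - a <= c.
Proof.
move=> ab abY [U [d [YU de Ud Uc]]].
pose l n := inf (U n).
have lP n x : U n x -> l n <= x <= l n + d n.
  move=> Ux; have lb : has_inf (U n).
    split; first by exists x.
    exists (x - d n) => y Uy; have := Ud n x y Ux Uy; rewrite ler_norml; lra.
  apply/andP; split; first by apply: ge_inf => //; case: lb.
  rewrite -lerBlDr; apply: lb_le_inf; first by exists x.
  by move=> y /(Ud n x y Ux); rewrite ler_norml; lra.
pose I n : set R := if `[< U n !=set0 >] then `[l n, l n + d n]%classic else set0.
have mI n : measurable (I n) by rewrite /I; case: ifP => _; [exact: measurable_itv|exact: measurable0].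
have cI : `]a, b[%classic `<=` \bigcup_n I n.
  move=> x; rewrite /= in_itv /= => /andP[ax xb].
  have [n _ Ux] := YU x (abY x ax xb); exists n => //.
  by rewrite /I ifT ?/mkset /= ?in_itv /= ?lP //; apply/asboolP; exists x.
have : (lebesgue_measure (`]a, b[%classic : set R) <=
    \sum_(0 <= n <oo) lebesgue_measure (I n))%E.
  by apply: measure_sigma_subadditive => //; exact: measurable_itv.
rewrite lebesgue_measure_itv /= lte_fin ab => H.
rewrite -lee_fin EFinB; apply: le_trans H _.
have E n : lebesgue_measure (I n) = (cost 1 U d n)%:E.
  rewrite /I /cost; case: ifP => _; last exact: measure0.
  have /andP[d0 _] := de n; rewrite lebesgue_measure_itv /= lte_fin ltrDl powRr1 //.
  case: ltP => h; first by rewrite -EFinB addrC addKr.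
  by congr EFin; apply/eqP; rewrite eq_le h d0.
rewrite (eq_eseriesr (fun n _ => E n)).
apply: lime_le; first by apply: is_cvg_nneseries => n _ _; rewrite lee_fin cost_ge0.
by near=> N; rewrite sumEFin lee_fin.
Unshelve. all: by end_near. Qed.

Lemma hausdorff_dim_ge1 Y (d : R) a b : a < b -> (forall x, a < x -> x < b -> Y x) ->
  hausdorff_dim Y d -> 1 <= d.
Proof.
move=> ab abY [d0 dP]; rewrite leNgt; apply/negP => d1.
have [m1 m2] := midf_lt d1; set t := (d + 1) / 2 in m1 m2.
have t0 : 0 <= t by lra.
have [_ /(_ m1) Ht] := dP t t0.
have H1 : hausdorff_measure 1 Y = 0%E.
  by apply: hausdorff_measure_lt m2 _ => //; rewrite Ht ltry.
have /small_cover_itv : small_cover 1 2^-1 ((b - a) / 2) Y.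
  apply: small_cover_of_measure; first by apply/andP; split; lra.
  by rewrite H1 lte_fin divr_gt0 // subr_gt0.
by move=> /(_ _ _ ab abY); lra.
Qed.

Lemma content_finite s e Y (I : finType) (V : I -> set R) (r : R) : 0 <= s -> 0 < r <= e ->
  Y `<=` \bigcup_i V i -> (forall i x y, V i x -> V i y -> `|x - y| <= r) ->
  small_cover s e (#|I|%:R * r `^ s) Y.
Proof.
move=> s0 /andP[r0 re] YV Vr.
pose U n : set R := if insub n is Some j then V (enum_val (j : 'I_#|I|)) else set0.
exists U, (fun=> r); split.
- move=> x /YV [i _ Vx]; exists (enum_rank i) => //.
  by rewrite /U valK enum_rankK.
- by move=> n; rewrite re ltW.
- by move=> n x y; rewrite /U; case: insubP => [j _ _|_] //; exact: Vr.
move=> N; apply: le_trans (_ : \sum_(0 <= n < N) (if (n < #|I|)%N then r `^ s else 0) <= _).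
  apply: ler_sum => n _; rewrite /cost /U.
  case: asboolP => [[x]|_]; last by case: ifP => // _; exact: powR_ge0.
  by case: insubP => [j -> _|_].
apply: le_trans (_ : (minn N #|I|)%:R * r `^ s <= _); last first.
  by rewrite ler_wpM2r ?powR_ge0 // ler_nat geq_minr.
elim: N => [|N IH]; first by rewrite big_geq // min0n mul0r.
rewrite big_nat_recr //=; case: ltnP => h; last first.
  rewrite addr0; apply: le_trans IH _; rewrite ler_wpM2r ?powR_ge0 //.
  by rewrite ler_nat leq_min geq_minr andbT (leq_trans (geq_minl _ _)).
rewrite (minn_idPl h); rewrite (minn_idPl (ltnW h)) in IH *.
by rewrite -natr1 mulrDl mul1r lerD2r.
Qed.

Lemma ler_sum_inj (T : eqType) (f : nat -> T) (s : seq T) (F : T -> R) N :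
  injective f -> (forall p, 0 <= F p) -> (forall n, (n < N)%N -> f n \in s) ->
  \sum_(0 <= n < N) F (f n) <= \sum_(p <- s) F p.
Proof.
move=> fi F0; elim: N s => [|N IH] s fs; first by rewrite big_geq // sumr_ge0.
rewrite big_nat_recr //= (big_rem (f N)) /= ?fs // addrC lerD2l.
apply: IH => n nN; have := fs n (ltnW nN).
have : f n != f N by rewrite (inj_eq fi) ltn_eqF.
elim: s {fs} => //= x s IH nN' ; rewrite in_cons.
case: (x =P f N) => [->|xN]; first by rewrite (negPf nN').
by rewrite in_cons => /orP[->//|/(IH nN') ->]; rewrite orbT.
Qed.

Lemma small_cover_bigcup s (Y : nat -> set R) e c : 0 < c ->
  (forall i c', 0 < c' -> small_cover s e c' (Y i)) ->
  small_cover s e c (\bigcup_i Y i).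
Proof.
move=> c0 H.
have [U HU] := choice (fun i => H i (c / 2 ^+ i.+1) (divr_gt0 c0 (exprn_gt0 i.+1 (ltr0n R 2)))).
have [d dP] := choice HU.
have /card_esym/ppcard_eqP[f] := card_nat2.
pose V n := U (f n).1 (f n).2; pose dd n := d (f n).1 (f n).2.
have fi : injective f by move=> x y; apply: inj; rewrite inE.
exists V, dd; split.
- move=> x [i _ Yx]; have [YU _ _ _] := dP i; have [j _ Ux] := YU x Yx.
  by exists (f^-1%FUN (i, j)) => //; rewrite /V invK // inE.
- by move=> n; rewrite /dd; case: (dP (f n).1).
- by move=> n x y; rewrite /V /dd; case: (dP (f n).1) => _ _ h _; exact: h.
move=> N; pose M := (\max_(n < N) maxn (f n).1 (f n).2).+1.
pose F (p : nat * nat) := cost s (U p.1) (d p.1) p.2.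
apply: le_trans (_ : \sum_(p <- [seq (i, j) | i <- iota 0 M, j <- iota 0 M]) F p <= _).
  apply: le_trans (_ : \sum_(0 <= n < N) F (f n) <= _).
    by apply: ler_sum => n _; rewrite /F /cost /V /dd.
  apply: ler_sum_inj => // [p|n nN]; first exact: cost_ge0.
  have := @leq_bigmax _ (fun n : 'I_N => maxn (f n).1 (f n).2) (Ordinal nN).
  rewrite geq_max => /andP[h1 h2].
  apply/allpairsPdep; exists (f n).1, (f n).2; rewrite !mem_iota /= !add0n !ltnS h1 h2.
  by split=> //; case: (f n).
rewrite big_allpairs_dep.
apply: le_trans (_ : \sum_(0 <= i < M) c / 2 ^+ i.+1 <= _).
  rewrite -{1}[M]subn0; apply: ler_sum => i _; rewrite /F /=.
  by have [_ _ _ /(_ M)] := dP i; rewrite /index_iota subn0.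
apply: le_trans (_ : c * (1 - (2 ^+ M)^-1) <= _); last first.
  by rewrite -[leRHS]mulr1 ler_pM2l // gerBl invr_ge0 exprn_ge0.
elim: M => [|M IH]; first by rewrite big_geq // expr0 invr1 subrr mulr0.
rewrite big_nat_recr //=; apply: le_trans (lerD IH (lexx _)) _.
rewrite le_eqVlt; apply/orP; left; apply/eqP; rewrite exprS; field.
by rewrite expf_neq0 // pnatr_eq0.
Qed.

(** Grid covers are covers by sets of diameter e. *)
Lemma small_cover_box s Y e c : bnd Y -> 0 <= s -> 0 < e ->
  cover_number Y e * e `^ s <= c -> small_cover s e c Y.
Proof.
move=> bY s0 e0 le; have [Z /coversP cZ E] := cover_number_ex bY e0.
have [|||U [d [YU de Ud Uc]]] := @content_finite s e Y Z
  (fun z => [set x | (val z)%:~R * e <= x <= (val z + 1)%:~R * e]) e s0.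
- by rewrite e0 lexx.
- move=> x /cZ [z [zZ h1 h2]]; exists [` zZ]%fset => //=; by rewrite h1.
- move=> z x y /= /andP[x1 x2] /andP[y1 y2]; rewrite intrD !mulrDl mul1r in x2 y2.
  by rewrite ler_norml; apply/andP; split; lra.
exists U, d; split=> // N; apply: le_trans (Uc N) _.
by rewrite -cardfE -E.
Qed.

Lemma hausdorff_measure_box s Y : bnd Y -> 0 <= s ->
  (forall e c, 0 < e -> 0 < c ->
    exists e', [/\ 0 < e', e' <= e & cover_number Y e' * e' `^ s <= c]) ->
  hausdorff_measure s Y = 0%E.
Proof.
move=> bY s0 H; apply: hausdorff_measure_eq0 => // e c e0 c0.
have [e' [e'0 e'e le]] := H e c e0 c0.
exact: small_cover_le e'e (small_cover_box bY s0 e'0 le).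
Qed.

Lemma hausdorff_dim_le1 Y (d : R) : Y `<=` `[0, 1] -> hausdorff_dim Y d -> d <= 1.
Proof.
move=> Y01 [d0 dP]; rewrite leNgt; apply/negP => d1.
have [m1 m2] := midf_lt d1; set t := (1 + d) / 2 in m1 m2.
have t0 : 0 <= t by lra.
have [/(_ m2) Ht _] := dP t t0.
have bY : bnd Y := bnd_unit Y01.
have : hausdorff_measure t Y = 0%E; last by rewrite Ht.
apply: hausdorff_measure_box => // e c e0 c0.
have t1 : 0 < t - 1 by rewrite subr_gt0.
pose e' := Num.min (Num.min e 1) ((c / 2) `^ (t - 1)^-1).
have e'0 : 0 < e' by rewrite !lt_min e0 ltr01 powR_gt0 // divr_gt0.
exists e'; split=> //; first by rewrite !ge_min lexx.
have e'1 : e' <= 1 by rewrite !ge_min lexx orbT.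
have N2 : cover_number Y e' <= 2 / e'.
  apply: le_trans (cover_number_unit Y01 e'0) _.
  have : 1 <= e'^-1 by rewrite invf_ge1.
  lra.
apply: le_trans (ler_wpM2r (powR_ge0 _ _) N2) _.
rewrite -{1}(powRr1 (ltW e'0)) -mulrA -powRN -powRD; last by rewrite (gt_eqF e'0) implybT.
rewrite addrC mulrC -ler_pdivlMr //.
have E : c / 2 = ((c / 2) `^ (t - 1)^-1) `^ (t - 1).
  by rewrite -powRrM mulVf ?gt_eqF // powRr1 // divr_ge0 // ltW.
rewrite [leRHS]E; apply: ge0_ler_powR; rewrite ?nnegrE ?powR_ge0 // ?(ltW e'0) ?(ltW t1) //.
by rewrite ge_min lexx orbT.
Qed.

End Hausdorff.

(** * Existence of box-counting dimensions *)

Section BoxLimits.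
Variable R : realType.

Lemma ln_large (C : R) : exists2 e0 : R, 0 < e0 & forall e, 0 < e -> e < e0 -> C < ln e^-1.
Proof.
exists (expR (- C)); first exact: expR_gt0.
move=> e e0 lt; rewrite lnV ?posrE // ltrNr -[ltRHS]expRK.
by rewrite ltr_ln ?posrE ?expR_gt0.
Qed.

Lemma box_limit (Y : set R) (d : R) : bnd Y -> Y !=set0 ->
  (forall c, 0 < c -> exists2 e1, 0 < e1 & forall e, 0 < e -> e < e1 ->
    `|ln (cover_number Y e) - d * ln e^-1| <= c * ln e^-1) ->
  box_dim Y d.
Proof.
move=> bY Y0 H; split=> //; first exact/bndP.
apply/cvg_at_right0 => c c0; have [e1 e10 He] := H c c0.
have [e2 e20 He2] := ln_large 0.
exists (Num.min e1 e2); first by rewrite lt_min e10.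
move=> e e0; rewrite lt_min => /andP[ee1 ee2].
have l0 := He2 e e0 ee2; have := He e e0 ee1.
rewrite -(ler_pM2r (_ : 0 < (ln e^-1)^-1)) ?invr_gt0 // mulfK ?gt_eqF //.
rewrite -[X in _ * X <= _](gtr0_norm (_ : 0 < (ln e^-1)^-1)) ?invr_gt0 // -normrM.
by rewrite mulrBl mulfK ?gt_eqF // distrC.
Qed.

Lemma box_dim_dense (Y : set R) a b : Y `<=` `[0, 1] -> a < b ->
  (forall x, a < x -> x < b -> oclosure Y x) -> box_dim Y 1.
Proof.
move=> Y01 ab abY.
have bY : bnd Y := bnd_unit Y01.
have Y0 : Y !=set0.
  have [m1 m2] := midf_lt ab.
  by have [y [Yy _ _]] := abY _ m1 m2 a b m1 m2; exists y.
apply: box_limit => // c c0.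
pose l := (b - a) / 2; have l0 : 0 < l by rewrite divr_gt0 // subr_gt0.
pose C := `|ln l| + ln 2.
have [e1 e10 He1] := ln_large (C / c).
exists (Num.min (Num.min e1 (l / 3)) 1); first by rewrite !lt_min e10 divr_gt0 // ltr01.
move=> e e0; rewrite !lt_min => /andP[/andP[ee1 ee2] ee3]; rewrite mul1r.
have N1 := cover_number_unit Y01 e0.
have N2 := cover_number_interval bY e0 ab abY.
have ei : 1 < e^-1 by rewrite invf_gt1.
have N1' : cover_number Y e <= 2 * e^-1 by lra.
have N2' : l * e^-1 <= cover_number Y e.
  apply: le_trans N2; rewrite /l.
  have : 3 <= l * e^-1 by rewrite ler_pdivlMr //; lra.
  rewrite /l; lra.
have le0 : 0 < l * e^-1 by rewrite mulr_gt0 // invr_gt0.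
have cn0 := lt_le_trans le0 N2'.
have L1 : ln (cover_number Y e) <= ln 2 + ln e^-1.
  by rewrite -lnM ?posrE ?invr_gt0 // ler_ln ?posrE // mulr_gt0 // invr_gt0.
have L2 : ln l + ln e^-1 <= ln (cover_number Y e).
  by rewrite -lnM ?posrE ?invr_gt0 // ler_ln ?posrE.
have := He1 e e0 ee1; rewrite ltr_pdivrMr // mulrC => h.
have l20 : 0 <= ln 2 :> R by rewrite ln_ge0 // ler1n.
have := ler_norm (- ln l); rewrite normrN; have := normr_ge0 (ln l).
by rewrite ler_norml /C in h *; move=> *; apply/andP; split; lra.
Qed.

(** Fekete's lemma on subadditive sequences. *)
Lemma fekete (u : nat -> R) : (forall n, 0 <= u n) ->
  (forall i j, u (i + j)%N <= u i + u j) ->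
  exists l, forall c, 0 < c -> exists n0, forall n, (n0 <= n)%N -> `|u n - l * n%:R| <= c * n%:R.
Proof.
move=> u0 sub; pose S := [set u i.+1 / i.+1%:R | i in setT].
have hS : has_inf S.
  split; first by exists (u 1%N / 1%:R), 0%N.
  by exists 0 => _ [i _ <-]; rewrite divr_ge0.
exists (inf S) => c c0.
have c2 : 0 < c / 2 by rewrite divr_gt0.
have ltS : inf S < inf S + c / 2 by rewrite ltrDl.
have [_ [i _ <-] Hi] := inf_lt hS.1 ltS.
pose M := \sum_(0 <= r < i.+1) u r.
have uM r : (r < i.+1)%N -> u r <= M.
  move=> ri; rewrite /M (big_cat_nat (n := r)) //=; last exact: ltnW.
  rewrite [X in _ + X]big_ltn // addrCA lerDl addr_ge0 //; exact: sumr_ge0.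
have uq q r : u (q * i.+1 + r)%N <= q%:R * u i.+1 + u r.
  elim: q => [|q IH]; first by rewrite mul0n mul0r add0r.
  rewrite mulSn -addnA -natr1 mulrDl mul1r.
  by apply: le_trans (sub _ _) _; lra.
exists (Num.truncn (M / (c / 2))).+1 => n nn.
have Mn : M <= c / 2 * n%:R.
  rewrite mulrC -ler_pdivrMr //; apply: le_trans (ltW (truncnS_gt _)) _.
  by rewrite ler_nat.
have n0 : (0 < n)%N by apply: leq_trans nn.
have lo : inf S * n%:R <= u n.
  rewrite -ler_pdivlMr ?ltr0n //; apply: ge_inf; first by case: hS.
  by exists n.-1 => //; rewrite prednK.
rewrite ger0_norm ?subr_ge0 // lerBlDr.
have /(_ (n %/ i.+1)%N (n %% i.+1)%N) := uq; rewrite -divn_eq => le.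
apply: le_trans le _.
have qn : (n %/ i.+1)%:R * u i.+1 <= n%:R * (inf S + c / 2).
  apply: le_trans (_ : (n %/ i.+1)%:R * (i.+1%:R * (inf S + c / 2)) <= _).
    by rewrite ler_wpM2l // mulrC -ler_pdivrMr ?ltr0n // ltW.
  rewrite mulrA ler_wpM2r //; last by rewrite -natrM ler_nat leq_divM.
  apply: le_trans (ltW Hi); rewrite divr_ge0 //.
have := uM _ (ltn_pmod n (ltn0Sn i)); nra.
Qed.

Lemma perfect_many (Y : set R) x a b m : Y `<=` derived Y -> Y x -> a < x -> x < b ->
  exists s : seq R, [/\ uniq s, size s = m & forall y, y \in s -> [/\ Y y, a < y & y < b]].
Proof.
move=> pY Yx; elim: m a b => [|m IH] a b ax xb; first by exists [::].
have [y [Yy yx ay yb]] := pY x Yx a b ax xb.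
case: (ltgtP y x) => [lt|gt|//].
  have [||s [us ss Hs]] := IH ((x + y) / 2) b; [lra|lra|].
  exists (y :: s); split=> //=; rewrite ?ss // ?us ?andbT.
    by apply/negP => /Hs [_ h _]; lra.
  by move=> z; rewrite in_cons => /orP[/eqP->|/Hs [Yz h1 h2]]; split=> //; lra.
have [||s [us ss Hs]] := IH a ((x + y) / 2); [lra|lra|].
exists (y :: s); split=> //=; rewrite ?ss // ?us ?andbT.
  by apply/negP => /Hs [_ _ h]; lra.
by move=> z; rewrite in_cons => /orP[/eqP->|/Hs [Yz h1 h2]]; split=> //; lra.
Qed.

Lemma separated (s : seq R) : uniq s ->
  exists2 d, 0 < d & forall x y, x \in s -> y \in s -> x <> y -> d < `|x - y|.
Proof.
elim: s => [|a s IH] /=; first by exists 1.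
move=> /andP[as_ /IH [d d0 Hd]].
have [d' d'0 Hd'] : exists2 d', 0 < d' & forall x, x \in s -> d' < `|x - a|.
  elim: s as_ {IH Hd} => [|b s IH]; first by exists 1.
  rewrite in_cons negb_or => /andP[ab /IH [d1 d10 H1]].
  exists (Num.min d1 (`|b - a| / 2)).
    by rewrite lt_min d10 divr_gt0 // normr_gt0 subr_eq0 eq_sym.
  move=> x; rewrite in_cons => /orP[/eqP->|/H1 h]; rewrite gt_min; last by rewrite h.
  apply/orP; right; have : 0 < `|b - a| by rewrite normr_gt0 subr_eq0 eq_sym.
  by move=> ?; lra.
exists (Num.min d d'); first by rewrite lt_min d0.
move=> x y; rewrite !in_cons => /orP[/eqP->|xs] /orP[/eqP->|ys] // xy; rewrite gt_min.
- by rewrite distrC Hd' ?orbT.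
- by rewrite Hd' ?orbT.
- by rewrite Hd.
Qed.

End BoxLimits.

(** * Counting the cells of a set with finitely many types *)

Lemma leq_count_uniq (T : eqType) (p : pred T) (s : seq T) (s' : seq T) :
  uniq s -> {subset [seq x <- s | p x] <= s'} -> (count p s <= size s')%N.
Proof. by move=> us sub; rewrite -size_filter; apply: uniq_leq_size => //; exact: filter_uniq. Qed.

Section Counting.
Variables (R : realType) (r K : nat) (Y : set R).
Hypotheses (r0 : (0 < r)%N) (K1 : (1 < K)%N) (Y01 : Y `<=` `[0, 1]).

Let D i : R := (r * K ^ i)%N%:R.

Let K0 j : (0 < K ^ j)%N. Proof. by rewrite expn_gt0 ltnW. Qed.

Let D0 i : 0 < D i.
Proof. by rewrite ltr0n muln_gt0 r0 K0. Qed.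

(** A cell is counted if it meets Y, and the cells of scale i + j inside a cell
    of scale i are its subcells. The list of cells includes the two neighbours
    of the unit interval, which may contain 0 or 1. *)
Definition meet i (z : int) := `[< exists x, 0 <= x <= 1 /\ Y ((z%:~R + x) / D i) >].
Definition unit_cells i : seq int := [seq Posz j - 1 | j <- iota 0 (r * K ^ i + 2)].
Definition ncell i := count (meet i) (unit_cells i).
Definition subcells j (z : int) : seq int := [seq z * (K ^ j)%N%:Z + Posz l | l <- iota 0 (K ^ j)].
Definition nsub j i z := count (meet (i + j)) (subcells j z).

Lemma unit_cells_uniq i : uniq (unit_cells i).
Proof. by rewrite map_inj_uniq ?iota_uniq // => a b /addIr []. Qed.

Lemma subcells_uniq j z : uniq (subcells j z).
Proof. by rewrite map_inj_uniq ?iota_uniq // => a b /addrI []. Qed.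

Lemma mem_subcells j z z' : (z' \in subcells j z) = (z * (K ^ j)%N%:Z <= z' < (z + 1) * (K ^ j)%N%:Z).
Proof.
apply/mapP/idP => [[l]|H].
  by rewrite mem_iota add0n => /andP[_ lK] ->; rewrite mulrDl mul1r; lia.
exists (absz (z' - z * (K ^ j)%N%:Z)%R); last by lia.
by rewrite mem_iota add0n /=; move: H; rewrite mulrDl mul1r; lia.
Qed.

Lemma meet_unit_cells i z : meet i z -> z \in unit_cells i.
Proof.
move=> /asboolP[x [/andP[x0 x1] /Y01]]; rewrite /= in_itv /= => /andP[h1 h2].
have {}h1 : 0 <= z%:~R + x by move: h1; rewrite pmulr_lge0 // invr_gt0.
have {}h2 : z%:~R + x <= D i by move: h2; rewrite ler_pdivrMr // mul1r.
have z1 : -1 <= z by rewrite -(ler_int R) intrN; lra.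
have z2 : z <= (r * K ^ i)%N%:Z by rewrite -(ler_int R) -pmulrn -/(D i); lra.
apply/mapP; exists (absz (z + 1)%R); last by lia.
by rewrite mem_iota add0n /=; lia.
Qed.

Lemma D_add i j : D (i + j) = D i * (K ^ j)%N%:R.
Proof. by rewrite /D expnD mulnA natrM. Qed.

Lemma meet_child i j z l x : (l < K ^ j)%N -> 0 <= x <= 1 ->
  Y (((z * (K ^ j)%N%:Z + Posz l)%:~R + x) / D (i + j)) ->
  exists2 y, 0 <= y <= 1 & Y ((z%:~R + y) / D i).
Proof.
move=> lK /andP[x0 x1] H; have KR : 0 < (K ^ j)%N%:R :> R by rewrite ltr0n.
exists ((l%:R + x) / (K ^ j)%N%:R).
  rewrite divr_ge0 ?addr_ge0 //= ler_pdivrMr // mul1r.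
  apply: le_trans (_ : l.+1%:R <= _); last by rewrite ler_nat.
  by rewrite -natr1; lra.
congr Y: H; rewrite D_add intrD intrM -!pmulrn; field.
by rewrite !pnatr_eq0 -!lt0n !K0 r0.
Qed.

Lemma meet_parent i j z z' : z' \in subcells j z -> meet (i + j) z' -> meet i z.
Proof.
move=> /mapP[l]; rewrite mem_iota add0n => /andP[_ lK] -> /asboolP[x [x01 Yx]].
have [y y01 Yy] := meet_child lK x01 Yx.
by apply/asboolP; exists y.
Qed.

Lemma parentP j z' : z' \in subcells j (z' %/ (K ^ j)%N%:Z)%Z.
Proof.
rewrite mem_subcells; have KR : (K ^ j)%N%:Z != 0 by have := K0 j; lia.
rewrite lez_floor // /=; have := ltz_ceil z' (_ : 0 < (K ^ j)%N%:Z).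
by rewrite ltz_nat => ->.
Qed.

Lemma leq_count_subcells j i z (s : seq int) :
  {subset [seq x <- subcells j z | meet (i + j) x] <= s} -> (nsub j i z <= size s)%N.
Proof. by apply: leq_count_uniq; exact: subcells_uniq. Qed.

Lemma nsub_le j i z : (nsub j i z <= K ^ j)%N.
Proof. by apply: leq_trans (count_size _ _) _; rewrite size_map size_iota. Qed.

Lemma nsub_le_ncell j i z : (nsub j i z <= ncell (i + j))%N.
Proof.
rewrite /ncell -size_filter; apply: leq_count_subcells => x; rewrite !mem_filter => /andP[mx _].
by rewrite mx meet_unit_cells.
Qed.

Lemma nsub_eq0 j i z : ~~ meet i z -> nsub j i z = 0%N.
Proof.
move=> nm; apply/eqP; rewrite -leqn0 leqNgt -has_count; apply/negP => /hasP[z' zz' mz'].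
by move/negP: nm; apply; exact: meet_parent zz' mz'.
Qed.

Lemma size_flatten_filter j i (s : seq int) :
  size (flatten [seq [seq x <- subcells j z | meet (i + j) x] | z <- s]) =
  \sum_(z <- s) nsub j i z.
Proof.
elim: s => [|z s IH] /=; first by rewrite big_nil.
by rewrite size_cat IH big_cons size_filter.
Qed.

Lemma ncell_le_sum i j : (ncell (i + j) <= \sum_(z <- unit_cells i) nsub j i z)%N.
Proof.
rewrite -size_flatten_filter; apply: leq_count_uniq; first exact: unit_cells_uniq.
move=> x; rewrite mem_filter => /andP[mx _]; apply/flatten_mapP.
exists (x %/ (K ^ j)%N%:Z)%Z; first by apply: meet_unit_cells; apply: meet_parent (parentP _ _) mx.
by rewrite mem_filter mx parentP.
Qed.

Lemma ncell_mul_le i j : (ncell (i + j) <= ncell i * K ^ j)%N.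
Proof.
apply: leq_trans (ncell_le_sum i j) _.
rewrite (bigID (meet i)) /= [X in (_ + X)%N]big1 ?addn0; last by move=> z /nsub_eq0.
rewrite /ncell -sum1_count big_distrl /=; apply: leq_sum => z _; rewrite mul1n; exact: nsub_le.
Qed.

(** Different cells have disjoint lists of subcells. *)
Lemma sum_nsub_shift i j d : (\sum_(z <- unit_cells i) nsub j i (z + d) <= ncell (i + j))%N.
Proof.
have -> : \sum_(z <- unit_cells i) nsub j i (z + d) =
  size [seq x <- flatten [seq subcells j (z + d) | z <- unit_cells i] | meet (i + j) x].
  elim: (unit_cells i) => [|z s IH] /=; first by rewrite big_nil.
  by rewrite filter_cat size_cat -IH big_cons size_filter.
rewrite /ncell -size_filter; apply: uniq_leq_size; last first.
  by move=> x; rewrite !mem_filter => /andP[mx _]; rewrite mx meet_unit_cells.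
apply: filter_uniq.
have : uniq (unit_cells i) := unit_cells_uniq i.
elim: (unit_cells i) => //= z s IH /andP[zs_ us]; rewrite cat_uniq subcells_uniq IH // andbT /=.
apply/hasPn => x /flatten_mapP[z' z's]; rewrite !mem_subcells => /andP[h1 h2].
apply/negP => /andP[h3 h4].
have : z' = z.
  have k0 := K0 j.
  have a1 : z + d < z' + d + 1 by rewrite -(ltr_pM2r (_ : 0 < (K ^ j)%N%:Z)) //; lia.
  have a2 : z' + d < z + d + 1 by rewrite -(ltr_pM2r (_ : 0 < (K ^ j)%N%:Z)) //; lia.
  by lia.
by move=> E; rewrite -E z's in zs_.
Qed.

Lemma cover_le_ncell i : cover_number Y (D i)^-1 <= (ncell i)%:R.
Proof.
rewrite /ncell -size_filter; apply: cover_number_seq => x Yx.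
have Di0 : 0 < (D i)^-1 by rewrite invr_gt0.
have [z [h1 h2]] := cell_of x Di0.
exists z; split=> //.
have mz : meet i z.
  apply/asboolP; exists (x * D i - z%:~R); split.
    rewrite ler_pdivrMr // in h1; rewrite ler_pdivlMr // intrD in h2.
    by apply/andP; split; lra.
  by rewrite addrC subrK mulfK // gt_eqF.
by rewrite mem_filter mz meet_unit_cells.
Qed.

Lemma ncell_le_cover i : (ncell i)%:R <= 3 * cover_number Y (D i)^-1.
Proof.
have bY : bnd Y := bnd_unit Y01.
have Di0 : 0 < (D i)^-1 by rewrite invr_gt0.
have [Z /coversP cZ ->] := cover_number_ex bY Di0.
pose s := enum_fset Z ++ ([seq z + 1 | z <- enum_fset Z] ++ [seq z - 1 | z <- enum_fset Z]).
have : (ncell i <= size s)%N.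
  apply: leq_count_uniq; first exact: unit_cells_uniq.
  move=> z; rewrite mem_filter => /andP[/asboolP[x [/andP[x0 x1] Yx]] _].
  have [z' [z'Z h1 h2]] := cZ _ Yx.
  rewrite ler_pM2r // in h1; rewrite ler_pM2r // intrD in h2.
  have a1 : z' <= z + 1 by rewrite -(ler_int R) intrD; lra.
  have a2 : z <= z' + 1 by rewrite -(ler_int R) intrD; lra.
  have : z = z' \/ z = z' + 1 \/ z = z' - 1 by lia.
  rewrite !mem_cat => -[->|[->|->]].
  - by rewrite z'Z.
  - by rewrite (map_f (fun z => z + 1)) ?orbT.
  - by rewrite (map_f (fun z => z - 1)) ?orbT.
rewrite -(ler_nat R) => /le_trans; apply.
rewrite /s !size_cat !size_map -natrM ler_nat.
by rewrite -[size (enum_fset Z)]/(#|` Z|); move: (#|` Z|) => c; lia.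
Qed.

Variables (T : finType) (tp : nat -> int -> T).
Hypothesis tpP : forall i z j z', tp i z = tp j z' ->
    forall x, 0 <= x <= 1 ->
    (Y ((z%:~R + x) / (r * K ^ i)%N%:R) <-> Y ((z'%:~R + x) / (r * K ^ j)%N%:R)).

Lemma nsub_type j i z i' z' : tp i z = tp i' z' -> nsub j i z = nsub j i' z'.
Proof.
move=> e; rewrite /nsub !count_map; apply: eq_in_count => l.
rewrite mem_iota add0n => /andP[_ lK].
have KR : 0 < (K ^ j)%N%:R :> R by rewrite ltr0n.
have E i1 z1 x : ((z1 * (K ^ j)%N%:Z + Posz l)%:~R + x) / D (i1 + j) =
    (z1%:~R + (l%:R + x) / (K ^ j)%N%:R) / (r * K ^ i1)%N%:R.
  rewrite D_add intrD intrM -!pmulrn -/(D i1); field.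
  by rewrite !pnatr_eq0 -!lt0n !K0 r0.
apply: asbool_equiv_eq; split=> -[x [x01 H]]; exists x; split=> //;
    move: H; rewrite !E; [apply: (tpP e _).1|apply: (tpP e _).2];
  case/andP: x01 => x0 x1; rewrite divr_ge0 ?addr_ge0 //= ler_pdivrMr // mul1r;
  by apply: le_trans (_ : l.+1%:R <= _); rewrite ?ler_nat // -natr1; lra.
Qed.

(** Choose one cell of each type, of scale i0 say. A cell of this type has as
    many subcells as the chosen one, and these are among all cells of scale i0 +
    j. *)
Lemma nsub_le_mul : exists I0, forall j i z, (nsub j i z <= K ^ I0 * ncell j)%N.
Proof.
have H (t : T) : exists i0 : nat, forall j i z, tp i z = t -> (nsub j i z <= K ^ i0 * ncell j)%N.
  have [[i0 [z0 e0]]|no] := pselect (exists i z, tp i z = t); last first.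
    by exists 0%N => j i z e; case: no; exists i, z.
  exists i0 => j i z e; rewrite (@nsub_type j i z i0 z0) ?e //.
  apply: leq_trans (nsub_le_ncell j i0 z0) _; rewrite addnC mulnC; exact: ncell_mul_le.
have [f fP] := choice H; exists (\max_t f t)%N => j i z.
apply: leq_trans (fP (tp i z) j i z erefl) _.
by rewrite leq_mul2r leq_pexp2l ?orbT ?(ltnW K1) //; exact: leq_bigmax.
Qed.

Lemma ncell_submul : exists C, (0 < C)%N /\
  forall i j, (ncell (i + j) <= C * (ncell i * ncell j))%N.
Proof.
have [I0 HI] := nsub_le_mul; exists (K ^ I0)%N; split=> // i j.
apply: leq_trans (ncell_le_sum i j) _.
rewrite (bigID (meet i)) /= [X in (_ + X)%N]big1 ?addn0; last by move=> z /nsub_eq0.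
rewrite {1}/ncell -sum1_count big_distrl big_distrr /=.
by apply: leq_sum => z _; rewrite mul1n.
Qed.

Hypothesis pY : Y `<=` derived Y.

(** Every window of three consecutive cells around a point of a perfect set
    eventually contains six cells of the set. *)
Lemma window_six i z : meet i z ->
  exists B0, forall B, (B0 <= B)%N -> (6 <= nsub B i (z - 1) + (nsub B i z + nsub B i (z + 1)))%N.
Proof.
move=> /asboolP[x [/andP[x0 x1] Yx]].
have [||s [us ss Hs]] := @perfect_many R Y _ ((z%:~R - 1) / D i) ((z%:~R + 2) / D i) 6 pY Yx.
- by rewrite ltr_pM2r ?invr_gt0 //; lra.
- by rewrite ltr_pM2r ?invr_gt0 //; lra.
have [d d0 Hd] := separated us.
have [B0 HB] := kX_inv_small K1 (1 / D i) d0.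
exists B0 => B BB; have {}HB : 1 < d * D (i + B).
  by have := HB B BB; rewrite ltr_pdivrMr ?(kX_gt0 R K1) // ltr_pdivrMr // D_add natrX -mulrA [_ * D i]mulrC.
pose fl y := Num.floor (y * D (i + B)).
have flE y : (fl y)%:~R <= y * D (i + B) < (fl y)%:~R + 1.
  by have := floor_itv (y * D (i + B)); rewrite intrD.
have fi : {in s &, injective fl}.
  move=> y y' ys y's E; apply: contrapT => yy'; have := Hd y y' ys y's yy'.
  have := flE y; have := flE y'; rewrite -E => /andP[a1 a2] /andP[a3 a4].
  rewrite -(ltr_pM2r (D0 (i + B))) -[X in _ < _ * X](gtr0_norm (D0 _)) -normrM mulrBl.
  have : `|y * D (i + B) - y' * D (i + B)| <= 1 by rewrite ler_norml; apply/andP; split; lra.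
  lra.
have -> : 6%N = size (map fl s) by rewrite size_map ss.
rewrite /nsub -!size_filter -!size_cat; apply: uniq_leq_size.
  by rewrite map_inj_in_uniq.
move=> _ /mapP[y ys ->]; have [Yy ay yb] := Hs y ys.
have m : meet (i + B) (fl y).
  apply/asboolP; exists (y * D (i + B) - (fl y)%:~R); split.
    by have /andP[a1 a2] := flE y; apply/andP; split; lra.
  by rewrite addrC subrK mulfK // gt_eqF.
rewrite !mem_cat !mem_filter m /= !mem_subcells.
have KR : 0 < (K ^ B)%N%:R :> R by rewrite ltr0n.
rewrite ltr_pdivrMr // in ay; rewrite ltr_pdivlMr // in yb.
have /andP[a1 a2] := flE y; rewrite D_add mulrA in a1 a2.
have b1 : (z - 1) * (K ^ B)%N%:Z <= fl y.
  rewrite -ltzD1 -(ltr_int R) intrM !intrD -pmulrn; apply: le_lt_trans a2.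
  by rewrite ler_pM2r // ltW // intrN.
have b2 : fl y < (z + 2) * (K ^ B)%N%:Z.
  rewrite -(ltr_int R) intrM !intrD -pmulrn; apply: le_lt_trans a1 _.
  by rewrite ltr_pM2r.
move: b1 b2 (K0 B); rewrite !mulrDl !mulNr !mul1r.
move: (fl y) (z * (K ^ B)%N%:Z) (K ^ B)%N => f q p; clear; lia.
Qed.

(** The B of window_six may be chosen for all scales, since it depends only on
    the types of three neighbouring cells, and each cell lies in at most three
    windows. *)
Lemma ncell_double : exists B, (0 < B)%N /\ forall i, (2 * ncell i <= ncell (i + B))%N.
Proof.
pose tw i z := (tp i (z - 1), tp i z, tp i (z + 1)).
have H (t : T * T * T) : exists B0, forall i z, tw i z = t -> meet i z ->
    forall B, (B0 <= B)%N -> (6 <= nsub B i (z - 1) + (nsub B i z + nsub B i (z + 1)))%N.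
  have [[i0 [z0 [e0 m0]]]|no] := pselect (exists i z, tw i z = t /\ meet i z); last first.
    by exists 0%N => i z e m; case: no; exists i, z.
  have [B0 HB] := window_six m0; exists B0 => i z e m B BB.
  have := HB B BB; move: e; rewrite -e0 => -[e1 e2 e3].
  by rewrite (nsub_type _ e1) (nsub_type _ e2) (nsub_type _ e3).
have [f fP] := choice H; pose B := (\max_t f t).+1; exists B; split=> // i.
have six z : meet i z -> (6 <= nsub B i (z + -1) + (nsub B i (z + 0) + nsub B i (z + 1)))%N.
  move=> m; rewrite addr0; apply: (fP (tw i z)) => //.
  by apply: leqW; exact: leq_bigmax.
have : (6 * ncell i <= 3 * ncell (i + B))%N.
  apply: (@leq_trans (\sum_(z <- unit_cells i) (nsub B i (z + -1) + (nsub B i (z + 0) + nsub B i (z + 1))))%N).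
    rewrite (bigID (meet i)) /=; apply: leq_trans (leq_addr _ _).
    by rewrite /ncell -sum1_count big_distrr /=; apply: leq_sum => z /six; rewrite muln1.
  rewrite !big_split /=.
  have := sum_nsub_shift i B (-1); have := sum_nsub_shift i B 0; have := sum_nsub_shift i B 1.
  lia.
lia.
Qed.

End Counting.

(** The numbers of cells at successive scales are submultiplicative up to a
    constant because there are finitely many types of cells, so their growth
    rate exists; it is positive because the set is perfect. *)
Lemma perfect_box_dim (R : realType) (r K : nat) (Y : set R) :
  (0 < r)%N -> (1 < K)%N -> Y `<=` `[0, 1] -> fintypes r K Y -> Y !=set0 ->
  Y `<=` derived Y ->
  exists2 d, 0 < d & forall A, A !=set0 -> A `<=` Y -> Y `<=` oclosure A -> box_dim A d.
Proof.
move=> r0 K1 Y01 [T [tp tpP]] [y0 Yy0] pY.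
have bY : bnd Y := bnd_unit Y01.
pose b i := ncell r K Y i.
have K0 j : (0 < K ^ j)%N by rewrite expn_gt0 ltnW.
have D0 i : 0 < (r * K ^ i)%N%:R :> R by rewrite ltr0n muln_gt0 r0 K0.
pose s i : R := (r * K ^ i)%N%:R^-1.
have s0 i : 0 < s i by rewrite invr_gt0.
have Nb i : cover_number Y (s i) <= (b i)%:R by exact: cover_le_ncell.
have bN i : (b i)%:R <= 3 * cover_number Y (s i) by exact: ncell_le_cover.
have b1 i : (0 < b i)%N.
  rewrite -(ltr0n R); apply: lt_le_trans (Nb i); apply: lt_le_trans (ltr01) _.
  by apply: cover_number_ge1 => //; exists y0.
have [C [C0 HC]] := ncell_submul r0 K1 Y01 tpP.
have [B [B0 HB]] := ncell_double r0 K1 Y01 tpP pY.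
pose u i : R := ln (C * b i)%N%:R.
have Cb i : 0 < (C * b i)%N%:R :> R by rewrite ltr0n muln_gt0 C0 b1.
have uE i : u i = ln C%:R + ln (b i)%:R by rewrite /u natrM lnM // posrE ltr0n.
have lnC0 : 0 <= ln C%:R :> R by rewrite ln_ge0 // ler1n.
have [l Hl] : exists l, forall c, 0 < c ->
    exists n0, forall n, (n0 <= n)%N -> `|u n - l * n%:R| <= c * n%:R.
  apply: fekete => [n|i j]; first by rewrite ln_ge0 // ler1n muln_gt0 C0 b1.
  rewrite /u -lnM ?posrE // ler_ln ?posrE ?mulr_gt0 // -natrM ler_nat.
  by rewrite mulnACA -mulnA leq_mul2l HC orbT.
(* The numbers of cells double every B scales. *)
have l0 : 0 < l.
  have bB n : (2 ^ n <= b (n * B))%N.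
    elim: n => [|n IH]; first by rewrite mul0n expn0.
    rewrite expnS [(n.+1 * B)%N]mulSn [(B + _)%N]addnC.
    apply: leq_trans (HB (n * B)%N).
    by rewrite leq_mul2l /= IH.
  have ln2 : 0 < ln 2 :> R by rewrite ln_gt0 // ltr1n.
  pose c := ln 2 / (2 * B%:R) : R.
  have BR : 0 < B%:R :> R by rewrite ltr0n.
  have c0 : 0 < c by rewrite divr_gt0 // mulr_gt0.
  have [n0 Hn] := Hl c c0.
  have nn : (n0 <= n0.+1 * B)%N by apply: leq_trans (leqnSn n0) _; rewrite leq_pmulr.
  have := Hn (n0.+1 * B)%N nn.
  rewrite ler_norml => /andP[_ h].
  have : n0.+1%:R * ln 2 <= u (n0.+1 * B)%N.
    rewrite uE -[X in X <= _]add0r lerD // -ln_powR powR_mulrn ?ler0n //.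
    by rewrite ler_ln ?posrE ?exprn_gt0 ?ltr0n // -natrX ler_nat bB.
  rewrite natrM in h *.
  have n1 : 0 < n0.+1%:R :> R by rewrite ltr0n.
  move=> h2; have h3 : n0.+1%:R * ln 2 <= (l + c) * B%:R * n0.+1%:R by lra.
  have h4 : ln 2 <= (l + c) * B%:R.
    by move: h3; rewrite [X in X <= _]mulrC ler_pM2r.
  have cE : c * B%:R = ln 2 / 2 by rewrite /c; field; rewrite gt_eqF.
  have : 0 < l * B%:R by rewrite mulrDl cE in h4; lra.
  by rewrite pmulr_lgt0.
have lnK : 0 < ln K%:R :> R by rewrite ln_gt0 // ltr1n.
exists (l / ln K%:R); first by rewrite divr_gt0.
move=> A A0 AY YA.
have bA : bnd A := bnd_sub AY bY.
(* A and Y have the same covers, as grid intervals are closed. *)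
have AE e : 0 < e -> cover_number A e = cover_number Y e.
  move=> e0; apply/eqP; rewrite eq_le; apply/andP; split; apply: cover_number_sub => //.
  by apply: subset_trans AY _; exact: sub_oclosure.
apply: box_limit => // c c0.
have lns i : - ln (s i) = ln r%:R + i%:R * ln K%:R.
  rewrite /s lnV ?posrE // opprK natrM lnM ?posrE ?ltr0n // natrX.
  by rewrite -powR_mulrn ?ler0n // ln_powR.
pose c1 := c * ln K%:R / 4.
have c10 : 0 < c1 by rewrite divr_gt0 // mulr_gt0.
have [n1 Hn1] := Hl c1 c10.
pose C1 := ln C%:R + ln 6 + c1 + l + l / ln K%:R * ln r%:R.
pose n2 := (Num.truncn (C1 / c1)).+1.
exists (s (maxn n1 n2).+1) => // e e0 es.
have [i [i1 i2 Hi]] : exists i, [/\ s i.+1 <= e, e < s i & (maxn n1 n2 < i)%N].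
  have ex : exists i, s i <= e.
    have [m Hm] := kX_inv_small K1 (1 / r%:R) e0.
    exists m; rewrite ltW //; have := Hm m (leqnn m).
    by rewrite /s natrM natrX invfM mul1r.
  have [i si imin] := ex_minnP ex.
  have smono m m' : (m <= m')%N -> s m' <= s m.
    by move=> mm; rewrite lef_pV2 ?posrE // ler_nat leq_mul2l leq_pexp2l ?orbT // ltnW.
  have ii : ((maxn n1 n2).+1 < i)%N.
    rewrite ltnNge; apply/negP => /smono /(lt_le_trans es) /lt_le_trans /(_ si).
    by rewrite ltxx.
  case: i si imin ii => // i si imin ii; exists i; split=> //.
  by rewrite ltNge; apply/negP => /imin; rewrite ltnn.
rewrite AE // lnV ?posrE //.
have N0 : 0 < cover_number Y e.
  by apply: lt_le_trans ltr01 _; apply: cover_number_ge1 => //; exists y0.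
have U : ln (cover_number Y e) <= ln 2 + ln (b i.+1)%:R.
  rewrite -lnM ?posrE ?ltr0n // ler_ln ?posrE ?mulr_gt0 ?ltr0n //.
  apply: le_trans (cover_number_scale bY (s0 i.+1) i1) _.
  by rewrite ler_pM2l ?ltr0n.
have L : ln (b i)%:R <= ln 6 + ln (cover_number Y e).
  rewrite -lnM ?posrE ?ltr0n // ler_ln ?posrE ?mulr_gt0 ?ltr0n //.
  apply: le_trans (bN i) _; have := cover_number_scale bY e0 (ltW i2); lra.
have E1 : ln r%:R + i%:R * ln K%:R <= - ln e.
  by rewrite -lns lerN2 ler_ln ?posrE // ltW.
have E2 : - ln e <= ln r%:R + (i%:R + 1) * ln K%:R.
  by rewrite natr1 -lns lerN2 ler_ln ?posrE.
have n1i : (n1 <= i)%N by apply: leq_trans (leq_maxl n1 n2) (ltnW Hi).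
have := Hn1 i n1i; have := Hn1 i.+1 (leqW n1i).
rewrite !uE -natr1 !ler_norml => /andP[f1 f2] /andP[f3 f4].
have lr : 0 <= ln r%:R :> R by rewrite ln_ge0 // ler1n.
pose q := l / ln K%:R; have q0 : 0 < q by rewrite divr_gt0.
have qK : q * ln K%:R = l by rewrite /q divfK // gt_eqF.
have E1' : q * ln r%:R + l * i%:R <= q * - ln e.
  by apply: le_trans (ler_wpM2l (ltW q0) E1); rewrite mulrDr mulrCA qK mulrC; lra.
have E2' : q * - ln e <= q * ln r%:R + l * i%:R + l.
  by apply: le_trans (ler_wpM2l (ltW q0) E2) _; rewrite mulrDr mulrCA qK; lra.
have qr : 0 <= q * ln r%:R by rewrite mulr_ge0 // ltW.
have big : C1 <= c1 * i%:R.
  rewrite mulrC -ler_pdivrMr //; apply: le_trans (ltW (truncnS_gt _)) _.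
  by rewrite ler_nat; apply: leq_trans (leq_maxr n1 n2) (ltnW Hi).
have cE : c1 * i%:R * 4 <= c * - ln e.
  have -> : c1 * i%:R * 4 = c * (i%:R * ln K%:R) by rewrite /c1; field.
  by rewrite ler_wpM2l ?(ltW c0) //; lra.
have ln6 : ln 2 <= ln 6 :> R by rewrite ler_ln ?posrE ?ltr0n // ler_nat.
have ln20 : 0 <= ln 2 :> R by rewrite ln_ge0 // ler1n.
rewrite -/q /C1 -/q in big *.
by apply/andP; split; lra.
Qed.

(** * A dichotomy for recognizable languages *)

Definition rarely (A : eqType) (Z : seq A) (w : nat -> A) :=
  exists n, forall p, (n <= p)%N -> seg w p (p + size Z) <> Z.

Section Dichotomy.
Variables (A : eqType) (a0 : A) (M : finType) (nu : seq A -> M) (L : (nat -> A) -> Prop).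
Hypothesis rL : recognizes nu L.

Definition loops_in (t : seq A) (e : M) :=
  forall w f, (forall i, (f i < f i.+1)%N) -> f 0%N = size t -> seg w 0 (size t) = t ->
    (forall i, nu (seg w (f i) (f i.+1)) = e) -> L w.

Definition big (e : M) (y : seq A) := forall z, exists z', nu (y ++ z ++ z') = e.

Lemma big_completion e y : big e y ->
  exists zc : M -> seq A, forall r, nu (y ++ r ++ zc (nu (y ++ r))) = e.
Proof.
move=> by_; have [c _] := rL.
have H (m : M) : exists z', forall r, nu (y ++ r) = m -> nu (y ++ r ++ z') = e.
  have [[r0 r0m]|no] := pselect (exists r, nu (y ++ r) = m); last first.
    by exists [::] => r rm; case: no; exists r.
  have [z' Hz] := by_ r0; exists z' => r rm; rewrite -Hz !catA; apply: c => //.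
  by rewrite rm r0m.
by have [zc zcP] := choice H; exists zc => r; exact: zcP.
Qed.

(** For each of the finitely many values of y ++ r, append to the word Z built
    so far a completion of it to a word of value e, followed by y. Thus,
    whatever precedes, Z contains the end of a block of value e that starts with
    y, and the start of the next block. *)
Lemma big_synchronizer e y : big e y -> exists Z, forall r,
  exists Z1 Z2, Z = Z1 ++ y ++ Z2 /\ nu (y ++ r ++ Z1) = e.
Proof.
move=> /big_completion [zc zcP]; have [c _] := rL.
suff H (l : seq M) : exists Z, forall r, nu (y ++ r) \in l ->
    exists Z1 Z2, Z = Z1 ++ y ++ Z2 /\ nu (y ++ r ++ Z1) = e.
  by have [Z HZ] := H (enum M); exists Z => r; apply: HZ; rewrite mem_enum.
elim: l => [|m l [Z HZ]]; first by exists [::].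
have [[r0 r0m]|no] := pselect (exists r, nu (y ++ r) = m); last first.
  by exists Z => r; rewrite in_cons => /orP[/eqP rm|/HZ//]; case: no; exists r.
pose z := zc (nu (y ++ r0 ++ Z)).
exists (Z ++ z ++ y) => r; rewrite in_cons => /orP[/eqP rm|/HZ [Z1 [Z2 [ZE E]]]].
  exists (Z ++ z), [::]; rewrite cats0 -catA; split=> //.
  have -> : z = zc (nu (y ++ (r ++ Z))).
    by rewrite /z; congr zc; rewrite !catA; apply: c => //; rewrite r0m rm.
  by have := zcP (r ++ Z); rewrite -!catA.
by exists Z1, (Z2 ++ z ++ y); split=> //; rewrite {1}ZE -!catA.
Qed.

(** A word that starts with t ++ y and contains the synchronizing word
    infinitely often can be cut, after t, into blocks of value e. *)
Lemma frequent_loops t e y : loops_in t e -> big e y -> (0 < size y)%N ->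
  exists Z, (0 < size Z)%N /\ forall w, ~ L (wcat (t ++ y) w) -> rarely Z w.
Proof.
move=> tL bey y0; have [Z HZ] := big_synchronizer bey.
exists Z; split.
  by have [Z1 [Z2 [-> _]]] := HZ [::]; rewrite !size_cat; lia.
move=> w nL; apply: contrapT => often; apply: nL.
set W := wcat (t ++ y) w.
have occ p : exists q, (p <= q)%N /\ seg W q (q + size Z) = Z.
  apply: contrapT => /forallNP no; apply: often; exists p => q pq E.
  apply: (no (size (t ++ y) + q)%N); split; first by lia.
  rewrite -[RHS]E (@eq_seg_shift _ W w _ _ q); first by congr seg; lia.
  by move=> l _; rewrite -addnA /W wcat_addn.
pose at_y p := seg W p (p + size y) = y.
have step p : exists p', at_y p -> [/\ (p < p')%N, at_y p' & nu (seg W p p') = e].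
  have [ap|nap] := pselect (at_y p); last by exists 0%N.
  have [q [pq qZ]] := occ (p + size y)%N.
  have [Z1 [Z2 [ZE E]]] := HZ (seg W (p + size y) q).
  have sZ : size Z = (size Z1 + (size y + size Z2))%N by rewrite ZE !size_cat.
  have : seg W q (q + size Z1) ++ (seg W (q + size Z1) (q + size Z1 + size y) ++
      seg W (q + size Z1 + size y) (q + size Z)) = Z1 ++ (y ++ Z2).
    rewrite seg_cat; [|lia|lia].
    by rewrite seg_cat; [rewrite qZ ZE|lia|lia].
  move=> /eqP; rewrite eqseq_cat; last by rewrite size_seg addKn.
  rewrite eqseq_cat; last by rewrite size_seg addKn.
  move=> /andP[/eqP e1 /andP[/eqP e2 _]].
  exists (q + size Z1)%N => _; split=> //; first by lia.
  rewrite -(@seg_cat _ W p (p + size y)); [|lia|lia].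
  rewrite ap -(@seg_cat _ W (p + size y) q); [|lia|lia].
  by rewrite e1.
pose nx p := sval (cid (step p)).
pose f i := iter i nx (size t).
have fy i : at_y (f i).
  elim: i => [|i IH] /=; last by rewrite /nx; case: (cid _) => p' /= /(_ IH) [].
  rewrite /at_y /f /= (@eq_seg_shift _ W (wcat y w) _ _ 0).
    by rewrite add0n addKn seg_wcat0.
  move=> l; rewrite addKn => ly; rewrite add0n /W /wcat size_cat ltn_add2l ly.
  by rewrite nth_cat ltnNge leq_addr /= addKn; apply: set_nth_default.
have fS i : (f i < f i.+1)%N /\ nu (seg W (f i) (f i.+1)) = e.
  by rewrite /f iterS -/(f i) /nx; case: (cid _) => p' /= /(_ (fy i)) [].
apply: (tL W f) => //.
- by move=> i; case: (fS i).
- rewrite (@eq_seg _ _ (wcat t w)) ?seg_wcat0 // => l /andP[_ lt].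
  rewrite /W /wcat size_cat lt ltn_addr // nth_cat lt; exact: set_nth_default.
by move=> i; case: (fS i).
Qed.

(** If no value in E is big, then for each of the finitely many pairs of values,
    one after the other, some continuation makes the first value unreachable
    from the second. *)
Lemma killer (E : M -> Prop) : (forall e y, E e -> ~ big e y) ->
  exists Z, (0 < size Z)%N /\ forall e y z', E e -> nu (y ++ Z ++ z') <> e.
Proof.
move=> nb; have [c _] := rL.
suff H (l : seq (M * M)) : exists Z, forall e y, E e -> (e, nu y) \in l ->
    forall z', nu (y ++ Z ++ z') <> e.
  have [Z HZ] := H (enum {: M * M}); exists (Z ++ [:: a0]); split.
    by rewrite size_cat addn1.
  by move=> e y z' Ee; rewrite -!catA; apply: HZ => //; rewrite mem_enum.
elim: l => [|[e0 m0] l [Z HZ]]; first by exists [::].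
have [[Ee0 [y0 ym]]|no] := pselect (E e0 /\ exists y, nu y = m0); last first.
  exists Z => e y Ee; rewrite in_cons => /orP[/eqP[ee ym]|]; last exact: HZ.
  by case: no; rewrite -ee; split=> //; exists y.
have /existsNP[z /forallNP Hz] := nb e0 (y0 ++ Z) Ee0.
exists (Z ++ z) => e y Ee; rewrite in_cons => /orP[/eqP[-> yy]|yl] z'; last first.
  by rewrite -catA; exact: HZ.
move=> h; apply: (Hz z'); rewrite -h -!catA; apply: c => //.
by rewrite ym yy.
Qed.

(** If some value of accepted loops is big, frequent_loops applies to the
    complement of L. Otherwise the word of killer cannot occur inside a block
    whose value is that of an accepted loop; but by Ramsey's theorem every word
    of L is made of such blocks, up to a prefix. *)
Lemma rarely_dichotomy : exists c Z, (0 < size Z)%N /\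
  ((forall w, L (wcat c w) -> rarely Z w) \/ (forall w, ~ L (wcat c w) -> rarely Z w)).
Proof.
have [[t [e [y [tL be]]]]|no] := pselect (exists t e y, loops_in t e /\ big e y).
  have [||Z [Z0 HZ]] := @frequent_loops t e (y ++ [:: a0]) tL.
  - by move=> z; have [z' Hz] := be (a0 :: z); exists z'; rewrite -catA.
  - by rewrite size_cat addn1.
  by exists (t ++ (y ++ [:: a0])), Z; split=> //; right.
have [|Z [Z0 HZ]] := @killer (fun e => exists t, loops_in t e).
  by move=> e y [t tL] be; apply: no; exists t, e, y.
exists [::], Z; split=> //; left=> w Lw.
have {}Lw : L w by congr L: Lw; apply/funext => n; rewrite /wcat /= subn0.
have [c s] := rL.
have [f [f0 fi [e fe]]] := ramsey (fun i j => nu (seg w i j)) 1.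
have Le : loops_in (seg w 0 (f 0%N)) e.
  move=> w' g gi; rewrite size_seg subn0 => g0 w'0 ge.
  pose ex (h : nat -> nat) i := if i is i'.+1 then h i' else 0%N.
  apply: (s w w' (ex f) (ex g)) => //.
  - by split=> // -[|i] //=; rewrite fi.
  - by split=> // -[|i] /=; rewrite ?g0 ?gi.
  by move=> [|i] /=; [rewrite g0 w'0|rewrite ge fe].
exists (f 0%N) => p fp E.
have [i /andP[i1 i2]] := incr_block fi fp.
have jp := incr_ge fi (p + size Z + i.+1).
apply: (HZ e (seg w (f i) p) (seg w (p + size Z) (f (p + size Z + i.+1)%N))).
  by exists (seg w 0 (f 0%N)).
by rewrite -{1}E (@seg_cat _ w p) ?leq_addr ?(@seg_cat _ w (f i)) ?fe //; lia.
Qed.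

End Dichotomy.

(** * Words that contain a given word finitely often *)

Section Rare.
Variables (R : realType) (K : nat) (K1 : (1 < K)%N) (Z : seq 'I_K) (Z0 : (0 < size Z)%N).

Lemma fr_close (w w' : nat -> 'I_K) m : (forall i, (i < m)%N -> w i = w' i) ->
  `|fr R w - fr R w'| <= (K%:R ^+ m)^-1.
Proof.
move=> ww'; rewrite (fr_split R K1 w m) (fr_split R K1 w' m).
rewrite (@psum_ext R K (fun i => Posz (w i)) (fun i => Posz (w' i))); last by move=> i /ww' ->.
rewrite [_ + _ - _](_ : _ = (fr R (fun i => w (m + i)%N) - fr R (fun i => w' (m + i)%N)) / K%:R ^+ m); last by ring.
rewrite norm_divkX // -[leRHS]mul1r ler_divkX // ler_norml.
have := fr_ge0 R K1 (fun i => w (m + i)%N); have := fr_le1 R K1 (fun i => w (m + i)%N).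
have := fr_ge0 R K1 (fun i => w' (m + i)%N); have := fr_le1 R K1 (fun i => w' (m + i)%N).
by move=> *; apply/andP; split; lra.
Qed.

Let B := size Z.
Let Q := (K ^ B)%N.

Lemma Q_ge2 : (2 <= Q)%N.
Proof. by rewrite /Q -(exp1n B) ltn_exp2r. Qed.

(** The exponent is chosen so that Q ^ s = Q - 1 / 2, where Q is the number of
    words of the length of Z. *)
Let s : R := ln (Q%:R - 2^-1) / ln Q%:R.

Lemma lnQ_gt0 : 0 < ln Q%:R :> R.
Proof. by rewrite ln_gt0 // ltr1n Q_ge2. Qed.

Lemma rare_exp_bounds : 0 <= s < 1.
Proof.
have Q2 : 2%:R <= Q%:R :> R by rewrite ler_nat Q_ge2.
rewrite /s divr_ge0 ?(ltW lnQ_gt0) //=; last by rewrite ln_ge0 //; lra.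
by rewrite ltr_pdivrMr ?lnQ_gt0 // mul1r ltr_ln ?posrE; lra.
Qed.

Lemma powR_Q : Q%:R `^ s = Q%:R - 2^-1 :> R.
Proof.
have Q2 : 2%:R <= Q%:R :> R by rewrite ler_nat Q_ge2.
rewrite -[RHS]lnK ?posrE; last by lra.
rewrite /powR gt_eqF; last by lra.
by rewrite /s divfK // gt_eqF // lnQ_gt0.
Qed.

Definition rare_from n : set R :=
  [set x | exists w, (forall p, (n <= p)%N -> seg w p (p + B) <> Z) /\ x = fr R w].

(** Cut the words, after n letters, into blocks of the length of Z. Only Q - 1
    blocks differ from Z; hence, up to constants, j blocks give (Q - 1) ^ j sets
    of diameter Q ^ - j, of total cost ((Q - 1) / (Q - 1 / 2)) ^ j. *)
Lemma small_cover_rare_from n e c : 0 < e -> 0 < c -> small_cover s e c (rare_from n).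
Proof.
move=> e0 c0; have /andP[s0 s1] := rare_exp_bounds.
have Q2 : 2%:R <= Q%:R :> R by rewrite ler_nat Q_ge2.
pose rho : R := (Q%:R - 1) / (Q%:R - 2^-1).
have rho1 : 0 < rho < 1.
  by rewrite divr_gt0 ?ltr_pdivrMr /=; lra.
have [j [je jc]] : exists j, (K%:R ^+ (n + B * j))^-1 <= e /\ (K ^ n)%N%:R * rho ^+ j <= c.
  have [m1 H1] := kX_inv_small K1 1 e0.
  have : (fun j => (K ^ n)%N%:R * rho ^+ j : R) @ \oo --> ((K ^ n)%N%:R * 0 : R).
    apply: cvgMl_tmp; apply: cvg_expr; rewrite ger0_norm; case/andP: rho1 => //.
    by move=> /ltW.
  rewrite mulr0 => /cvgrPdist_le /(_ c c0) [m2 _ H2].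
  exists (maxn m1 m2); split.
    rewrite -[leLHS]mul1r ltW // H1 //; have : (m1 <= maxn m1 m2)%N := leq_maxl _ _.
    by move: Z0; rewrite -/B; case: B => // b _; rewrite mulSn; lia.
  have := H2 (maxn m1 m2) (leq_maxr _ _); rewrite sub0r normrN.
  exact: le_trans (ler_norm _).
pose ZT := in_tuple Z.
pose I := (n.-tuple 'I_K * {ffun 'I_j -> {x : B.-tuple 'I_K | x != ZT}})%type.
pose V (i : I) : set R := [set x | exists w, [/\ x = fr R w, seg w 0 n = i.1 &
  forall l : 'I_j, seg w (n + B * l) (n + B * l + B) = val (i.2 l)]].
set r := (K%:R ^+ (n + B * j))^-1 in je *.
have r0 : 0 < r by rewrite invr_gt0 kX_gt0.
have := @content_finite R s e (rare_from n) I V r s0.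
rewrite r0 je => /(_ isT) [||U [d [YU de Ud Uc]]].
- move=> x [w [Hw ->]].
  have tn : size (seg w 0 n) == n by rewrite size_seg subn0.
  have tb (l : 'I_j) : size (seg w (n + B * l) (n + B * l + B)) == B.
    by rewrite size_seg addKn.
  have tZ (l : 'I_j) : Tuple (tb l) != ZT.
    apply/eqP => /(congr1 val) /= E.
    by apply: (Hw (n + B * l)%N); rewrite ?leq_addr.
  exists (Tuple tn, [ffun l => exist _ (Tuple (tb l)) (tZ l)]) => //.
  by exists w; split=> // l; rewrite ffunE.
- move=> i x y [w [-> w1 w2]] [w' [-> w'1 w'2]]; apply: fr_close => p pn.
  have [lt|ge] := ltnP p n.
    by have := congr1 (fun u => nth (w p) u p) (etrans w1 (esym w'1)); rewrite !nth_seg ?subn0.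
  have B0 : (0 < B)%N by [].
  have lj : ((p - n) %/ B < j)%N by rewrite ltn_divLR // ltn_subLR // mulnC.
  have := etrans (w2 (Ordinal lj)) (esym (w'2 (Ordinal lj))) => /=.
  move=> /(congr1 (fun u => nth (w p) u ((p - n) %% B))).
  have pE : (n + B * ((p - n) %/ B) + (p - n) %% B = p)%N.
    by rewrite mulnC -addnA -divn_eq subnKC.
  by rewrite !nth_seg ?addKn ?ltn_mod ?pE.
exists U, d; split=> // N; apply: le_trans (Uc N) _; apply: le_trans jc.
have -> : #|{: I}| = (K ^ n * (Q - 1) ^ j)%N.
  rewrite card_prod card_tuple card_ord card_ffun card_ord; congr (_ * _ ^ _)%N.
  by rewrite card_sig (eq_card (B := predC1 ZT)) // cardC1 card_tuple card_ord subn1.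
rewrite natrM -mulrA ler_wpM2l ?ler0n //.
have -> : r `^ s = ((K%:R ^+ n) `^ s)^-1 * ((Q%:R - 2^-1) ^+ j)^-1.
  have inv (x : R) : 0 <= x -> x^-1 `^ s = (x `^ s)^-1.
    by move=> x0; rewrite -powR_inv1 // powRAC powR_inv1 // powR_ge0.
  have Q0 : 0 <= Q%:R :> R by rewrite ler0n.
  rewrite /r exprD exprM -[K%:R ^+ B]natrX -/Q.
  rewrite inv ?mulr_ge0 ?exprn_ge0 ?ler0n // powRM ?exprn_ge0 ?ler0n // invfM.
  congr (_ * _^-1); rewrite -(powR_mulrn _ Q0) powRAC powR_Q powR_mulrn //.
  by lra.
have h1 : ((K%:R ^+ n) `^ s)^-1 <= 1 :> R.
  have k1 : 1 <= K%:R ^+ n :> R by rewrite exprn_ege1 // ler1n ltnW.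
  rewrite invf_le1 ?powR_gt0 //; last by exact: lt_le_trans ltr01 k1.
  by rewrite -[leLHS](powRr0 (K%:R ^+ n)) ler_powR.
rewrite natrX natrB ?(ltnW Q_ge2) // /rho expr_div_n mulrCA.
rewrite -[leRHS]mul1r ler_wpM2r //.
by rewrite divr_ge0 ?exprn_ge0 //; lra.
Qed.

Lemma rare_measure0 : exists2 t : R, 0 <= t < 1 & forall e c, 0 < e -> 0 < c ->
  small_cover t e c [set x | exists w, rarely Z w /\ x = fr R w].
Proof.
exists s; first exact: rare_exp_bounds.
move=> e c e0 c0; apply: small_cover_sub (small_cover_bigcup c0 _); last first.
  by move=> n c' c'0; exact: small_cover_rare_from.
by move=> x [w [[n Hn] ->]]; exists n => //; exists w.
Qed.

End Rare.

Lemma small_cover_image (R : realType) (s e c : R) (Y : set R) (h : R -> R) :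
  (forall x y, `|h x - h y| <= `|x - y|) -> small_cover s e c Y ->
  small_cover s e c (h @` Y).
Proof.
move=> hl [U [d [YU de Ud Uc]]]; exists (fun n => h @` U n), d; split=> //.
- by move=> _ [x /YU [n _ Ux] <-]; exists n => //; exists x.
- by move=> n _ _ [x Ux <-] [y Uy <-]; apply: le_trans (hl x y) (Ud n x y Ux Uy).
move=> N; apply: le_trans (Uc N); apply: ler_sum => n _; rewrite /cost.
case: asboolP => [[_ [x Ux _]]|_]; first by rewrite ifT //; apply/asboolP; exists x.
by case: ifP => // _; exact: powR_ge0.
Qed.

(** * Constructions of definable sets *)

Section Constructions.
Variables (R : realType) (n : nat) (X : set 'rV[R]_n).

Lemma fo_fam_term F f j : fam X F -> foterm f ->
  (forall (e w : nat -> R) y, f e (upd w j y) = f e w) ->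
  fo X (fun e w => F e (f e w)).
Proof.
move=> fF ff fj.
apply: fo_ext (fo_ex j (fo_and (fo_eq X (foterm_aux R j) ff) (fo_fam j fF))) => e w.
split=> [[y []]|H]; first by rewrite updE eqxx fj => ->.
by exists (f e w); rewrite updE eqxx fj.
Qed.

Lemma definable_not (D : set R) : definable X D -> definable X (~` D).
Proof.
move=> [phi [e ->]]; exists (FNot phi), e; by apply/seteqP; split=> x.
Qed.

Lemma definable_restrict (D : set R) a b :
  definable X D -> definable X [set x | D x /\ a <= x <= b].
Proof.
move=> /definable_fam [F [e [fF ->]]]; have [B FB] := fam_agree fF.
apply/definable_fam; exists (fun e x => F e x /\ e B.+1 <= x <= e B.+2).
exists (upd (upd e B.+1 a) B.+2 b); split.
  apply: fam_fo => [|e' x]; last by rewrite (fam_indep _ _ fF).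
  apply: fo_ext (fo_and (fo_fam 0 fF) (fo_and (fo_le X (foterm_par R B.+1) (foterm_aux R 0))
    (fo_le X (foterm_aux R 0) (foterm_par R B.+2)))) => e' w.
  by split=> [[? []] -> ->|[? /andP[]]].
have -> : F (upd (upd e B.+1 a) B.+2 b) = F e.
  by symmetry; apply: FB => v /andP[_ vB]; rewrite !updE !ltn_eqF //; lia.
by rewrite !updE !eqxx ltn_eqF.
Qed.

Implicit Types F G : (nat -> R) -> set R.

Lemma fam_derived F : fam X F -> fam X (fun e => derived (F e)).
Proof.
move=> fF; apply: fam_fo => [|e x]; last by rewrite (fam_indep _ _ fF).
apply: fo_ext (fo_all 1 (fo_all 2 (fo_imp (fo_lt_aux X 1 0) (fo_imp (fo_lt_aux X 0 2)
  (fo_ex 3 (fo_and (fo_fam 3 fF) (fo_and (fo_not (fo_eq X (foterm_aux R 3) (foterm_aux R 0)))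
     (fo_and (fo_lt_aux X 1 3) (fo_lt_aux X 3 2))))))))) => e w.
by split=> H a b /(H a b) {}H /H [y]; [move=> [? [? []]]|move=> []]; exists y.
Qed.

Lemma fam_oclosure F : fam X F -> fam X (fun e => oclosure (F e)).
Proof.
move=> fF; apply: fam_fo => [|e x]; last by rewrite (fam_indep _ _ fF).
apply: fo_ext (fo_all 1 (fo_all 2 (fo_imp (fo_lt_aux X 1 0) (fo_imp (fo_lt_aux X 0 2)
  (fo_ex 3 (fo_and (fo_fam 3 fF) (fo_and (fo_lt_aux X 1 3) (fo_lt_aux X 3 2)))))))) => e w.
by split=> H a b /(H a b) {}H /H [y]; [move=> [? []]|move=> []]; exists y.
Qed.

Lemma fam_iterD F c : fam X F -> fam X (fun e => iterD c (F e)).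
Proof. by move=> fF; elim: c => // c; exact: fam_derived. Qed.

Lemma fo_subset F G : fam X F -> fam X G -> fo X (fun e w => F e `<=` G e).
Proof. by move=> fF fG; exact: (fo_all 0 (fo_imp (fo_fam 0 fF) (fo_fam 0 fG))). Qed.

Lemma fo_nonempty F : fam X F -> fo X (fun e w => F e !=set0).
Proof. by move=> fF; exact: (fo_ex 0 (fo_fam 0 fF)). Qed.

Lemma fo_codense F : fam X F -> fo X (fun e w => codense (F e)).
Proof.
move=> fF.
apply: fo_ext (fo_all 1 (fo_all 2 (fo_imp (fo_lt_aux X 1 2) (fo_ex 3 (fo_and (fo_lt_aux X 1 3)
  (fo_and (fo_lt_aux X 3 2) (fo_not (fo_fam 3 fF)))))))) => e w.
by split=> H a b /(H a b) [y]; [move=> [? []]|move=> []]; exists y.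
Qed.

(** The left endpoints of the gaps of Y, with the maximum counted as one. *)
Definition right_isolated (Y : set R) : set R :=
  [set x | Y x /\ exists2 y, x < y & forall z, x < z -> z < y -> ~ Y z].

Lemma fam_right_isolated F : fam X F -> fam X (fun e => right_isolated (F e)).
Proof.
move=> fF; apply: fam_fo => [|e x]; last by rewrite (fam_indep _ _ fF).
apply: fo_ext (fo_and (fo_fam 0 fF) (fo_ex 1 (fo_and (fo_lt_aux X 0 1) (fo_all 2 (fo_imp (fo_lt_aux X 0 2)
  (fo_imp (fo_lt_aux X 2 1) (fo_not (fo_fam 2 fF)))))))) => e w.
by split=> -[? [y]]; [move=> []|]; split=> //; exists y.
Qed.

Definition ovr (w p : nat -> R) lo N v := if (lo <= v < lo + N)%N then p v else w v.

(** Quantification over N auxiliary variables at once: the entries of a vector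
    of parameters. *)
Lemma fo_ex_block lo N Q : fo X Q -> fo X (fun e w => exists p, Q e (ovr w p lo N)).
Proof.
elim: N Q => [|N IH] Q fQ.
  apply: fo_ext fQ => e w.
  have E p : ovr w p lo 0 = w.
    by apply/funext => v; rewrite /ovr ifF //; apply/negbTE; lia.
  by split=> [H|[p]]; [exists w|]; rewrite E.
apply: fo_ext (IH _ (fo_ex (lo + N) fQ)) => e w.
have E p x : upd (ovr w p lo N) (lo + N)%N x = ovr w (upd p (lo + N)%N x) lo N.+1.
  apply/funext => v; rewrite /ovr !updE; case: eqP => [->|ne]; first by rewrite ifT //; lia.
  by have -> : (lo <= v < lo + N.+1)%N = (lo <= v < lo + N)%N by lia.
split=> [[p [x H]]|[p H]]; first by exists (upd p (lo + N)%N x); rewrite -E.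
exists p, (p (lo + N)%N); rewrite E.
have -> : upd p (lo + N)%N (p (lo + N)%N) = p by apply/funext => v; rewrite updE; case: eqP => [->|].
by [].
Qed.

Lemma fam_rename F (r : nat -> nat) : injective r -> (forall v, r v != 0)%N ->
  fam X F -> fam X (fun e => F (fun v => e (r v))).
Proof.
move=> ri r0 [phi Hp].
exists (FEx (r 0%N) (FAnd (FEq n (Var (r 0%N)) (Var 0)) (fren r phi))) => e x /=.
have E y : [eta upd e 0%N x with r 0%N |-> y] \o r = upd (fun v => e (r v)) 0%N y.
  apply/funext => v; rewrite /upd /= (inj_eq ri); case: eqP => // _.
  by rewrite (negbTE (r0 v)).
rewrite Hp eqxx eq_sym (negbTE (r0 _)) /=; split.
  by move=> H; exists x; split=> //; rewrite sat_ren // E.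
by move=> [y [->]]; rewrite sat_ren // E.
Qed.

Lemma fo_nwd F : fam X F -> fo X (fun e w => nwd (F e)).
Proof.
move=> fF.
apply: fo_ext (fo_all 1 (fo_all 2 (fo_imp (fo_lt_aux X 1 2) (fo_ex 3 (fo_ex 4 (fo_and (fo_lt_aux X 1 3)
  (fo_and (fo_lt_aux X 3 4) (fo_and (fo_lt_aux X 4 2) (fo_all 5 (fo_imp (fo_lt_aux X 3 5) (fo_imp (fo_lt_aux X 5 4)
    (fo_not (fo_fam 5 fF))))))))))))) => e w.
by split=> H a b /(H a b) [c [d]]; [move=> [? [? []]]|move=> []]; exists c, d.
Qed.

End Constructions.

(** * Dense and codense sets *)
Section DenseCodense.
Variables (R : realType) (k : nat) (hk : (1 < k)%N) (n : nat) (X : set 'rV[R]_n).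
Hypothesis aX : automatic k X.

(** By the dichotomy, in some subinterval the points of the set, or those of its
    complement, have digits that contain a certain word only finitely often.
    These points are dense, so that their box-counting dimension is 1, but their
    Hausdorff dimension is smaller. *)
Lemma dense_codense_dims G (W : nat -> nat -> letter k) m t :
  fam X G -> periodic W m t ->
  (forall u v, 0 <= u -> u < v -> v <= (k%:R ^+ m)^-1 ->
    (exists x, [/\ u < x, x < v & G (env R W) x]) /\
    (exists x, [/\ u < x, x < v & ~ G (env R W) x])) ->
  exists A : set R, [/\ A `<=` `[0, 1]%classic, definable X A &
    exists dB dH : R, [/\ box_dim A dB, hausdorff_dim A dH & dB <> dH]].
Proof.
move=> fG per dc; have [m0 t0 _ _] := per.
have K1 := K_gt1 hk t0; set K := (k ^ t)%N in K1.
have [M [nu nuP]] := pure_cells hk aX fG per.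
have := nuP 0%N; rewrite expn_gt0 ltnW // => /(_ isT) rL.
have [c [Z [Z0 dich]]] := rarely_dichotomy (Ordinal (ltnW K1)) rL.
have [s /andP[s0 s1] small] := rare_measure0 R K1 Z0.
set pc : R := psum R K (fun i => Posz (wcat c (fun=> Ordinal (ltnW K1)) i)) (size c).
have wcE w : fr R (wcat c w) = pc + fr R w / K%:R ^+ size c.
  rewrite fr_wcat //; congr (_ + _); apply: psum_ext => i ic.
  by rewrite /wcat ic; congr Posz; congr nat_of_ord; apply: set_nth_default.
have kx : 0 < k%:R ^+ m :> R := kX_gt0 R hk m.
have Kx : 0 < K%:R ^+ size c :> R := kX_gt0 R K1 _.
pose h x := (pc + x / K%:R ^+ size c) / k%:R ^+ m.
have hw w : h (fr R w) = (0%:R + fr R (wcat c w)) / k%:R ^+ m by rewrite wcE add0r.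
have hmono x y : x < y -> h x < h y.
  by move=> xy; rewrite /h ltr_pM2r ?invr_gt0 // ltrD2l ltr_pM2r ?invr_gt0.
have hlip x y : `|h x - h y| <= `|x - y|.
  have -> : h x - h y = (x - y) / K%:R ^+ size c / k%:R ^+ m by rewrite /h; ring.
  rewrite !norm_divkX // !ler_pdivrMr // -mulrA ler_peMr //.
  by rewrite mulr_ege1 // exprn_ege1 // ler1n ltnW.
have h_onto y : h 0 <= y <= h 1 -> exists2 x, 0 <= x <= 1 & y = h x.
  rewrite /h mul0r addr0 mul1r ler_pdivrMr // ler_pdivlMr // => /andP[y0 y1].
  exists ((y * k%:R ^+ m - pc) * K%:R ^+ size c).
    rewrite mulr_ge0 ?subr_ge0 ?(ltW Kx) //= -ler_pdivlMr // mul1r.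
    by rewrite lerBlDr addrC.
  by rewrite mulfK ?gt_eqF // addrC subrK mulfK // gt_eqF.
have h_cell x : 0 <= x <= 1 -> 0 <= h x <= (k%:R ^+ m)^-1.
  move=> x01; have [w <-] := fr_surj K1 x01; rewrite hw add0r.
  rewrite divr_ge0 ?fr_ge0 ?(ltW kx) //= -[leRHS]mul1r ler_pM2r ?invr_gt0 //.
  exact: fr_le1.
have kx1 : (k%:R ^+ m)^-1 <= 1 :> R.
  by rewrite invf_le1 // exprn_ege1 // ler1n ltnW.
suff main (H : set R) : definable X H ->
    (forall u v, 0 <= u -> u < v -> v <= (k%:R ^+ m)^-1 -> exists x, [/\ u < x, x < v & H x]) ->
    (forall w, H ((0%:R + fr R (wcat c w)) / k%:R ^+ m) -> rarely Z w) ->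
    exists A : set R, [/\ A `<=` `[0, 1]%classic, definable X A &
      exists dB dH : R, [/\ box_dim A dB, hausdorff_dim A dH & dB <> dH]].
  have dG : definable X (G (env R W)) by apply/definable_fam; exists G, (env R W).
  case: dich => thin; [apply: (main (G (env R W)))|apply: (main (~` G (env R W)))] => //.
  - by move=> u v u0 uv vk; case: (dc u v u0 uv vk).
  - exact: definable_not.
  - by move=> u v u0 uv vk; case: (dc u v u0 uv vk).
move=> dH dense thin; pose A := [set x | H x /\ h 0 <= x <= h 1].
have h01 : 0 <= h 0 /\ h 1 <= (k%:R ^+ m)^-1.
  by have := h_cell 0; have := h_cell 1; rewrite !lexx ler01 => /(_ isT) /andP[_ ->] /(_ isT) /andP[->].
have A01 : A `<=` `[0, 1].
  move=> x [_ /andP[x0 x1]]; rewrite /= in_itv /=; case: h01 => h0 h1.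
  by rewrite (le_trans h0 x0) (le_trans x1) // (le_trans h1).
have AZ : A `<=` h @` [set x | exists w, rarely Z w /\ x = fr R w].
  move=> y [Hy /h_onto [x x01 yE]]; have [w wx] := fr_surj K1 x01.
  exists x; last by rewrite yE.
  by exists w; split=> //; apply: thin; rewrite -hw wx -yE.
have m0A : hausdorff_measure s A = 0%E.
  apply: hausdorff_measure_eq0 => // e c' e0 c0.
  by apply: small_cover_sub AZ _; apply: small_cover_image => //; exact: small.
have [d Hd ds] := hausdorff_dim_exists s0 m0A.
exists A; split=> //; first exact: definable_restrict.
exists 1, d; split=> //; last by move=> d1; move: (le_lt_trans ds s1); rewrite -d1 ltxx.
apply: (@box_dim_dense R A (h 0) (h 1)) => //; first by apply: hmono; exact: ltr01.
move=> x x0 x1 a b ax xb.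
have [|||y [ya yb Hy]] := dense (Num.max a (h 0)) (Num.min b (h 1)).
- by rewrite le_max (proj1 h01) orbT.
- by rewrite gt_max !lt_min (lt_trans ax xb) (lt_trans ax x1) (lt_trans x0 xb) (lt_trans x0 x1).
- by rewrite ge_min (proj2 h01) orbT.
move: ya yb; rewrite gt_max lt_min => /andP[ay hy] /andP[yb yh].
by exists y; split=> //; split=> //; rewrite !ltW.
Qed.

(** An interval on which the set is dense and codense is moved to the origin,
    its left end and its length being parameters, before the parameters are
    replaced by periodic ones. *)
Lemma dense_codense_case (D J : set R) : definable X D -> is_interval J ->
  interior J !=set0 -> dense_codense_on J D ->
  exists A : set R, [/\ A `<=` `[0, 1]%classic, definable X A &
    exists dB dH : R, [/\ box_dim A dB, hausdorff_dim A dH & dB <> dH]].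
Proof.
move=> /definable_fam [F [e0 [fF ->]]] _ [x0 /nbhs_oitv [a [b [ax xb abJ]]]] [dJ cJ].
have ab : a < b := lt_trans ax xb.
have [B FB] := fam_agree fF.
pose e := upd (upd (upd e0 B.+1 1) B.+2 a) B.+3 (b - a).
have FE : F e = F e0.
  by apply: FB => v /andP[_ vB]; rewrite /e !updE !ltn_eqF //; lia.
pose G e x := F e (x + e B.+2).
pose Q e := 0 < e B.+3 /\ forall u v, 0 <= u -> u < v -> v <= e B.+3 ->
  (exists x, [/\ u < x, x < v & G e x]) /\ (exists x, [/\ u < x, x < v & ~ G e x]).
have ft : foterm (fun e w : nat -> R => w 0%N + e B.+2).
  exact: foterm_add (foterm_aux R 0) (foterm_par R _).
have fG : fam X G.
  apply: fam_fo => [|e' x]; first exact: (fo_fam_term (j := 1) fF ft).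
  by rewrite /G (fam_indep _ _ fF).
have btw (P : (nat -> R) -> set R) : fo X (fun e w => P e (w 0%N)) ->
    fo X (fun e w => exists x, [/\ w 1%N < x, x < w 2%N & P e x]).
  move=> fP; apply: fo_ext (fo_ex 0 (fo_and (fo_lt_aux X 1 0)
    (fo_and (fo_lt_aux X 0 2) fP))) => e' w.
  by split=> -[x]; [move=> [? []]|move=> []]; exists x.
have sQ : sentence X Q.
  apply: sentence_fo; apply: fo_and.
    exact: fo_gt0 (foterm_par R B.+3).
  have fG0 : fo X (fun e w => G e (w 0%N)) by exact: fo_fam.
  exact: (fo_all 1 (fo_all 2 (fo_imp (fo_ge0 X (foterm_aux R 1)) (fo_imp (fo_lt_aux X 1 2)
     (fo_imp (fo_le X (foterm_aux R 2) (foterm_par R B.+3))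
     (fo_and (btw G fG0) (btw (fun e => ~` G e) (fo_not fG0)))))))).
have Qe : Q e.
  have eE : e B.+2 = a /\ e B.+3 = b - a by rewrite /e !updE !eqxx ltn_eqF.
  rewrite /Q /G (proj1 eE) (proj2 eE) FE; split; first by rewrite subr_gt0.
  move=> u v u0 uv vb; have md : u < (u + v) / 2 < v by rewrite !midf_lt.
  have Jm : J (a + (u + v) / 2) by apply: abJ; lra.
  have := dJ _ Jm; have := cJ _ Jm; rewrite !closureE.
  move=> /(_ (a + u) (a + v)) cm /(_ (a + u) (a + v)) dm; split.
    have [||y [[Dy _] y1 y2]] := dm; try lra.
    by exists (y - a); split; [lra|lra|rewrite subrK].
  have [||y [[Jy Dy] y1 y2]] := cm; try lra.
  by exists (y - a); split; [lra|lra|rewrite subrK].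
have e1 : e B.+1 = 1 by rewrite /e !updE eqxx !ltn_eqF.
have [W [m [t [per [d0 dQ] _]]]] := transfer hk aX sQ Qe e1.
have [m1 Hm1] := kX_inv_small hk 1 d0.
have per' : periodic W (m + t * m1) t.
  have [m0 t0 Wt Wz] := per; split=> //; first by rewrite ltn_addr.
    by move=> i /(leq_trans (leq_addr _ _)) /Wt.
  by move=> i v /(leq_trans (leq_addr _ _)) /Wz.
apply: (dense_codense_dims fG per') => u v u0 uv vk; apply: dQ => //.
apply: le_trans vk _; rewrite -[leLHS]mul1r ltW // Hm1 //.
by have [_ t0 _ _] := per; rewrite (leq_trans (leq_pmull m1 t0)) ?leq_addl.
Qed.

End DenseCodense.

(** * Cantor sets *)

Section Countable.
Variable R : realType.

(** Disjoint intervals to the right of the points contain distinct rationals. *)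
Lemma countable_right_isolated (A : set R) : A `<=` right_isolated A -> countable A.
Proof.
move=> Ai.
have H x : exists q : rat, A x -> x < ratr q /\ forall z, x < z -> z <= ratr q -> ~ A z.
  have [Ax|nA] := pselect (A x); last by exists 0.
  have [_ [y xy Hy]] := Ai x Ax.
  have [q] := rat_in_itvoo xy; rewrite in_itv /= => /andP[xq qy].
  by exists q => _; split=> // z xz zq; apply: Hy => //; exact: le_lt_trans qy.
have [f fP] := choice H.
apply/countable_injP; exists (choice.pickle \o f) => x y /set_mem Ax /set_mem Ay /(pcan_inj choice.pickleK) E.
have [xf xA] := fP x Ax; have [yf yA] := fP y Ay.
have [lt|gt|//] := ltgtP x y.
  by case: (xA y lt) => //; rewrite E ltW.
by case: (yA x gt) => //; rewrite -E ltW.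
Qed.

Lemma right_isolated_sub (Y A : set R) : A `<=` right_isolated Y -> A `<=` Y ->
  A `<=` right_isolated A.
Proof.
move=> AY sY x Ax; split=> //; have [_ [y xy H]] := AY x Ax.
by exists y => // z xz zy /sY; exact: H.
Qed.

(** Between two points of Y lies a point g outside Y, and the last point of Y
    before g is the left endpoint of a gap. *)
Lemma right_isolated_dense (Y : set R) : oclosure Y `<=` Y -> Y `<=` derived Y ->
  codense Y -> Y `<=` oclosure (right_isolated Y).
Proof.
move=> cY pY coY x Yx u v ux xv.
have [y [Yy yx uy yv]] := pY x Yx u v ux xv.
suff main p q : Y p -> u < p -> p < q -> q < v ->
    exists z, [/\ right_isolated Y z, u < z & z < v].
  case: (ltgtP x y) => [lt|gt|E]; last by case: yx.
    exact: (main x y).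
  exact: (main y x).
move=> Yp up pq qv; have [g [pg gq nYg]] := coY p q pq.
pose S := [set z | Y z /\ z < g].
have hS : has_sup S by split; [exists p|exists g => z [_ /ltW]].
have ps : p <= sup S by apply: ub_le_sup => //; case: hS.
have sg : sup S <= g by apply: ge_sup => [|z [_ /ltW]//]; exists p.
have Ys : Y (sup S).
  apply: cY => a b a1 b1; have e0 : 0 < sup S - a by rewrite subr_gt0.
  have [z Sz] := sup_adherent e0 hS; rewrite subKr => az; exists z; split=> //.
    by case: Sz.
  by apply: le_lt_trans b1; apply: ub_le_sup => //; case: hS.
have sg' : sup S < g.
  by rewrite lt_neqAle sg andbT; apply/eqP => E; apply: nYg; rewrite -E.
exists (sup S); split; [|exact: lt_le_trans ps|lra].
split=> //; exists g => // z sz zg Yz; have := ub_le_sup (proj2 hS) (conj Yz zg : S z).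
by rewrite leNgt sz.
Qed.

End Countable.

Section CantorCase.
Variables (R : realType) (k : nat) (hk : (1 < k)%N) (n : nat) (X : set 'rV[R]_n).
Hypothesis aX : automatic k X.

(** The left endpoints of the gaps are dense, hence of the same box-counting
    dimension as the Cantor set, which is positive; but they are countable. *)
Lemma cantor_dims G (W : nat -> nat -> letter k) m t :
  fam X G -> periodic W m t -> let Y := G (env R W) in
  Y `<=` `[0, 1] -> Y !=set0 -> oclosure Y `<=` Y -> Y `<=` derived Y -> codense Y ->
  exists A : set R, [/\ A `<=` `[0, 1]%classic, definable X A &
    exists dB dH : R, [/\ box_dim A dB, hausdorff_dim A dH & dB <> dH]].
Proof.
move=> fG per Y Y01 Y0 cY pY coY; have [m0 t0 _ _] := per.
have ft : fintypes (k ^ m) (k ^ t) Y := periodic_fintypes hk aX fG per Y01.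
have r0 : (0 < k ^ m)%N by rewrite expn_gt0 ltnW.
have [d d0 dP] := perfect_box_dim r0 (K_gt1 hk t0) Y01 ft Y0 pY.
have AY : right_isolated Y `<=` Y by move=> x [].
have dA := right_isolated_dense cY pY coY.
exists (right_isolated Y); split; first exact: subset_trans Y01.
  by apply/definable_fam; exists (fun e => right_isolated (G e)), (env R W); split=> //; exact: fam_right_isolated.
exists d, 0; split; last by move=> E; rewrite E ltxx in d0.
  apply: dP => //; have [x Yx] := Y0.
  have [||z [Az _ _]] := dA x Yx (x - 1) (x + 1); by [lra|lra|exists z].
apply/hausdorff_dim_countable/countable_right_isolated.
exact: (@right_isolated_sub _ Y).
Qed.

(** The Cantor set is cut between two points of its complement at distance less
    than 1 and moved into the unit interval, before the parameters are replaced
    by periodic ones. *)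
Lemma cantor_case (C : set R) : cantor_set C -> definable X C ->
  exists A : set R, [/\ A `<=` `[0, 1]%classic, definable X A &
    exists dB dH : R, [/\ box_dim A dB, hausdorff_dim A dH & dB <> dH]].
Proof.
move=> /cantorP [[y Cy] _ cC pC coC] /definable_fam [F [e0 [fF CE]]].
have [a [ya1 ya Ca]] := coC (y - 2^-1) y (ltac:(lra)).
have [b [yb yb1 Cb]] := coC y (y + 2^-1) (ltac:(lra)).
have [B FB] := fam_agree fF.
pose e := upd (upd (upd e0 B.+1 1) B.+2 a) B.+3 (b - a).
have FE : F e = C.
  by rewrite CE; apply: FB => v /andP[_ vB]; rewrite /e !updE !ltn_eqF //; lia.
have [e1 ea eb] : [/\ e B.+1 = 1, e B.+2 = a & e B.+3 = b - a].
  by rewrite /e !updE !eqxx !ltn_eqF.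
pose G e : set R := [set x | [/\ F e (x + e B.+2), 0 < x & x < e B.+3]].
have fG : fam X G.
  apply: fam_fo => [|e' x]; last by rewrite /G /= (fam_indep _ _ fF).
  have ft := foterm_add (foterm_aux R 0) (foterm_par R B.+2).
  have f0 := fo_gt0 X (foterm_aux R 0).
  have fFt := fo_fam_term (j := 1) fF ft (fun _ _ _ => erefl).
  apply: fo_ext (fo_and fFt (fo_and f0 (fo_lt X (foterm_aux R 0) (foterm_par R B.+3)))) => e' w.
  by split=> [[? []]|[]].
pose Q e := e B.+3 <= e B.+1 /\ (G e !=set0 /\ (oclosure (G e) `<=` G e /\
  (G e `<=` derived (G e) /\ codense (G e)))).
have sQ : sentence X Q.
  apply: sentence_fo; apply: fo_and; first exact: fo_le (foterm_par R _) (foterm_par R _).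
  apply: fo_and; first exact: fo_nonempty.
  apply: fo_and; first by apply: fo_subset => //; exact: fam_oclosure.
  by apply: fo_and; [apply: fo_subset => //; exact: fam_derived|exact: fo_codense].
have GE : G e = [set x | [/\ C (x + a), 0 < x & x < b - a]].
  by rewrite /G FE ea eb.
have Qe : Q e.
  rewrite /Q e1 eb GE; clear GE FE FB e1 ea eb sQ fG CE; split; first by lra.
  split; first by exists (y - a); rewrite /= subrK; split=> //; lra.
  split.
    move=> x Gx.
    have Cx : C (x + a).
      apply: cC => u v ux xv; have [||z [[Cz _ _] z1 z2]] := Gx (u - a) (v - a); [lra|lra|].
      by exists (z + a); split=> //; lra.
    have [x0 x1] : 0 <= x /\ x <= b - a.
      split; rewrite leNgt; apply/negP => lt.
        by have [||z [[_ z0 _] _ z2]] := Gx (x - 1) 0; [lra|lra|lra].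
      by have [||z [[_ _ z0] z2 _]] := Gx (b - a) (x + 1); [lra|lra|lra].
    split=> //; rewrite lt_neqAle ?x0 ?x1 andbT; apply/eqP => E.
      by apply: Ca; rewrite -[a]add0r E.
    by apply: Cb; rewrite (_ : b = x + a) // E; ring.
  split.
    move=> x [Cx x0 x1] u v ux xv.
    have [||z [Cz zx z1 z2]] := pC _ Cx (Num.max a (u + a)) (Num.min b (v + a)) => //.
    - by rewrite gt_max ltrDr x0 ltrD2r.
    - by rewrite lt_min ltrD2r xv andbT; lra.
    move: z1 z2; rewrite gt_max lt_min => /andP[z1 z2] /andP[z3 z4].
    exists (z - a); rewrite /= subrK; split; [|by move=> E; apply: zx; rewrite -E subrK|lra|lra].
    by split=> //; lra.
  move=> u v uv; have [|z [z1 z2 nz]] := coC (u + a) (v + a); first by rewrite ltrD2r.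
  by exists (z - a); split; [lra|lra|rewrite /= subrK => -[]].
have [W [m [t [per [d0 [QY [Qc [Qp Qco]]]] W1]]]] := transfer hk aX sQ Qe e1.
apply: (cantor_dims fG per) => // x [_ x0 x1].
by rewrite /= in_itv /= !ltW // (lt_le_trans x1) // -W1.
Qed.

End CantorCase.

(** * Counting runs without double loops *)

Section Runs.
Variables (D M : finType) (st : (nat -> D) -> nat -> M) (L : (nat -> D) -> Prop) (n0 : nat).
Implicit Types w : nat -> D.

(** Two different loops of the same length at one state of the run. *)
Definition double_loop w w' i j := [/\ (n0 <= i)%N, (i < j)%N, L w & [/\
  st w i = st w j, st w' j = st w j, forall l, (l < i)%N -> w' l = w l &
  exists2 l, (i <= l < j)%N & w' l <> w l]].

Hypothesis st0 : forall w w', st w 0 = st w' 0.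
Hypothesis stS : forall w w' i j, (i <= j)%N -> st w i = st w' i ->
  (forall l, (i <= l < j)%N -> w l = w' l) -> st w j = st w' j.
Hypothesis noloop : forall w w' i j, ~ double_loop w w' i j.

Lemma loop_unique w w' i j : (n0 <= i)%N -> (i <= j)%N -> L w ->
  st w i = st w j -> st w' i = st w i -> st w' j = st w j -> seg w i j = seg w' i j.
Proof.
move=> ni ij Lw wij ii jj; apply: eq_seg => l /andP[il lj].
pose w2 l := if (l < i)%N then w l else w' l.
have w2w : st w2 i = st w i.
  by apply: (stS (leq0n i) (st0 _ _)) => l' /andP[_ l'i]; rewrite /w2 l'i.
have w2j : st w2 j = st w j.
  rewrite -jj; apply: (stS ij); first by rewrite ii.
  by move=> l' /andP[il' _]; rewrite /w2 ltnNge il'.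
have [//|ne] := eqVneq (w l) (w' l); exfalso.
apply: (noloop (w := w) (w' := w2) (i := i) (j := j)); split=> //.
  exact: leq_ltn_trans lj.
split=> //; first by move=> l' l'i; rewrite /w2 l'i.
by exists l; [rewrite il|rewrite /w2 ltnNge il /=; apply/eqP; rewrite eq_sym].
Qed.

(** Induction on the number of states that the run may visit. Between the first
    and the last visit to q the run is a loop, determined by its length j; after
    the letter that follows, it avoids q. The number of segments is thus at most
    1 plus, for each j and each letter, the bound for one state less. *)
Lemma run_segments c (S : {set M}) i q n : (n0 <= i)%N -> (#|S| <= c)%N ->
  exists2 s : seq (seq D), (size s <= (#|D|.+1 * n.+1) ^ c)%N &
    forall w, L w -> st w i = q -> (forall l, (i <= l <= i + n)%N -> st w l \in S) ->
      seg w i (i + n) \in s.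
Proof.
elim: c S i q n => [|c IH] S i q n ni Sc.
  exists [::] => // w Lw wi wS; suff : (0 < #|S|)%N by rewrite ltnNge Sc.
  by apply/card_gt0P; exists (st w i); apply: wS; rewrite leqnn leq_addr.
have [qS|qS] := boolP (q \in S); last first.
  exists [::] => // w Lw wi wS; have := wS i; rewrite leqnn leq_addr => /(_ isT).
  by rewrite wi (negbTE qS).
(* The last visit to q occurs after j letters; the first j letters form a loop. *)
have tail j (a : D) : exists2 s : seq (seq D), (size s <= (#|D|.+1 * n.+1) ^ c)%N &
    (j < n)%N -> forall w, L w -> st w i = q -> st w (i + j) = q -> w (i + j)%N = a ->
      (forall l, (i + j < l <= i + n)%N -> st w l \in S :\ q) -> seg w i (i + n) \in s.
  have [[w0 [Lw0 w0i w0j w0a]]|no] := pselect (exists w0, [/\ L w0, st w0 i = q,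
      st w0 (i + j) = q & w0 (i + j)%N = a]); last first.
    by exists [::] => // _ w Lw wi wj wa; case: no; exists w.
  have [jn|nj] := ltnP j n; last by exists [::].
  have ni' : (n0 <= i + j.+1)%N by rewrite (leq_trans ni) ?leq_addr.
  have Sc' : (#|S :\ q| <= c)%N by move: Sc; rewrite (cardsD1 q S) qS.
  have [s ss sP] := IH (S :\ q) (i + j.+1)%N (st w0 (i + j.+1)) (n - j.+1)%N ni' Sc'.
  exists [seq seg w0 i (i + j.+1) ++ u | u <- s].
    rewrite size_map (leq_trans ss) //; case: (c) => // c'.
    by rewrite leq_exp2r // leq_mul2l ltnS leq_subr orbT.
  move=> _ w Lw wi wj wa wS; rewrite -(@seg_cat _ w i (i + j.+1)) ?leq_add2l ?leq_addr //.
  have aj : seg w i (i + j.+1) = seg w0 i (i + j.+1).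
    rewrite addnS -(@seg_cat _ w i (i + j)) ?leq_addr //.
    rewrite -(@seg_cat _ w0 i (i + j)) ?leq_addr // !seg1 wa w0a; congr (_ ++ _).
    by apply: loop_unique; rewrite ?leq_addr ?wi ?wj ?w0i ?w0j.
  have e : (i + n = (i + j.+1) + (n - j.+1))%N by lia.
  rewrite aj; apply: map_f; rewrite e; apply: sP => //.
    apply: (stS (i := i + j)); rewrite ?leq_add2l ?wj ?w0j // => l /andP[l1 l2].
    suff -> : l = (i + j)%N by rewrite wa w0a.
    by apply/eqP; rewrite eqn_leq l1 andbT -ltnS -addnS.
  by move=> l /andP[l1 l2]; apply: wS; lia.
pose f ja := s2val (cid2 (tail ja.1 ja.2)).
have fS ja : (size (f ja) <= (#|D|.+1 * n.+1) ^ c)%N by rewrite /f; case: cid2.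
have fP j a : (j < n)%N -> forall w, L w -> st w i = q -> st w (i + j) = q ->
    w (i + j)%N = a -> (forall l, (i + j < l <= i + n)%N -> st w l \in S :\ q) ->
    seg w i (i + n) \in f (j, a) by rewrite /f /=; case: cid2.
have [s0 s0S s0P] : exists2 s : seq (seq D), (size s <= 1)%N &
    forall w, L w -> st w i = q -> st w (i + n) = q -> seg w i (i + n) \in s.
  have [[w0 [Lw0 w0i w0n]]|no] := pselect (exists w0, [/\ L w0, st w0 i = q & st w0 (i + n) = q]).
    exists [:: seg w0 i (i + n)] => // w Lw wi wn; rewrite inE; apply/eqP.
    by apply: loop_unique; rewrite ?leq_addr ?wi ?wn ?w0i ?w0n.
  by exists [::] => // w Lw wi wn; case: no; exists w.
pose idx := [seq (j, a) | j <- iota 0 n, a <- enum D].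
exists (s0 ++ flatten [seq f ja | ja <- idx]).
  rewrite size_cat; apply: (@leq_trans (1 + size idx * (#|D|.+1 * n.+1) ^ c)).
    rewrite leq_add // size_flatten /shape -map_comp.
    elim: idx => //= ja idx' IHi; rewrite mulSn leq_add //.
  rewrite size_allpairs size_iota -cardE expnS.
  have : (0 < (#|D|.+1 * n.+1) ^ c)%N by rewrite expn_gt0.
  move: (_ ^ c)%N => P P0; apply: (@leq_trans ((1 + n * #|D|) * P)).
    by rewrite mulnDl mul1n leq_add2r.
  by rewrite leq_mul2r; apply/orP; right; move: #|D| => d; clear; nia.
move=> w Lw wi wS; rewrite mem_cat.
have exj : exists j, (j <= n)%N && (st w (i + j) == q) by exists 0%N; rewrite addn0 wi eqxx.
have bnd j : (j <= n)%N && (st w (i + j) == q) -> (j <= n)%N by case/andP.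
case: (ex_maxnP exj bnd) => j /andP[jn /eqP wj] jmax.
move: jn; rewrite leq_eqVlt => /orP[/eqP E|jn]; first by rewrite s0P // -E.
apply/orP; right; apply/flattenP; exists (f (j, w (i + j)%N)).
  by apply: map_f; apply: allpairs_f; rewrite ?mem_iota ?mem_enum.
apply: fP => // l /andP[l1 l2]; rewrite !inE wS ?andbT; last by rewrite l2 andbT; lia.
apply/eqP => wl; have := jmax (l - i)%N.
have -> : (i + (l - i) = l)%N by lia.
by rewrite wl eqxx andbT => /(_ ltac:(lia)); lia.
Qed.

(** The first n0 letters are arbitrary, and from there on run_segments applies
    to all states together. *)
Lemma few_prefixes n : exists2 s : seq (seq D),
  (size s <= #|D| ^ n0 * #|M| * (#|D|.+1 * n.+1) ^ #|M|)%N &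
  forall w, L w -> seg w 0 (n0 + n) \in s.
Proof.
have H q : exists2 s : seq (seq D), (size s <= (#|D|.+1 * n.+1) ^ #|M|)%N &
    forall w, L w -> st w n0 = q -> seg w n0 (n0 + n) \in s.
  have [|s sS sP] := @run_segments #|M| [set: M] n0 q n (leqnn _); first by rewrite cardsT.
  by exists s => // w Lw wq; apply: sP => // l _; rewrite inE.
pose f q := s2val (cid2 (H q)).
have fS q : (size (f q) <= (#|D|.+1 * n.+1) ^ #|M|)%N by rewrite /f; case: cid2.
have fP q w : L w -> st w n0 = q -> seg w n0 (n0 + n) \in f q by rewrite /f; case: cid2 => s _ /=; exact.
pose idx := [seq (val p, q) | p <- enum {: n0.-tuple D}, q <- enum M].
exists (flatten [seq [seq pq.1 ++ u | u <- f pq.2] | pq <- idx]).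
  apply: (@leq_trans (size idx * (#|D|.+1 * n.+1) ^ #|M|)).
    rewrite size_flatten /shape -map_comp.
    by elim: idx => //= pq idx' IHi; rewrite mulSn leq_add // size_map.
  by rewrite size_allpairs -!cardE card_tuple.
move=> w Lw; rewrite -(@seg_cat _ w 0 n0) ?leq_addr //.
have sz : size (seg w 0 n0) == n0 by rewrite size_seg subn0.
apply/flattenP; exists [seq seg w 0 n0 ++ u | u <- f (st w n0)].
  apply/mapP; exists (seg w 0 n0, st w n0) => //.
  by apply/allpairsP; exists (Tuple sz, st w n0); rewrite !mem_enum.
by apply: map_f; exact: fP.
Qed.

End Runs.

(** * Sets of dimension zero *)

Section Thin.
Variable R : realType.
Implicit Types (Y : set R) (s e c : R).

(** Sets of lower box-counting dimension 0. *)
Definition thin Y := forall s e c, 0 < s -> 0 < e -> 0 < c ->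
  exists e', [/\ 0 < e', e' <= e & cover_number Y e' * e' `^ s <= c].

Lemma thin_hausdorff_dim Y d : bnd Y -> thin Y -> hausdorff_dim Y d -> d = 0.
Proof.
move=> bY tY [d0 dP]; apply/eqP; rewrite eq_le d0 andbT leNgt; apply/negP => dp.
have s0 : 0 < d / 2 by rewrite divr_gt0.
have [/(_ _) H _] := dP _ (ltW s0).
have {}H := H (ltac:(lra)).
suff : hausdorff_measure (d / 2) Y = 0%E by rewrite H.
by apply: hausdorff_measure_box => // [|e c e0 c0]; [exact: ltW|exact: tY].
Qed.

Lemma thin_box_dim Y d : thin Y -> box_dim Y d -> d = 0.
Proof.
move=> tY [Y0 /bndP bY /cvg_at_right0 lim].
have [lt|gt|//] := ltgtP d 0.
  have [e0 e00 He] := lim (- d / 2) (ltac:(lra)).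
  pose e := Num.min (e0 / 2) (2^-1).
  have [e1 e2] : 0 < e /\ e < e0.
    by rewrite /e lt_min gt_min; split; [apply/andP; split; lra|apply/orP; left; lra].
  have e3 : e <= 2^-1 by rewrite /e ge_min lexx orbT.
  have := He e e1 e2; rewrite ler_norml => /andP[h1 h2]; exfalso.
  have : 0 <= ln (cover_number Y e) / ln e^-1.
    rewrite divr_ge0 // ln_ge0 //; first exact: cover_number_ge1.
    by rewrite -(invr1 R) lef_pV2 ?posrE //; lra.
  by lra.
have [e0 e00 He] := lim (d / 2) (ltac:(lra)).
have s0 : 0 < d / 2 by lra.
pose e := Num.min (e0 / 2) (2^-1).
have ep : 0 < e by rewrite /e lt_min; apply/andP; split; lra.
have [e' [e'0 e'e le]] := tY (d / 2) e (2^-1) s0 ep (ltac:(lra)).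
move: e'e; rewrite /e le_min => /andP[h1 h2].
have := He e' e'0 (ltac:(lra)); rewrite ler_norml => /andP[g1 g2]; exfalso.
have c1 := cover_number_ge1 bY e'0 Y0.
have c0 : 0 < cover_number Y e' by exact: lt_le_trans c1.
have l0 : 0 < ln e'^-1.
  by rewrite ln_gt0 // -(invr1 R) ltf_pV2 ?posrE //; lra.
have : d / 2 * ln e'^-1 <= ln (cover_number Y e').
  by rewrite -ler_pdivlMr //; lra.
rewrite lnV ?posrE // mulrN -ln_powR -subr_ge0 opprK -lnM ?posrE ?powR_gt0 //.
move=> h; have : ln (cover_number Y e' * e' `^ (d / 2)) < 0.
  rewrite ln_lt0 //; apply/andP; split; first by rewrite mulr_gt0 ?powR_gt0.
  by apply: le_lt_trans le _; lra.
by lra.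
Qed.

(** Exponentials dominate powers of n. *)
Lemma cover_polynomial_thin k Y C d n0 : (1 < k)%N ->
  (forall n, cover_number Y (k%:R ^+ (n0 + n))^-1 <= C * n.+1%:R ^+ d) -> thin Y.
Proof.
move=> hk H s e c s0 e0 c0.
have k1 : 1 < k%:R :> R by rewrite ltr1n.
pose b := k%:R `^ (s / d.+1%:R).
have d0 : 0 < d.+1%:R :> R by rewrite ltr0n.
have b1 : 1 < b.
  by rewrite /b /powR gt_eqF ?(lt_trans ltr01) // expR_gt1 mulr_gt0 ?ln_gt0 ?divr_gt0.
have bk : b ^+ d.+1 = k%:R `^ s.
  by rewrite -powR_mulrn ?powR_ge0 // /b -powRrM divfK // gt_eqF.
pose C1 := 1 + (b - 1)^-1.
have lin n : n.+1%:R <= C1 * b ^+ n.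
  have bern : 1 + n%:R * (b - 1) <= b ^+ n.
    elim: n => [|n IH]; first by rewrite mul0r addr0 expr0.
    rewrite exprS; have n0' : 0 <= n%:R :> R by rewrite ler0n.
    apply: (@le_trans _ _ (b * (1 + n%:R * (b - 1)))); last by rewrite ler_wpM2l //; lra.
    have := mulr_ge0 n0' (sqr_ge0 (b - 1)); rewrite -natr1; lra.
  have b1' : 0 < b - 1 by lra.
  have i0 : 0 < (b - 1)^-1 by rewrite invr_gt0.
  have n0' : 0 <= n%:R :> R by rewrite ler0n.
  apply: (@le_trans _ _ (C1 * (1 + n%:R * (b - 1)))); last first.
    by rewrite ler_wpM2l // /C1; lra.
  have -> : C1 * (1 + n%:R * (b - 1)) = 1 + n%:R * (b - 1) + (b - 1)^-1 + n%:R.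
    by rewrite /C1; field; rewrite gt_eqF.
  have := mulr_ge0 n0' (ltW b1'); rewrite -natr1; lra.
have C10 : 0 < C1 by rewrite /C1 addr_gt0 // invr_gt0; lra.
have binv : `|b^-1| < 1.
  by rewrite ger0_norm ?invr_ge0 ?powR_ge0 // invf_lt1 // (lt_trans ltr01).
have : (fun n => `|C| * C1 ^+ d * b^-1 ^+ n : R) @ \oo --> (`|C| * C1 ^+ d * 0 : R).
  by apply: cvgMl_tmp; exact: cvg_expr.
rewrite mulr0 => /cvgrPdist_le /(_ c c0) [N1 _ HN1].
have [N2 HN2] := kX_inv_small hk 1 e0.
pose n := maxn N1 N2.
have kx : 0 < k%:R ^+ (n0 + n) :> R := kX_gt0 R hk _.
exists (k%:R ^+ (n0 + n))^-1; split; first by rewrite invr_gt0.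
  by rewrite -[leLHS]mul1r ltW // HN2 // (leq_trans (leq_maxr N1 N2)) ?leq_addl.
have := HN1 n (leq_maxl N1 N2); rewrite sub0r normrN => HN.
apply: le_trans (le_trans (ler_norm _) HN).
have pw : (k%:R ^+ (n0 + n))^-1 `^ s <= (b^-1 ^+ n) ^+ d.+1.
  have -> : (b^-1 ^+ n) ^+ d.+1 = ((k%:R `^ s) ^+ n)^-1.
    by rewrite -exprM mulnC exprM exprVn bk exprVn.
  rewrite -[X in X `^ s]powR_inv1 ?(ltW kx) // powRAC powR_inv1 ?powR_ge0 //.
  rewrite lef_pV2 ?posrE ?powR_gt0 ?exprn_gt0 ?powR_gt0 //; try lra.
  rewrite -(powR_mulrn (n0 + n)) ?ler0n // powRAC powR_mulrn ?powR_ge0 //.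
  apply: ler_weXn2l; last exact: leq_addl.
  by rewrite -[leLHS](powRr0 k%:R) ler_powR // ltW.
have bn0 : 0 < b^-1 ^+ n by rewrite exprn_gt0 // invr_gt0; lra.
have Cn : cover_number Y (k%:R ^+ (n0 + n))^-1 <= `|C| * (C1 * b ^+ n) ^+ d.
  apply: le_trans (H n) _; apply: (@le_trans _ _ (`|C| * n.+1%:R ^+ d)).
    by rewrite ler_wpM2r ?exprn_ge0 ?ler0n // ler_norm.
  by rewrite ler_wpM2l // lerXn2r ?nnegrE ?ler0n // (le_trans _ (lin n)) ?ler0n.
apply: le_trans (ler_pM _ (powR_ge0 _ _) Cn pw) _; first exact: cover_number_ge0.
rewrite le_eqVlt; apply/orP; left; apply/eqP.
rewrite exprMn -!mulrA; congr (_ * (_ * _)).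
rewrite exprS mulrCA -exprMn -exprMn mulfV ?expr1n ?mulr1 // gt_eqF //; lra.
Qed.

Lemma finite_thin Y (s : seq R) : (forall x, Y x -> x \in s) -> thin Y.
Proof.
move=> Ys; apply: (@cover_polynomial_thin 2 Y (size s)%:R 0 0) => // n.
rewrite expr0 mulr1; have e0 : 0 < (2%:R ^+ (0 + n))^-1 :> R by rewrite invr_gt0 exprn_gt0.
have [f fP] := choice (fun x : R => cell_of x e0).
rewrite -(size_map f); apply: cover_number_seq => x /Ys xs.
by exists (f x); case: (fP x) => h1 h2; split=> //; exact: map_f.
Qed.

End Thin.

(** * Definable discrete sets containing a geometric progression *)

Section Rationality.
Variables (R : realType) (k : nat) (hk : (1 < k)%N).

Lemma psum_nat (w : nat -> 'I_k) n :
  exists a : nat, psum R k (fun i => Posz (w i)) n = a%:R / k%:R ^+ n.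
Proof.
elim: n => [|n [a IH]]; first by exists 0%N; rewrite psum0 mul0r.
exists (a * k + w n)%N; rewrite psumS IH natrD natrM exprS -pmulrn; field.
by rewrite (kX_neq0 R hk) gt_eqF // (k_gt0 R hk).
Qed.

(** The periodic part sums to a geometric series. *)
Lemma fr_periodic (w : nat -> 'I_k) n t : (0 < t)%N ->
  (forall l, (n <= l)%N -> w (l + t)%N = w l) ->
  exists g : nat, fr R w = g%:R / (k ^ n * (k ^ t).-1)%N%:R.
Proof.
move=> t0 wt; have [a aE] := psum_nat w n.
pose w' i := w (n + i)%N; have [b bE] := psum_nat w' t.
have K1 : (1 < k ^ t)%N := K_gt1 hk t0.
have e1 : fr R w = (a%:R + fr R w') / k%:R ^+ n := fr_prefix hk aE.
have e2 : fr R w' = (b%:R + fr R w') / k%:R ^+ t.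
  rewrite {1}(fr_prefix hk bE); congr ((_ + fr R _) / _); apply/funext => i.
  by rewrite /w' addnCA addnC wt // leq_addr.
have D0 : (k ^ t).-1%:R != 0 :> R by rewrite pnatr_eq0; lia.
have kE : k%:R ^+ t = (k ^ t).-1%:R + 1 :> R.
  by rewrite -natrX natr1 prednK // ltnW.
have e3 : fr R w' = b%:R / (k ^ t).-1%:R.
  have := congr1 (fun x => x * k%:R ^+ t) e2.
  rewrite mulfVK ?(kX_neq0 R hk) // kE mulrDr mulr1 => /addIr E.
  by rewrite -E mulfK.
exists (a * (k ^ t).-1 + b)%N; rewrite e1 e3 natrD !natrM natrX; field.
by rewrite D0 (kX_neq0 R hk).
Qed.

End Rationality.

Section Progression.
Variables (R : realType) (k : nat) (hk : (1 < k)%N) (n : nat) (X : set 'rV[R]_n).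
Hypothesis aX : automatic k X.

(** A point close to 0 has many zeros as its first digits. By the pigeonhole
    principle two blocks of zeros have the same value, so that zeros may be
    pumped, which divides the point by a fixed power of k. The tail is made
    periodic to have a rational point. *)
Lemma small_points_progression D (W : nat -> nat -> letter k) m t :
  fam X D -> periodic W m t ->
  (forall c, 0 < c -> exists y, [/\ D (env R W) y, 0 < y & y < c]) ->
  exists g d b : nat, [/\ (0 < g)%N, (0 < d)%N, (0 < b)%N &
    forall N, D (env R W) (g%:R / d%:R / k%:R ^+ (b * N))].
Proof.
move=> fD per small; have [m0 t0 _ _] := per.
have K1 := K_gt1 hk t0; set K := (k ^ t)%N in K1.
have [M [nu nuP]] := pure_cells hk aX fD per.
have := nuP 0%N; rewrite expn_gt0 ltnW // => /(_ isT) rL.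
have kx : 0 < k%:R ^+ m :> R := kX_gt0 R hk m.
pose z0 : 'I_K := Ordinal (ltnW K1).
(* More zeros than there are values. *)
pose l := #|M|.+1.
have Kl : 0 < K%:R ^+ l :> R := kX_gt0 R K1 l.
have [|y [Dy y0 yl]] := small ((K%:R ^+ l)^-1 / k%:R ^+ m).
  by rewrite divr_gt0 // invr_gt0.
have [w0 w0E] : exists w : nat -> 'I_K, fr R w = y * k%:R ^+ m * K%:R ^+ l.
  apply: fr_surj => //; rewrite !mulr_ge0 ?(ltW kx) ?(ltW Kl) ?(ltW y0) //=.
  by rewrite -ler_pdivlMr // mul1r -ler_pdivlMr // ltW.
have [i [j [ij jl nuij]]] : exists i j, [/\ (i < j)%N, (j <= l)%N &
    nu (nseq i z0) = nu (nseq j z0)].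
  pose f (x : 'I_l) := nu (nseq x z0).
  have /injectivePn [x [x' xx' fx]] : ~~ injectiveb f.
    by apply/negP => /injectiveP /leq_card; rewrite card_ord ltnn.
  have [lt|gt|E] := ltngtP x x'; last by move: xx'; rewrite (val_inj E) eqxx.
    by exists x, x'; split=> //; exact: ltnW.
  by exists x', x; split=> //; exact: ltnW.
pose b := (j - i)%N.
have nuN N : nu (nseq (i + b * N) z0) = nu (nseq i z0).
  elim: N => [|N IH]; first by rewrite muln0 addn0.
  have -> : (i + b * N.+1 = j + b * N)%N by rewrite mulnS /b; lia.
  rewrite nseqD -[RHS]IH nseqD; apply: rL.1 => //.
have pz N w : psum R K (fun q => Posz (wcat (nseq N z0) w q)) N = 0.
  rewrite /psum big_nat big1 // => q /andP[_ qN].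
  by rewrite /wcat size_nseq qN nth_nseq qN mul0r.
have frz N w : fr R (wcat (nseq N z0) w) = fr R w / K%:R ^+ N.
  by rewrite fr_wcat // size_nseq pz add0r.
pose w1 := wcat (nseq l z0) w0.
have w1E : fr R w1 = y * k%:R ^+ m by rewrite frz w0E mulfK // gt_eqF.
have w1p : 0 < fr R w1 by rewrite w1E mulr_gt0.
have Lw1 : D (env R W) ((0%:R + fr R w1) / k%:R ^+ m).
  by rewrite add0r w1E mulfK // gt_eqF.
have [N1 HN1] := kX_inv_small K1 1 w1p.
have [p [s [pN p0 s0 LU]]] := periodize (maxn N1 l) rL Lw1.
set w2 := looped w1 p s in LU.
have w2p : 0 < fr R w2.
  rewrite (fr_split R K1 w2 p) (@psum_ext R K _ (fun q => Posz (w1 q))); last first.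
    by move=> q qp; rewrite /w2 looped_prefix.
  have := fr_split R K1 w1 p => E.
  have h1 : fr R (fun q => w1 (p + q)%N) / K%:R ^+ p < fr R w1.
    apply: le_lt_trans (HN1 p (leq_trans (leq_maxl _ _) pN)).
    by rewrite ler_divkX // fr_le1.
  have h2 : 0 <= fr R (fun q => w2 (p + q)%N) / K%:R ^+ p.
    by rewrite divr_ge0 ?fr_ge0 // ltW // kX_gt0.
  by move: E h1 h2; lra.
have pre : seg w2 0 i = nseq i z0.
  have -> : seg w2 0 i = seg w1 0 i.
    apply: eq_seg => q /andP[_ qi]; rewrite /w2 looped_prefix //.
    by apply: leq_trans pN; rewrite leq_max; apply/orP; right; lia.
  apply: (@eq_from_nth _ z0); rewrite size_seg ?size_nseq subn0 // => q qi.
  rewrite nth_seg ?subn0 // nth_nseq qi /w1 /wcat add0n size_nseq.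
  by rewrite ifT ?nth_nseq ?ifT //; lia.
pose w3 q := w2 (i + q)%N.
have w2E : w2 = wcat (nseq i z0) w3 by rewrite -pre wcat_seg.
have [g gE] : exists g : nat, fr R w2 = g%:R / (K ^ p * (K ^ s).-1)%N%:R.
  by apply: fr_periodic => // q pq; exact: looped_periodic.
exists g, (K ^ p * (K ^ s).-1 * k ^ m)%N, (t * b)%N.
have Ks := K_gt1 K1 s0.
split.
- by move: w2p; rewrite gE; case: (g) => //; rewrite mul0r ltxx.
- have Kp : (0 < K ^ p)%N by rewrite expn_gt0 ltnW.
  have km : (0 < k ^ m)%N by rewrite expn_gt0 ltnW.
  by rewrite !muln_gt0 Kp km andbT; lia.
- by rewrite muln_gt0 t0 /b subn_gt0.
move=> N; have : D (env R W) ((0%:R + fr R (wcat (nseq (i + b * N) z0) w3)) / k%:R ^+ m).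
  apply: (recognizes_prefix (i := i) (j := i + b * N) rL _ _ LU).
    rewrite pre -(nuN N); congr nu.
    by have := seg_wcat0 (nseq (i + b * N) z0) w3; rewrite size_nseq.
  move=> q; have := wcat_addn (nseq (i + b * N) z0) w3 q; rewrite size_nseq => ->.
  by [].
have w2i : fr R w2 = fr R w3 / K%:R ^+ i by rewrite w2E frz.
have KX : K%:R ^+ (b * N) = k%:R ^+ (t * b * N) :> R by rewrite /K natrX -exprM mulnA.
suff -> : (0%:R + fr R (wcat (nseq (i + b * N) z0) w3)) / k%:R ^+ m =
  g%:R / (K ^ p * (K ^ s).-1 * k ^ m)%N%:R / k%:R ^+ (t * b * N) by [].
rewrite add0r frz exprD invfM mulrA -w2i gE KX; move: (K ^ p * _)%N => d0.
by rewrite natrM natrX invfM mulrA mulrAC.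
Qed.

(** A finite set is thin, and an infinite bounded set has an accumulation point. *)
Lemma infinite_derived (Y : set R) : bnd Y -> ~ thin Y -> derived Y !=set0.
Proof.
move=> bY nt; have [|x Hx] := @infinite_bounded_limit_point_nonempty R Y _ ((bndP Y).1 bY).
  by move=> /finite_seqP [s Ys]; apply: nt; apply: (@finite_thin _ _ s) => x; rewrite Ys.
exists x => a b ax xb; have [|y [/eqP yx Yy /andP[ay yb]]] := Hx [set y | a < y < b].
  by apply/nbhs_oitv; exists a, b; split=> // y ay yb /=; rewrite ay.
by exists y.
Qed.

(** Near an isolated point z of the derived set of a closed set K, the distances
    from z to the other points of K form a discrete set accumulating at 0. *)
Definition distances (K : set R) z r : set R :=
  [set y | [/\ 0 < y, y < r & K (z + y) \/ K (z - y)]].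

Lemma distances_small K z r : derived K z -> 0 < r ->
  forall c, 0 < c -> exists y, [/\ distances K z r y, 0 < y & y < c].
Proof.
move=> Kz r0 c c0; pose d := Num.min r c.
have d0 : 0 < d by rewrite /d lt_min r0.
have [||x [Kx xz x1 x2]] := Kz (z - d) (z + d); [lra|lra|].
have [dr dc] : d <= r /\ d <= c by rewrite /d !ge_min !lexx orbT.
have [lt|gt|//] := ltgtP x z.
  exists (z - x); split; [split|lra|lra]; [lra|lra|right].
  by rewrite subKr.
exists (x - z); split; [split|lra|lra]; [lra|lra|left].
by rewrite addrC subrK.
Qed.

Lemma distances_discrete K z r : (forall x, z - r < x -> x < z + r -> x <> z -> ~ derived K x) ->
  forall y, distances K z r y -> ~ derived (distances K z r) y.
Proof.
move=> H y [y0 yr _] dy.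
have isol x : ~ derived K x -> exists a b, [/\ a < x, x < b & forall x', a < x' -> x' < b -> x' <> x -> ~ K x'].
  move=> /existsNP [a /existsNP [b /not_implyP [ax /not_implyP [xb no]]]].
  by exists a, b; split=> // x' ax' xb' x'x Kx'; apply: no; exists x'.
have n1 : ~ derived K (z + y) by apply: H; [lra|lra|move=> E; lra].
have n2 : ~ derived K (z - y) by apply: H; [lra|lra|move=> E; lra].
have [a [b [az zb Hp]]] := isol _ n1.
have [a' [b' [az' zb' Hm]]] := isol _ n2.
have [||y' [[y'0 y'r Ky'] y'y]] := dy (Num.max (a - z) (z - b')) (Num.min (b - z) (z - a')).
- by rewrite gt_max; apply/andP; split; lra.
- by rewrite lt_min; apply/andP; split; lra.
rewrite gt_max lt_min => /andP[h1 h2] /andP[h3 h4].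
case: Ky'; [apply: Hp|apply: Hm]; [lra|lra|by move=> /addrI|lra|lra|by move=> /addrI /oppr_inj].
Qed.

Lemma discrete_right_isolated (Y : set R) : (forall y, Y y -> ~ derived Y y) ->
  Y `<=` right_isolated Y.
Proof.
move=> H y Yy; split=> //; have := H y Yy.
move=> /existsNP [a /existsNP [b /not_implyP [ay /not_implyP [yb no]]]].
exists b => // z yz zb Yz; apply: no; exists z; split=> //.
  by move=> E; rewrite E ltxx in yz.
exact: lt_trans yz.
Qed.

Lemma fam_distances F i j : fam X F -> (0 < i)%N -> (0 < j)%N ->
  fam X (fun e => distances (F e) (e i) (e j)).
Proof.
move=> fF i0 j0; apply: fam_fo => [|e x]; last first.
  by rewrite (fam_indep _ _ fF) !updE !gtn_eqF.
have f0 := fo_gt0 X (foterm_aux R 0).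
have fp := fo_fam_term (j := 1) fF (foterm_add (foterm_par R i) (foterm_aux R 0)) (fun _ _ _ => erefl).
have fm := fo_ex 1 (fo_and (fo_eq X (foterm_add (foterm_aux R 1) (foterm_aux R 0)) (foterm_par R i)) (fo_fam 1 fF)).
apply: fo_ext (fo_and f0 (fo_and (fo_lt X (foterm_aux R 0) (foterm_par R j)) (fo_or fp fm))) => e w.
rewrite /distances /=; split.
  move=> [? [? [?|[x [E Fx]]]]]; split=> //; [by left|right].
  by rewrite -E addrK.
move=> [? ? [?|Fx]]; split=> //; split=> //; [by left|right].
by exists (e i - w 0%N); rewrite /= subrK.
Qed.

(** The derived set of the closure of A is closed, bounded, nowhere dense and,
    since A is infinite, not empty. It is not a Cantor set, so it has an
    isolated point z, and the distances from z have the two properties that are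
    transferred to periodic parameters. *)
Lemma discrete_progression (A : set R) :
  (~ exists C, cantor_set C /\ definable X C) ->
  definable X A -> bnd A -> nwd A -> ~ thin A ->
  exists D (W : nat -> nat -> letter k) m t, [/\ fam X D, periodic W m t, D (env R W) `<=` right_isolated (D (env R W)) &
    exists g d b : nat, [/\ (0 < g)%N, (0 < d)%N, (0 < b)%N &
      forall N, D (env R W) (g%:R / d%:R / k%:R ^+ (b * N))]].
Proof.
move=> noC /definable_fam [F [e0 [fF AE]]] bA nA nt.
pose K e := oclosure (F e); have fK : fam X K := fam_oclosure fF.
have KA : K e0 = oclosure A by rewrite /K AE.
have cK : oclosure (K e0) `<=` K e0 by exact: oclosure_idem.
have [z [Kz nKz]] : exists z, derived (K e0) z /\ ~ derived (derived (K e0)) z.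
  apply: contrapT => /forallNP H; apply: noC; exists (derived (K e0)).
  have dK : derived (K e0) `<=` K e0.
    by move=> x /derived_oclosure; exact: cK.
  split; last first.
    by apply/definable_fam; exists (fun e => derived (K e)), e0; split=> //; exact: fam_derived.
  apply/cantorP; split.
  - have [x Ax] := infinite_derived bA nt; exists x; apply: derived_sub Ax.
    by rewrite KA; exact: sub_oclosure.
  - by apply: bnd_sub dK _; rewrite KA; exact: bnd_oclosure.
  - exact: derived_closed.
  - by move=> x Kx; apply: contrapT => nx; apply: (H x).
  - by apply: nwd_codense; apply: nwd_sub dK _; rewrite KA; exact: nwd_oclosure.
have [r r0 Hr] : exists2 r, 0 < r & forall x, z - r < x -> x < z + r -> x <> z -> ~ derived (K e0) x.
  move/existsNP: nKz => [a /existsNP [b /not_implyP [az /not_implyP [zb no]]]].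
  have [r [r0 ra rb]] : exists r, [/\ 0 < r, r <= z - a & r <= b - z].
    exists (Num.min (z - a) (b - z)).
    by rewrite lt_min !subr_gt0 az zb !ge_min !lexx orbT.
  exists r => // x x1 x2 xz Kx; apply: no; exists x; split=> //; lra.
have [B FB] := fam_agree fF.
pose e := upd (upd (upd e0 B.+1 1) B.+2 z) B.+3 r.
have KE : K e = K e0.
  by congr oclosure; apply: FB => v /andP[_ vB]; rewrite /e !updE !ltn_eqF //; lia.
have [e1 ez er] : [/\ e B.+1 = 1, e B.+2 = z & e B.+3 = r].
  by rewrite /e !updE !eqxx !ltn_eqF.
pose D e := distances (K e) (e B.+2) (e B.+3).
have fD : fam X D by exact: fam_distances.
pose Q e := (forall y, D e y -> ~ derived (D e) y) /\
  (forall c, 0 < c -> exists y, [/\ D e y, 0 < y & y < c]).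
have sQ : sentence X Q.
  have f0 i := fo_gt0 X (foterm_aux R i).
  apply: sentence_fo; apply: fo_and.
    exact: (fo_all 0 (fo_imp (fo_fam 0 fD) (fo_not (fo_fam 0 (fam_derived fD))))).
  apply: fo_ext (fo_all 0 (fo_imp (f0 0%N) (fo_ex 1 (fo_and (fo_fam 1 fD) (fo_and (f0 1%N)
    (fo_lt X (foterm_aux R 1) (foterm_aux R 0))))))) => e' w.
  by split=> H c /(H c) [y]; [move=> [? []]|move=> []]; exists y.
have Qe : Q e.
  rewrite /Q /D KE ez er; split; first exact: distances_discrete.
  exact: distances_small.
have [W [m [t [per [QD Qs] _]]]] := transfer hk aX sQ Qe e1.
exists D, W, m, t; split=> //; first exact: discrete_right_isolated.
exact: small_points_progression fD per Qs.
Qed.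

End Progression.

(** * Pumping a double loop *)

Section Pump.
Variables (R : realType) (k : nat) (hk : (1 < k)%N).

Lemma psum_inj (w w' : nat -> 'I_k) m :
  psum R k (fun l => Posz (w l)) m = psum R k (fun l => Posz (w' l)) m ->
  forall l, (l < m)%N -> w l = w' l.
Proof.
elim: m => // m IH; rewrite !psumS.
have [a aE] := psum_nat R hk w m; have [a' a'E] := psum_nat R hk w' m.
rewrite aE a'E => E.
have {}E : (a * k + w m = a' * k + w' m)%N.
  apply/eqP; rewrite -(eqr_nat R) !natrD !natrM; apply/eqP.
  have := congr1 (fun x => x * k%:R ^+ m.+1) E; rewrite !mulrDl -!pmulrn.
  rewrite !divfK ?(kX_neq0 R hk) // exprS !mulrA.
  by rewrite ![_ / k%:R ^+ m * k%:R]mulrAC !divfK ?(kX_neq0 R hk).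
have k0 : (0 < k)%N := ltnW hk.
have wE : w m = w' m.
  apply: val_inj => /=; have := congr1 (modn^~ k) E.
  by rewrite !modnMDl !modn_small.
have aa : a = a'.
  by have := congr1 (divn^~ k) E; rewrite !divnMDl // !divn_small // !addn0.
move=> l; rewrite ltnS leq_eqVlt => /orP[/eqP->//|]; apply: IH.
by rewrite aE a'E aa.
Qed.

Definition splice (T : Type) (u w : nat -> T) m j l : T :=
  if (l < m)%N then u l else w (j + (l - m))%N.

Variables (F : (nat -> R) -> set R) (n0 : nat) (W : nat -> nat -> letter k).
Hypothesis Wn0 : forall v, fin_int (fun l => W l v) n0.
Variables (M : finType) (mu : seq (nat -> letter k) -> M) (L : (nat -> nat -> letter k) -> Prop).
Hypothesis rL : recognizes mu L.

(** The digits of the parameters and those of the point are read together; the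
    integer part of the point is 0. *)
Definition join (W : nat -> nat -> letter k) (w : nat -> 'I_k) := updw W 0 (fword hk w).

Hypothesis LF : forall W w, good W -> (L (join W w) <-> F (env R W) (fr R w)).

Definition run w l := mu (seg (join W w) 0 l).

Lemma eq_join W1 W2 w1 w2 l l' : W1 l = W2 l' -> w1 l = w2 l' ->
  join W1 w1 l = join W2 w2 l'.
Proof. by move=> E1 E2; apply/funext => v; rewrite /join /updw /fword E1 E2. Qed.

(** Otherwise the words of F (env R W) have polynomially many prefixes. *)
Lemma double_loop_exists : F (env R W) `<=` `[0, 1] -> ~ thin (F (env R W)) ->
  exists w w' i j, double_loop run (fun w => L (join W w)) n0 w w' i j.
Proof.
move=> F01 nt; apply: contrapT => no; apply: nt.
have gW : good W by exists n0.
apply: (@cover_polynomial_thin _ _ _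
  (#|'I_k| ^ n0 * #|M| * #|'I_k|.+1 ^ #|M|)%N%:R #|M| n0 hk) => N.
have [|||s ss sP] := @few_prefixes _ _ run (fun w => L (join W w)) n0 _ _ _ N.
- by move=> w w'; rewrite /run !seg_nil.
- move=> w w' i j ij wi ww'; rewrite /run.
  rewrite -(@seg_cat _ (join W w) 0 i) // -(@seg_cat _ (join W w') 0 i) //.
  apply: rL.1 => //; congr mu; apply: eq_seg => l lij.
  by apply: eq_join => //; exact: ww'.
- by move=> w w' i j H; apply: no; exists w, w', i, j.
set m := (n0 + N)%N in s ss sP *.
have k0 : (0 < k)%N := ltnW hk.
have km : 0 < k%:R ^+ m :> R := kX_gt0 R hk m.
have [f fP] := choice (fun p : seq 'I_k => psum_nat R hk (nth (Ordinal k0) p) m).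
apply: (@le_trans _ _ (size s)%:R).
  rewrite -(size_map (fun p => Posz (f p))); apply: cover_number_seq => x Fx.
  have x01 : 0 <= x <= 1 by have := F01 x Fx; rewrite /= in_itv.
  have [w wx] := fr_surj hk x01.
  exists (Posz (f (seg w 0 m))).
  rewrite map_f; last by apply: sP; apply/LF => //; rewrite wx.
  have E : psum R k (fun i => Posz (w i)) m = (f (seg w 0 m))%:R / k%:R ^+ m.
    rewrite -fP; apply: psum_ext => i im; rewrite nth_seg ?subn0 //.
  rewrite -wx (fr_prefix hk E) intrD !ler_pM2r ?invr_gt0 // -!pmulrn.
  by split=> //; [rewrite lerDl fr_ge0|rewrite lerD2l fr_le1].
rewrite -natrX -natrM ler_nat; apply: leq_trans ss _.
by rewrite expnMn !mulnA.
Qed.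

Section Loop.
Variables (w w' : nat -> 'I_k) (i j : nat).
Hypothesis dl : double_loop run (fun w => L (join W w)) n0 w w' i j.
Let h := (j - i)%N.

Lemma h_gt0 : (0 < h)%N.
Proof. by case: dl => _ ij _ _; rewrite subn_gt0. Qed.

(** The tails of W and w beyond the loops are made ultimately periodic, which
    makes the parameters W1 and Ws rational multiples of powers of k apart. *)
Variables (nn tt : nat).
Hypotheses (jnn : (j <= nn)%N) (tt0 : (0 < tt)%N).
Let W1 := looped W nn tt.
Let w1 := looped w nn tt.
Hypothesis L1 : L (join W1 w1).
Let Ws := looped W1 i h.

(** The sequence b chooses, turn after turn, which of the two loops is run
    through. *)
Definition branch (b : nat -> bool) l :=
  if (l < i)%N then w1 l
  else (if b ((l - i) %/ h)%N then w' else w1) (i + (l - i) %% h)%N.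

Lemma W1_prefix l : (l < j)%N -> W1 l = W l.
Proof. by move=> lj; rewrite /W1 looped_prefix // (leq_trans lj). Qed.

Lemma w1_prefix l : (l < j)%N -> w1 l = w l.
Proof. by move=> lj; rewrite /w1 looped_prefix // (leq_trans lj). Qed.

Lemma block_index N l : (l < h)%N ->
  ((i + h * N + l - i) %/ h = N)%N /\ ((i + h * N + l - i) %% h = l)%N.
Proof.
move=> lh; have h0 := h_gt0.
have -> : (i + h * N + l - i = N * h + l)%N by rewrite mulnC; lia.
by rewrite divnMDl // modnMDl divn_small // modn_small // addn0.
Qed.

Lemma Ws_block N l : (l < h)%N -> Ws (i + h * N + l)%N = W (i + l)%N.
Proof.
move=> lh; rewrite /Ws /looped ifF; last by apply/negbTE; lia.
have [_ ->] := block_index N lh; apply: W1_prefix.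
by move: lh; rewrite /h; lia.
Qed.

Lemma branch_block b N l : (l < h)%N ->
  branch b (i + h * N + l)%N = (if b N then w' else w) (i + l)%N.
Proof.
move=> lh; rewrite /branch ifF; last by apply/negbTE; lia.
have [-> ->] := block_index N lh; case: (b N) => //; apply: w1_prefix.
by move: lh; rewrite /h; lia.
Qed.

Lemma run_branch b N : mu (seg (join Ws (branch b)) 0 (i + h * N)) = run w i.
Proof.
have [ni ij _ [wij wj ww' _]] := dl.
elim: N => [|N IH].
  rewrite muln0 addn0 /run; congr mu; apply: eq_seg => l /andP[_ li].
  have lj : (l < j)%N := ltn_trans li ij.
  by apply: eq_join; [rewrite /Ws looped_prefix // W1_prefix|rewrite /branch li w1_prefix].
rewrite mulnS addnCA addnC -(@seg_cat _ _ 0 (i + h * N)) ?leq_addr //.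
pose wb := if b N then w' else w.
have wbE : run wb i = run w i /\ run wb j = run w i.
  rewrite /wb; case: (b N); last by rewrite wij.
  split; last by rewrite wj wij.
  by rewrite /run; congr mu; apply: eq_seg => l /andP[_ li]; apply: eq_join => //; exact: ww'.
rewrite -(proj2 wbE) /run -(@seg_cat _ (join W wb) 0 i j) ?(ltnW ij) //.
apply: rL.1; first by rewrite IH -(proj1 wbE).
congr mu; rewrite (@eq_seg_shift _ _ (join W wb) _ _ i).
  by congr seg; move: ij; rewrite /h; lia.
move=> l; rewrite addKn => lh; apply: eq_join; first exact: Ws_block.
by rewrite branch_block // /wb; case: (b N).
Qed.

Lemma W1_fin v : fin_int (fun l => W1 l v) n0.
Proof.
have [ni ij _ _] := dl; move=> l nl.
have [lt|ge] := ltnP l nn; first by rewrite /W1 looped_prefix //; exact: Wn0.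
have [l' l'n E] := looped_suffix W tt ge; rewrite /W1 E; apply: Wn0; lia.
Qed.

Lemma Ws_fin v : fin_int (fun l => Ws l v) n0.
Proof.
have [ni ij _ _] := dl; move=> l nl.
have [lt|ge] := ltnP l i; first by rewrite /Ws looped_prefix //; exact: W1_fin.
have [l' l'n E] := looped_suffix W1 h ge; rewrite /Ws E; apply: W1_fin; lia.
Qed.

(** The loop is run through N times, by the parameters as well as by the point,
    before both continue with a tail that is accepted. *)
Lemma pump_branch b N :
  F (env R (splice Ws W1 (i + h * N) j)) (fr R (splice (branch b) w1 (i + h * N) j)).
Proof.
have [ni ij _ [wij wj ww' _]] := dl.
have gS : good (splice Ws W1 (i + h * N) j).
  exists n0 => v l nl; rewrite /splice; case: ifP => _; first exact: Ws_fin.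
  by apply: W1_fin; lia.
apply/LF => //; apply: (recognizes_prefix (i := j) (j := i + h * N) rL _ _ L1).
  transitivity (run w i).
    rewrite wij /run; congr mu; apply: eq_seg => l /andP[_ lj].
    by apply: eq_join; [exact: W1_prefix|exact: w1_prefix].
  rewrite -(run_branch b N); congr mu; apply: eq_seg => l /andP[_ lt].
  by apply: eq_join; rewrite /splice lt.
move=> l; apply/funext => v; rewrite /join /updw /fword /splice.
by rewrite ltnNge leq_addr /= addKn.
Qed.

(** The parameters agree up to place i + h N, and continue there with two words
    that do not depend on N and are ultimately periodic, hence denote rationals. *)
Lemma env_splice : exists (J : nat) (a : nat -> int), (0 < J)%N /\ forall N v,
  env R (splice Ws W1 (i + h * N) j) v =
  env R Ws v + (a v)%:~R / J%:R / k%:R ^+ (h * N).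
Proof.
have [ni ij _ _] := dl; have h0 := h_gt0.
pose tau v l := (W1 (j + l)%N v).2; pose sig v l := (Ws (i + l)%N v).2.
have tauP v : exists g : nat, fr R (tau v) = g%:R / (k ^ nn * (k ^ tt).-1)%N%:R.
  apply: fr_periodic => // l nl; rewrite /tau addnA /W1 looped_periodic //.
  exact: leq_trans nl (leq_addl _ _).
have sigP v : exists g : nat, fr R (sig v) = g%:R / (k ^ 0 * (k ^ h).-1)%N%:R.
  apply: fr_periodic => // l _; rewrite /sig addnA /Ws looped_periodic //.
  exact: leq_addr.
have [g1 g1P] := choice tauP; have [g2 g2P] := choice sigP.
set d1 := (k ^ nn * (k ^ tt).-1)%N in g1P; set d2 := (k ^ 0 * (k ^ h).-1)%N in g2P.
have k0 : (0 < k)%N := ltnW hk.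
have d10 : (0 < d1)%N.
  by rewrite muln_gt0 expn_gt0 k0 /=; have := K_gt1 hk tt0; lia.
have d20 : (0 < d2)%N.
  by rewrite /d2 expn0 mul1n; have := K_gt1 hk h0; lia.
exists (k ^ i * (d1 * d2))%N, (fun v => (g1 v * d2)%N%:Z - (g2 v * d1)%N%:Z).
clearbody d1 d2.
split; first by rewrite !muln_gt0 expn_gt0 k0 d10 d20.
move=> N v; set m := (i + h * N)%N.
have sf : fin_int (fun l => splice Ws W1 m j l v) i.
  move=> l il; rewrite /splice; case: ifP => _; first by apply: Ws_fin; lia.
  by apply: W1_fin; lia.
have wf : fin_int (fun l => Ws l v) i by move=> l il; apply: Ws_fin; lia.
rewrite /env (wvalE R sf) (wvalE R wf) -addrA; congr (_ + _).
  congr (_%:~R); rewrite /ipart; apply: eq_big_nat => l /andP[_ li].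
  by rewrite /= /splice ifT //; rewrite /m; lia.
rewrite -[frac R k _]/(fr R (fun l => (splice Ws W1 m j l v).2)).
rewrite -[in RHS]/(fr R (fun l => (Ws l v).2)).
rewrite (fr_split R hk _ m) (fr_split R hk (fun l => (Ws l v).2) m) -addrA.
congr (_ + _); first by apply: psum_ext => l lm; rewrite /splice lm.
have -> : (fun l => (splice Ws W1 m j (m + l) v).2) = tau v.
  by apply/funext => l; rewrite /splice ltnNge leq_addr /= addKn.
have -> : (fun l => (Ws (m + l)%N v).2) = sig v.
  apply/funext => l; rewrite /sig /Ws /looped !ifF; [|by apply/negbTE; rewrite /m; lia..].
  by rewrite addKn /m -addnA addKn mulnC modnMDl.
rewrite g1P g2P intrD intrN -!pmulrn !natrM natrX /m exprD; field.
rewrite !pnatr_eq0 !expf_neq0 ?(gt_eqF (k_gt0 R hk)) //=; lia.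
Qed.

Lemma branch_close b N : `|fr R (branch b) - fr R (splice (branch b) w1 (i + h * N) j)|
  <= (k%:R ^+ (h * N))^-1.
Proof.
apply: le_trans (@fr_close R k hk _ _ (h * N) _) _ => // l lh.
by rewrite /splice ifT // (leq_trans lh) // leq_addl.
Qed.

Definition branches : set R := [set fr R (branch b) | b in setT].

(** Changing one entry of b replaces one block of digits by another and keeps
    all other digits, which moves the point slightly. Expansions are not unique,
    but two different blocks of the same length do denote different numbers. *)
Lemma branches_perfect : branches `<=` derived branches.
Proof.
have [ni ij _ [_ _ _ [l0 /andP[il0 l0j] w'w]]] := dl; have h0 := h_gt0.
move=> _ [b _ <-] u v ux xv.
have [e [e0 ue ve]] : exists e, [/\ 0 < e, u + e <= fr R (branch b) & fr R (branch b) + e <= v].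
  exists (Num.min (fr R (branch b) - u) (v - fr R (branch b))).
  have h1 : Num.min (fr R (branch b) - u) (v - fr R (branch b)) <= fr R (branch b) - u.
    by rewrite ge_min lexx.
  have h2 : Num.min (fr R (branch b) - u) (v - fr R (branch b)) <= v - fr R (branch b).
    by rewrite ge_min lexx orbT.
  by split; [rewrite lt_min !subr_gt0 ux|lra|lra].
have [N HN] := kX_inv_small hk 1 e0.
pose b' N' := if N' == N then ~~ b N else b N'.
have far l : (l < i + h * N)%N || (i + h * N + h <= l)%N -> branch b l = branch b' l.
  rewrite /branch; case: ifP => // /negbT; rewrite -leqNgt => il H.
  rewrite /b'; suff -> : ((l - i) %/ h == N)%N = false by [].
  apply/negP => /eqP E.
  have := divn_eq (l - i) h; have := ltn_mod (l - i) h; rewrite E h0 mulnC.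
  by move: H; case/orP; lia.
exists (fr R (branch b')); split; first by exists b'.
- rewrite (fr_split R hk (branch b) (i + h * N + h)) (fr_split R hk (branch b') (i + h * N + h)).
  have -> : (fun l => branch b' (i + h * N + h + l)%N) = (fun l => branch b (i + h * N + h + l)%N).
    by apply/funext => l; rewrite far // leq_addr orbT.
  rewrite !(psum_cat _ _ _ (i + h * N) h) (@psum_ext R k (fun l => Posz (branch b' l)) (fun l => Posz (branch b l))); last first.
    by move=> l lt; rewrite far // lt.
  move=> /addIr /addrI /(congr1 (fun x => x * k%:R ^+ (i + h * N))).
  rewrite !divfK ?(kX_neq0 R hk) // => /psum_inj E.
  have lh : (l0 - i < h)%N by rewrite /h; lia.
  have := E _ lh; rewrite !branch_block // /b' eqxx subnKC //.
  by case: (b N) => /= E'; apply: w'w; rewrite E'.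
all: have := @fr_close R k hk (branch b) (branch b') N _.
all: have := HN N (leqnn N); rewrite mul1r ler_norml => HN' /(_ _)/andP[].
all: try by move=> l lN; apply: far; apply/orP; left; apply: leq_trans lN _; nia.
all: by lra.
Qed.

End Loop.
End Pump.

(** * A definable Cantor set *)

Section Union.
Variables (R : realType) (n : nat) (X : set 'rV[R]_n).
Variables (F D : (nat -> R) -> set R) (B c : nat) (J d : nat) (ap an : nat -> nat).
Hypotheses (fF : fam X F) (fD : fam X D) (c0 : (0 < c)%N).
Hypothesis FB : forall e e', (forall v, (0 < v < B)%N -> e v = e' v) -> F e = F e'.

(** The even entries of e are a vector q and the odd ones parameters for D. The
    equations express that p = q + (ap - an) / J.+1 * y without using division
    nor subtraction. *)
Definition on_line (e p : nat -> R) y v :=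
  p v *+ J.+1 + y *+ (an v).+1 = e v.*2 *+ J.+1 + y *+ (ap v).+1.

Definition line_union (e : nat -> R) : set R := [set x | [/\ 0 <= x, x <= e c.*2 &
  exists y p, [/\ D (fun v => e v.*2.+1) y, forall v, (v < B)%N -> on_line e p y v.+1 & F p x]]].

Lemma fam_line_union : fam X line_union.
Proof.
pose D' e := D (fun v => e v.*2.+1).
have fD' : fam X D'.
  by apply: (@fam_rename _ _ _ D (fun v => v.*2.+1)) => // u v; lia.
apply: fam_fo => [|e x]; last first.
  by rewrite /line_union /= !updE gtn_eqF ?double_gt0 //.
have f0 := fo_ge0 X (foterm_aux R 0).
have fl v : fo X (fun e w => on_line e (fun v => w (2 + v)%N) (w 1%N) v.+1).
  exact (fo_eq X (foterm_add (foterm_muln J (foterm_aux R (2 + v.+1)))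
                             (foterm_muln _ (foterm_aux R 1)))
                 (foterm_add (foterm_muln J (foterm_par R (v.+1).*2))
                             (foterm_muln _ (foterm_aux R 1)))).
have fQ := fo_and (fo_fam 1 fD') (fo_and (fo_all_lt B fl) (fo_and (fo_fam_shift 2 fF)
  (fo_eq X (foterm_aux R 2) (foterm_aux R 0)))).
apply: fo_ext (fo_and f0 (fo_and (fo_le X (foterm_aux R 0) (foterm_par R c.*2))
  (fo_ex 1 (fo_ex_block 2 B.+1 fQ)))) => e w; split.
  move=> [x0 [x1 [y [p [Dy [on [Fp E]]]]]]]; split=> //.
  exists y, (fun v => ovr (upd w 1%N y) p 2 B.+1 (2 + v)%N); split=> //.
  by move: E Fp; rewrite /= => ->.
move=> [x0 x1 [y [p [Dy on Fp]]]]; split=> //; split=> //; exists y.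
pose q v := if v == 2 then w 0%N else p (v - 2)%N; exists q; split; first exact: Dy.
have oE v : (0 < v <= B)%N -> ovr (upd w 1%N y) q 2 B.+1 (2 + v)%N = p v.
  by move=> vB; rewrite /ovr /q ifT ?ifF ?addKn //; lia.
have o0 : ovr (upd w 1%N y) q 2 B.+1 2 = w 0%N by [].
split; first by move=> v vB; have := on v vB; rewrite /on_line oE ?ltnS.
split; last exact: o0.
rewrite o0 (FB (e' := p)) // => v /andP[v0 vB]; apply: oE; lia.
Qed.

Hypothesis Fnwd : forall e, nwd (F e).

(** D is countable, so this is a countable union of nowhere dense sets. *)
Lemma line_union_codense e : countable (D (fun v => e v.*2.+1)) -> codense (line_union e).
Proof.
move=> /countable_injP [f fI]; set D0 := D _ in fI.
pose p y v := e v.*2 + ((ap v)%:R - (an v)%:R) * y / J.+1%:R.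
pose T i : set R := [set x | exists y, [/\ D0 y, f y = i & F (p y) x]].
have nT i : nwd (T i).
  have [[y0 [Dy0 fy0]]|no] := pselect (exists y, D0 y /\ f y = i).
    apply: (@nwd_sub _ _ (F (p y0))) => // x [y [Dy fy]].
    by have -> : y = y0 by apply: fI; rewrite ?inE ?fy.
  by apply: (@nwd_sub _ _ (F (p 0))) => // x [y [Dy fy _]]; case: no; exists y.
move=> a b ab; have [x [ax xb nx]] := meager_codense nT ab.
exists x; split=> // -[_ _ [y [q [Dy on Fq]]]]; apply: nx; exists (f y) => //.
exists y; split=> //; rewrite (@FB _ q) // => v /andP[v0 vB].
have := on v.-1; rewrite prednK // => /(_ ltac:(lia)); rewrite /on_line /p => E.
have J0 : J.+1%:R != 0 :> R by rewrite pnatr_eq0.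
apply: (mulIf J0); rewrite mulrDl divfK //.
move: E; rewrite -(mulr_natl (q v)) -(mulr_natl (e v.*2)).
rewrite -(mulr_natl y (an v).+1) -(mulr_natl y (ap v).+1) -[(an v).+1%:R]natr1 -[(ap v).+1%:R]natr1 => E.
lra.
Qed.

End Union.

Section Contradiction.
Variables (R : realType) (k : nat) (hk : (1 < k)%N) (n : nat) (X : set 'rV[R]_n).
Hypothesis aX : automatic k X.

Definition interleave (T : Type) (V V' : nat -> nat -> T) l v :=
  if odd v then V' l v./2 else V l v./2.

Lemma periodic_interleave (V V' : nat -> nat -> letter k) m t m' t' :
  periodic V m t -> periodic V' m' t' ->
  periodic (interleave V V') (maxn m m') (t * t').
Proof.
move=> pV pV'; have [m0 t0 _ Vz] := pV; have [m'0 t'0 _ V'z] := pV'.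
split; [by rewrite leq_max m0|by rewrite muln_gt0 t0| |].
  move=> l; rewrite geq_max => /andP[ml m'l]; apply/funext => v; rewrite /interleave.
  rewrite -(subnKC ml) (periodic_mul pV) subnKC //.
  by rewrite -(subnKC m'l) mulnC (periodic_mul pV').
move=> l v; rewrite geq_max => /andP[ml m'l]; rewrite /interleave.
by case: ifP => _; [exact: V'z|exact: Vz].
Qed.

Lemma env_interleave (V V' : nat -> nat -> letter k) v :
  env R (interleave V V') v.*2 = env R V v /\
  env R (interleave V V') v.*2.+1 = env R V' v.
Proof.
split; rewrite /env; congr wval; apply/funext => l; rewrite /interleave /=.
  by rewrite odd_double doubleK.
by rewrite odd_double /= uphalf_double.
Qed.

(** The closure of S has finitely many types of cells, hence taking derived sets
    becomes stationary after finitely many steps. The perfect set thus obtained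
    contains P and is not empty. *)
Lemma cantor_of_perfect_subset (S : (nat -> R) -> set R) (W : nat -> nat -> letter k) m t
    (P : set R) :
  fam X S -> periodic W m t -> S (env R W) `<=` `[0, 1] -> nwd (S (env R W)) ->
  P !=set0 -> P `<=` derived P -> P `<=` oclosure (S (env R W)) ->
  exists C, cantor_set C /\ definable X C.
Proof.
move=> fS per S01 nS P0 dP PS.
pose Y e := oclosure (S e); have fY : fam X Y := fam_oclosure fS.
have Y01 : Y (env R W) `<=` `[0, 1].
  move=> x Yx; rewrite /= in_itv /=; apply/andP; split; rewrite leNgt; apply/negP => lt.
    have [||y [Sy _ y0]] := Yx (x - 1) 0; [lra|lra|].
    by have := S01 y Sy; rewrite /= in_itv /= => /andP[]; lra.
  have [||y [Sy y0 _]] := Yx 1 (x + 1); [lra|lra|].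
  by have := S01 y Sy; rewrite /= in_itv /= => /andP[]; lra.
have [m0 t0 _ _] := per.
have cY : oclosure (Y (env R W)) `<=` Y (env R W) by exact: oclosure_idem.
have rm : (0 < k ^ m)%N by rewrite expn_gt0 ltnW.
have [c Ec] := fintypes_iterD_stable rm (K_gt1 hk t0) cY (periodic_fintypes hk aX fY per Y01).
exists (iterD c (Y (env R W))); split; last first.
  by apply/definable_fam; exists (fun e => iterD c (Y e)), (env R W); split=> //; exact: fam_iterD.
have sub : iterD c (Y (env R W)) `<=` Y (env R W) by exact: (@iterD_le _ 0 c).
apply/cantorP; split.
- have [x Px] := P0; exists x; exact: (perfect_iterD c dP PS).
- exact: bnd_unit (subset_trans sub Y01).
- exact: iterD_closed.
- by rewrite -iterDS -Ec.
- by apply: nwd_codense; apply: nwd_sub sub _; exact: nwd_oclosure.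
Qed.

Lemma oneword_pos l l' : (0 < l)%N -> (0 < l')%N -> oneword hk l = oneword hk l'.
Proof. by rewrite /oneword; case: l; case: l'. Qed.

(** Otherwise pumping a double loop gives a perfect set in the closure of a
    definable nowhere dense set. *)
Lemma nwd_definable_thin (A : set R) :
  (~ exists C, cantor_set C /\ definable X C) ->
  (~ exists D, definable X D /\ exists J : set R,
     [/\ is_interval J, interior J !=set0 & dense_codense_on J D]) ->
  definable X A -> A `<=` `[0, 1] -> nwd A -> thin A.
Proof.
move=> noC noD dA A01 nA; apply: contrapT => nt.
have bA : bnd A := bnd_unit A01.
have [D [W2 [m2 [t2 [fD per2 Di [g [d [b [g0 d0 b0 Dp]]]]]]]]] :=
  discrete_progression hk aX noC dA bA nA nt.
have [F0 [e0 [fF0 AE]]] := (definable_fam X A).1 dA.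
(* For all parameters, and not just for those of A, the set is nowhere dense. *)
pose F e : set R := [set x | F0 e x /\ nwd (F0 e)].
have fF : fam X F.
  apply: fam_fo => [|e x]; first exact: fo_and (fo_fam 0 fF0) (fo_nwd fF0).
  by rewrite /F /= (fam_indep _ _ fF0).
have FA : F e0 = A.
  by apply/seteqP; split=> x; rewrite /F /= -AE; [case|split].
have Fnwd e : nwd (F e).
  have [nF|nF] := pselect (nwd (F0 e)); first by apply: nwd_sub nF => x [].
  by apply: nwd_sub nA => x [].
have [B FB] := fam_agree fF; pose c := B.+1.
have [W0 [gW0 W0E]] : exists W : nat -> nat -> letter k, good W /\
    env R W = fun v => if (v < B)%N then e0 v else 0.
  by apply: (env_surj hk (b := B)) => v vb; rewrite ltnNge vb.
(* The fresh parameter c is set to 1, to restrict S to the unit interval. *)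
pose W := updw W0 c (oneword hk).
have [n1 Wn1] : good W by exact: good_updw gW0 (fin_oneword hk).
pose n0 := n1.+1.
have Wn0 v : fin_int (fun l => W l v) n0 by move=> l /ltnW; exact: Wn1.
have FW : F (env R W) = A.
  rewrite -FA; apply: FB => v /andP[_ vB].
  by rewrite /W env_updw /= W0E vB ltn_eqF // /c ltnW.
have [phi Hphi] := fF.
have [L [[M [mu rmu]] LP]] := rep_sat hk phi aX.
have LF V w : good V -> L (join hk V w) <-> F (env R V) (fr R w).
  move=> gV; rewrite LP; last by apply: good_updw (_ : fin_int _ 0).
  by rewrite Hphi /join env_updw val_fword.
have [||w [w' [i [j dl]]]] := double_loop_exists Wn0 rmu LF; [by rewrite FW|by rewrite FW|].
have [ni ij Lw _] := dl.
have [nn [tt [jn nn0 tt0 LU]]] := periodize j rmu Lw.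
have L1 : L (join hk (looped W nn tt) (looped w nn tt)).
  congr L: LU; apply/funext => l; apply/funext => v.
  by rewrite /join /updw /fword /looped; case: ifP => _; case: ifP.
set W1 := looped W nn tt in L1; set w1 := looped w nn tt in L1.
pose h := (j - i)%N; pose Ws := looped W1 i h.
have h0 : (0 < h)%N by rewrite subn_gt0.
have [J [a [J0 spl]]] := env_splice R Wn0 dl jn tt0.
rewrite -/W1 -/h -/Ws in spl.
have perS : periodic Ws i h.
  split=> //; first exact: leq_trans ni.
    by move=> l il; exact: looped_periodic.
  by move=> l v il; apply: (Ws_fin Wn0 dl jn tt0); exact: leq_trans ni il.
have Wsc : env R Ws c = 1.
  rewrite -(val_oneword R hk) /env; congr wval; apply/funext => l.
  have Wc l' : W l' c = oneword hk l' by rewrite /W /updw eqxx.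
  have W1c l' : W1 l' c = oneword hk l'.
    have [lt|ge] := ltnP l' nn; first by rewrite /W1 looped_prefix.
    have [q nq E] := looped_suffix W tt ge; rewrite /W1 E Wc.
    by apply: oneword_pos; exact: leq_trans nn0 _.
  have [lt|ge] := ltnP l i; first by rewrite /Ws looped_prefix.
  have [q iq E] := looped_suffix W1 h ge; rewrite /Ws E W1c.
  by apply: oneword_pos; apply: leq_trans (leq_trans ni _).
pose Wm := interleave Ws W2.
have perm := periodic_interleave perS per2; rewrite -/Wm in perm.
have Weven v : env R Wm v.*2 = env R Ws v by case: (env_interleave Ws W2 v).
have Wodd : (fun v => env R Wm v.*2.+1) = env R W2.
  by apply/funext => v; case: (env_interleave Ws W2 v).
(* Positive and negative parts, since formulas have no subtraction. *)
pose ap v := if 0 <= a v then (absz (a v) * d)%N else 0%N.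
pose an v := if 0 <= a v then 0%N else (absz (a v) * d)%N.
have apn v : (a v)%:~R * d%:R = (ap v)%:R - (an v)%:R :> R.
  rewrite /ap /an; case: (a v) => q.
    by rewrite natrM subr0 -pmulrn.
  by rewrite NegzE natrM sub0r intrN -pmulrn mulNr.
pose J1 := (J * g).-1; have J1E : J1.+1 = (J * g)%N by rewrite prednK // muln_gt0 J0.
pose S := line_union F D B c J1 ap an.
have fS : fam X S by exact: fam_line_union.
have S01 : S (env R Wm) `<=` `[0, 1].
  by move=> x [x0 x1 _]; rewrite /= in_itv /= x0 -Wsc -Weven.
have nS : nwd (S (env R Wm)).
  apply: (nwd_of_codense noD); first by apply/definable_fam; exists S, (env R Wm).
  apply: line_union_codense => //; rewrite Wodd.
  exact: countable_right_isolated.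
apply: noC; apply: (cantor_of_perfect_subset fS perm S01 nS (P := branches w w' i j nn tt)).
- by exists (fr R (branch w w' i j nn tt (fun=> true))), (fun=> true).
- exact: (branches_perfect dl jn tt0).
move=> _ [be _ <-] u v; set x := fr R _ => ux xv.
have [r [r0 ur rv]] : exists r, [/\ 0 < r, r <= x - u & r <= v - x].
  by exists (Num.min (x - u) (v - x)); rewrite lt_min !subr_gt0 ux xv !ge_min !lexx orbT.
have [q Hq] := kX_inv_small hk 1 r0.
(* The exponents of the two geometric progressions coincide at h b q. *)
pose N := (b * q)%N.
have hN : (h * N = b * (h * q))%N by rewrite /N mulnCA.
have := branch_close R hk w w' i j nn tt be N; rewrite -/x -/h -/w1.
set y := fr R (splice _ _ _ _) => xy.
have {}xy : `|x - y| < r.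
  apply: le_lt_trans xy _; rewrite -[ltLHS]mul1r Hq // hN.
  by rewrite mulnA leq_pmull // muln_gt0 b0.
exists y; move: xy; rewrite ltr_norml => /andP[xy1 xy2]; split; [|lra|lra].
split; [exact: fr_ge0|by rewrite Weven Wsc fr_le1|].
exists (g%:R / d%:R / k%:R ^+ (b * (h * q))), (env R (splice Ws W1 (i + h * N) j)).
split; first by rewrite Wodd.
  move=> v' _; rewrite /on_line spl Weven hN J1E.
  have kq : k%:R ^+ (b * (h * q)) != 0 :> R by rewrite (kX_neq0 R hk).
  have := apn v'.+1; move: (k%:R ^+ _ : R) kq => kq kq0 Ea.
  rewrite ![_ *+ _.+1]mulrSr ![_ *+ (J * g)%N]mulrnDl.
  rewrite -addrA; congr (_ + _); rewrite addrA; congr (_ + _).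
  rewrite -[_ *+ ap _]mulr_natr -[_ *+ an _]mulr_natr -[_ *+ (J * g)]mulr_natr.
  have -> : (ap v'.+1)%:R = (a v'.+1)%:~R * d%:R + (an v'.+1)%:R :> R by rewrite Ea subrK.
  rewrite natrM; field; rewrite kq0 !pnatr_eq0; lia.
exact: (pump_branch Wn0 rmu LF dl jn tt0 L1).
Qed.

End Contradiction.

(** * Sets whose dimensions differ *)

Lemma interval_dims (R : realType) (A : set R) a b dB dH : A `<=` `[0, 1] -> a < b ->
  (forall x, a < x -> x < b -> A x) -> box_dim A dB -> hausdorff_dim A dH -> dB = dH.
Proof.
move=> A01 ab abA [_ _ lB] hH.
have [|_ _ l1] := @box_dim_dense R A a b A01 ab.
  by move=> x ax xb; apply: sub_oclosure; exact: abA.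
have -> : dB = 1 by exact: (cvg_unique _ lB l1).
apply/eqP; rewrite eq_le (hausdorff_dim_ge1 ab abA hH).
by rewrite (hausdorff_dim_le1 A01 hH).
Qed.

Theorem theoremD (R : realType) (k n : nat) (hk : (2 <= k)%N) (hn : (1 <= n)%N)
    (X : set 'rV[R]_n) (hX : X `<=` @unit_cube R n) (haut : automatic k X) :
  (exists A : set R,
      [/\ A `<=` `[0, 1]%classic, definable X A &
          exists dB dH : R, [/\ box_dim A dB, hausdorff_dim A dH & dB <> dH]])
  <->
  ((exists C : set R, cantor_set C /\ definable X C) \/
   (exists D : set R, definable X D /\
      exists J : set R,
        [/\ is_interval J, interior J !=set0 & dense_codense_on J D])).
Proof.
split; last first.
  case=> [[C [cC dC]]|[D [dD [J [iJ J0 dcJ]]]]].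
    exact: (@cantor_case R k hk n X haut C).
  exact: (@dense_codense_case R k hk n X haut D J).
move=> [A [A01 dA [dB [dH [bA hA ne]]]]]; apply: contrapT => /not_orP[noC noD].
apply: ne; have [coA|/existsNP[a /existsNP[b /not_implyP[ab no]]]] := pselect (codense A).
  have tA : thin A.
    exact: (nwd_definable_thin hk haut noC noD dA A01 (nwd_of_codense noD dA coA)).
  rewrite (thin_box_dim tA bA) (thin_hausdorff_dim _ tA hA) //.
  by case: bA => _ /bndP.
apply: (@interval_dims R A a b) => // x ax xb; apply: contrapT => nAx.
by apply: no; exists x.
Qed.
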